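(* Let $(S,\mathcal F,\mathcal L)$ be a $p$-local finite group and let $Bi\colon BS\to|\mathcal L|$ be the standard inclusion. Then $(S,\mathcal F,\mathcal L)$ is nilpotent if and only if one of the following four conditions is satisfied: (1) $Bi^*\colon H^1(|\mathcal L|;\mathbb F_p)\to H^1(BS;\mathbb F_p)$ is an isomorphism; (2) $Bi^*\colon H^2(|\mathcal L|;\mathbb F_p)\to H^2(BS;\mathbb F_p)$ is an isomorphism; (3) $Bi_*\colon H_1(BS;\mathbb F_p)\to H_1(|\mathcal L|;\mathbb F_p)$ is an isomorphism; (4) $Bi_*\colon H_2(BS;\mathbb F_p)\to H_2(|\mathcal L|;\mathbb F_p)$ is an isomorphism.
   Context: Let $p$ be a prime and $S$ a finite $p$-group. For $P,Q\le S$, $\mathrm{Hom}_S(P,Q)$ is the set of maps $c_g\colon x\mapsto gxg^{-1}$ with $g\in S$, $gPg^{-1}\le Q$, and $\mathrm{Aut}_S(P)=\mathrm{Hom}_S(P,P)$. A fusion system $\mathcal F$ over $S$ is a category whose objects are the subgroups of $S$, with $\mathrm{Hom}_S(P,Q)\subseteq\mathrm{Hom}_{\mathcal F}(P,Q)\subseteq \mathrm{Inj}(P,Q)$, such that every morphism factors as an $\mathcal F$-isomorphism followed by an inclusion. Subgroups are $\mathcal F$-conjugate if they are isomorphic in $\mathcal F$. $P$ is fully centralized (resp. fully normalized) if $|C_S(P)|\ge |C_S(P')|$ (resp. $|N_S(P)|\ge|N_S(P')|$) for all $P'$ $\mathcal F$-conjugate to $P$. $\mathcal F$ is saturated if (I)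 every fully normalized $P$ is fully centralized and $\mathrm{Aut}_S(P)$ is a Sylow $p$-subgroup of $\mathrm{Aut}_{\mathcal F}(P)$, and (II) whenever $\phi\in\mathrm{Hom}_{\mathcal F}(P,S)$ with $\phi(P)$ fully centralized, $\phi$ extends to a morphism in $\mathcal F$ defined on $N_\phi=\{g\in N_S(P):\phi c_g\phi^{-1}\in \mathrm{Aut}_S(\phi(P))\}$. $P$ is $\mathcal F$-centric if $C_S(P')\le P'$ for all $P'$ $\mathcal F$-conjugate to $P$; $\mathcal F^c$ is the full subcategory on these. A centric linking system associated to $\mathcal F$ is a category $\mathcal L$ with objects the $\mathcal F$-centric subgroups, a functor $\pi\colon\mathcal L\to\mathcal F^c$ which is the identity on objects, and monomorphisms $\delta_P\colon P\to\mathrm{Aut}_{\mathcal L}(P)$, such that (A) $Z(P)$ (via $\delta_P$) acts freely on $\mathrm{Mor}_{\mathcal L}(P,Q)$ by composition and $\pi$ induces a bijection $\mathrm{Mor}_{\mathcal L}(P,Q)/Z(P)\to\mathrm{Hom}_{\mathcal F}(P,Q)$; (B) $\pi(\delta_P(g))=c_g$ for $g\in P$; (C) $f\circ\delta_P(g)=\delta_Q(\pi(f)(g))\circ f$ for $f\in\mathrm{Mor}_{\mathcal L}(P,Q)$, $g\in P$. A $p$-local finite group is a triple $(S,\mathcal F,\mathcal L)$ with $\mathcal F$ a saturated fusion system over $S$ and $\mathcal L$ an associated centric linking system; $|\mathcal L|$ is the geometric realization of the nerve of $\mathcal L$. $(S,\mathcal F,\mathcal L)$ is called nilpotent if $\mathcal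 F=\mathcal F_S(S)$, the fusion system with $\mathrm{Hom}_{\mathcal F_S(S)}(P,Q)=\mathrm{Hom}_S(P,Q)$. The standard inclusion $Bi\colon BS\to|\mathcal L|$ is induced by the functor from the one-object category of $S$ to $\mathcal L$ sending the object to $S$ and $g$ to $\delta_S(g)$. *)

(* Defs.v *)
From HB Require Import structures.
From mathcomp Require Import all_boot all_order all_algebra all_fingroup all_solvable.
From mathcomp Require Import pgroup.

Set Implicit Arguments.
Unset Strict Implicit.
Unset Printing Implicit Defensive.

Import GRing.Theory.

(* A morphism P -> Q of a fusion system over S is represented by a finite   *)
(* function f : gT -> gT which is an injective homomorphism on P, with      *)
(* image in Q, and which is normalized to be 1 outside P (so that equal     *)
(* homomorphisms P -> Q have equal representatives).                        *)
(* A fusion system is given by F : {set gT} -> {set gT} -> {set {ffun ..}}, *)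
(* F P Q = Hom_F(P,Q); only its values on subgroups of S matter.            *)

Record linking_data (gT : finGroupType) := LinkingData {
  lmor : finType;
  lsrc : lmor -> {group gT};
  ltgt : lmor -> {group gT};
  lcomp : lmor -> lmor -> lmor;      (* lcomp f g = f o g *)
  lid : {group gT} -> lmor;
  lpi : lmor -> {ffun gT -> gT};
  ldelta : {group gT} -> gT -> lmor
}.
Arguments lmor {gT} l.
Arguments lsrc {gT} l _.
Arguments ltgt {gT} l _.
Arguments lcomp {gT} l _ _.
Arguments lid {gT} l _.
Arguments lpi {gT} l _.
Arguments ldelta {gT} l _ _.

Section Fusion.
Variable gT : finGroupType.
Local Open Scope group_scope.

Definition fmor := {ffun gT -> gT}.

Definition conjm (P : {set gT}) (g : gT) : fmor :=
  [ffun x => if x \in P then g * x * g^-1 else 1].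

Definition fcomp (P : {set gT}) (g f : fmor) : fmor :=
  [ffun x => if x \in P then g (f x) else 1].

Definition fimage (f : fmor) (P : {set gT}) : {set gT} := [set f x | x in P].

Definition injhom (P Q : {set gT}) (f : fmor) : bool :=
  [&& [forall x, (x \notin P) ==> (f x == 1)],
      [forall x in P, forall y in P, f (x * y) == f x * f y],
      [forall x in P, forall y in P, (f x == f y) ==> (x == y)]
    & fimage f P \subset Q].

Definition HomS (S P Q : {set gT}) : {set fmor} :=
  [set conjm P g | g in S & [set g * x * g^-1 | x in P] \subset Q].

Definition AutS (S P : {set gT}) : {set fmor} := [set conjm P g | g in 'N_S(P)].

Definition fsys := {set gT} -> {set gT} -> {set fmor}.

Definition fusion_system (S : {group gT}) (F : fsys) : Prop :=
  forall P Q R : {group gT}, P \subset S -> Q \subset S -> R \subset S ->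
  [/\ HomS S P Q \subset F P Q,
      (forall f, f \in F P Q -> injhom P Q f),
      (* every morphism is an F-isomorphism followed by an inclusion *)
      (forall f, f \in F P Q ->
         f \in F P (fimage f P) /\
         exists2 g, g \in F (fimage f P) P & forall x, x \in P -> g (f x) = x)
    &
      (forall f g, f \in F P Q -> g \in F Q R -> fcomp P g f \in F P R)].

Definition Fconj (F : fsys) (P Q : {set gT}) : bool :=
  [exists f in F P Q, fimage f P == Q].

Definition fully_centralized (S : {group gT}) (F : fsys) (P : {set gT}) : Prop :=
  forall Q : {group gT}, Q \subset S -> Fconj F P Q -> #|'C_S(Q)| <= #|'C_S(P)|.

Definition fully_normalized (S : {group gT}) (F : fsys) (P : {set gT}) : Prop :=
  forall Q : {group gT}, Q \subset S -> Fconj F P Q -> #|'N_S(Q)| <= #|'N_S(P)|.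

Definition Nphi (S P : {set gT}) (f : fmor) : {set gT} :=
  [set g in 'N_S(P) | [exists h in S, [forall x in P,
       f (g * x * g^-1) == h * f x * h^-1]]].

Definition saturated (p : nat) (S : {group gT}) (F : fsys) : Prop :=
  fusion_system S F /\
  (* axiom (I): Aut_S(P) is a Sylow p-subgroup of Aut_F(P) = F P P *)
  (forall P : {group gT}, P \subset S -> fully_normalized S F P ->
     fully_centralized S F P /\
     (p.-nat #|AutS S P| /\ p^'.-nat (#|F P P| %/ #|AutS S P|))) /\
  (forall (P : {group gT}) (f : fmor), P \subset S -> f \in F P S ->
     fully_centralized S F (fimage f P) ->
     exists2 g, g \in F (Nphi S P f) S & forall x, x \in P -> g x = f x).

Definition Fcentric (S : {group gT}) (F : fsys) (P : {set gT}) : bool :=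
  (P \subset S) &&
  [forall Q : {group gT}, ((Q \subset S) && Fconj F P Q) ==> ('C_S(Q) \subset Q)].

Definition nilpotent_fs (S : {group gT}) (F : fsys) : Prop :=
  forall P Q : {group gT}, P \subset S -> Q \subset S -> F P Q = HomS S P Q.

Definition linking_system (S : {group gT}) (F : fsys) (L : linking_data gT) : Prop :=
  let cent := Fcentric S F in
  let comp := lcomp L in
  [/\ (forall f, cent (lsrc L f) /\ cent (ltgt L f)),
      (forall P : {group gT}, cent P -> lsrc L (lid L P) = P /\ ltgt L (lid L P) = P),
      (forall f g, lsrc L f = ltgt L g ->
          lsrc L (comp f g) = lsrc L g /\ ltgt L (comp f g) = ltgt L f),
      (forall f g h, lsrc L f = ltgt L g -> lsrc L g = ltgt L h ->
          comp f (comp g h) = comp (comp f g) h)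
    & (forall f, comp (lid L (ltgt L f)) f = f /\ comp f (lid L (lsrc L f)) = f)] /\
  [/\ (forall f, lpi L f \in F (lsrc L f) (ltgt L f)),
      (forall f g, lsrc L f = ltgt L g ->
          lpi L (comp f g) = fcomp (lsrc L g) (lpi L f) (lpi L g))
    & (forall P : {group gT}, cent P -> lpi L (lid L P) = conjm P 1)] /\
  (forall P : {group gT}, cent P ->
     [/\ (forall g, g \in P -> lsrc L (ldelta L P g) = P /\ ltgt L (ldelta L P g) = P),
         (forall g h, g \in P -> h \in P ->
            ldelta L P (g * h) = comp (ldelta L P g) (ldelta L P h)),
         ldelta L P 1 = lid L P
       & (forall g h, g \in P -> h \in P -> ldelta L P g = ldelta L P h -> g = h)]) /\
  (forall P Q : {group gT}, cent P -> cent Q ->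
     [/\ (forall f z, lsrc L f = P -> ltgt L f = Q -> z \in 'Z(P) ->
            comp f (ldelta L P z) = f -> z = 1),
         (forall phi, phi \in F P Q ->
            exists f, [/\ lsrc L f = P, ltgt L f = Q & lpi L f = phi])
       & (forall f f', lsrc L f = P -> ltgt L f = Q -> lsrc L f' = P -> ltgt L f' = Q ->
            lpi L f = lpi L f' -> exists2 z, z \in 'Z(P) & f' = comp f (ldelta L P z))]) /\
  (forall (P : {group gT}) g, cent P -> g \in P -> lpi L (ldelta L P g) = conjm P g) /\
  (forall f g, g \in lsrc L f ->
     comp f (ldelta L (lsrc L f) g) = comp (ldelta L (ltgt L f) (lpi L f g)) f).

End Fusion.

(* The mod-p (co)homology of the geometric realization |N C| is computed as *)
(* the (co)homology of the (unnormalized) simplicial chain complex of the   *)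
(* nerve N C with coefficients in F_p.                                      *)

Record catdata := CatData {
  cobj : finType;
  cob : pred cobj;
  cmor : finType;
  cvalid : pred cmor;
  csrc : cmor -> cobj;
  ctgt : cmor -> cobj;
  ccomp : cmor -> cmor -> cmor  (* ccomp g f = g o f *)
}.
Arguments cob : clear implicits.
Arguments cvalid : clear implicits.
Arguments csrc : clear implicits.
Arguments ctgt : clear implicits.
Arguments ccomp : clear implicits.

Section Nerve.
Variable C : catdata.

Fixpoint chainc (x : cobj C) (s : seq (cmor C)) : bool :=
  match s with
  | [::] => true
  | f :: s' => [&& cvalid C f, csrc C f == x & chainc (ctgt C f) s']
  end.

(* an n-simplex  x0 -f1-> x1 -f2-> ... -fn-> xn  is (x0, [:: f1; ...; fn]) *)
Definition nerve_ok (x : cobj C) (s : seq (cmor C)) : bool := cob C x && chainc x s.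

Definition simplex (n : nat) := {x : cobj C * n.-tuple (cmor C) | nerve_ok x.1 x.2}.

Definition raw n (s : simplex n) : cobj C * seq (cmor C) := ((val s).1, val (val s).2).

(* inner/last faces on the morphism list (i >= 1) *)
Fixpoint fc (i : nat) (s : seq (cmor C)) : seq (cmor C) :=
  match s with
  | [::] => [::]
  | f :: s' =>
    match i with
    | 0 => s
    | i'.+1 => if i' is 0 then
                 (match s' with [::] => [::] | g :: s'' => ccomp C g f :: s'' end)
               else f :: fc i' s'
    end
  end.

Definition face (i : nat) (x : cobj C * seq (cmor C)) : cobj C * seq (cmor C) :=
  if i is 0 then (if x.2 is f :: s then (ctgt C f, s) else x)
  else (x.1, fc i x.2).

End Nerve.
Arguments raw {C n} s.
Arguments face : clear implicits.
Arguments simplex : clear implicits.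


Section Homology.
Variable p : nat.
Local Open Scope ring_scope.

Definition chains (C : catdata) n := {ffun simplex C n -> 'F_p}.

Definition bd (C : catdata) n (c : chains C n.+1) : chains C n :=
  [ffun t => \sum_(s : simplex C n.+1) \sum_(i < n.+2)
      (if face C i (raw s) == raw t then (-1) ^+ i * c s else 0)].

Definition cobd (C : catdata) n (u : chains C n) : chains C n.+1 :=
  [ffun s => \sum_(i < n.+2) \sum_(t : simplex C n)
      (if raw t == face C i (raw s) then (-1) ^+ i * u t else 0)].

Section Map.
Variables (C1 C2 : catdata) (fo : cobj C1 -> cobj C2) (fm : cmor C1 -> cmor C2).

Definition fmap_raw (x : cobj C1 * seq (cmor C1)) : cobj C2 * seq (cmor C2) :=
  (fo x.1, map fm x.2).

Definition push n (c : chains C1 n) : chains C2 n :=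
  [ffun t => \sum_(s : simplex C1 n) (if fmap_raw (raw s) == raw t then c s else 0)].

Definition pull n (u : chains C2 n) : chains C1 n :=
  [ffun s => \sum_(t : simplex C2 n) (if raw t == fmap_raw (raw s) then u t else 0)].

(* the induced map H_{n+1}(N C1; F_p) -> H_{n+1}(N C2; F_p) is bijective *)
Definition homology_iso n : Prop :=
  (forall z : chains C2 n.+1, bd z = 0 ->
     exists w : chains C1 n.+1, bd w = 0 /\
       exists b : chains C2 n.+2, z = push w + bd b) /\
  (forall w : chains C1 n.+1, bd w = 0 ->
     (exists b : chains C2 n.+2, push w = bd b) ->
     exists b' : chains C1 n.+2, w = bd b').

(* the induced map H^{n+1}(N C2; F_p) -> H^{n+1}(N C1; F_p) is bijective *)
Definition cohomology_iso n : Prop :=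
  (forall u : chains C1 n.+1, cobd u = 0 ->
     exists v : chains C2 n.+1, cobd v = 0 /\
       exists a : chains C1 n, u = pull v + cobd a) /\
  (forall v : chains C2 n.+1, cobd v = 0 ->
     (exists a : chains C1 n, pull v = cobd a) ->
     exists a' : chains C2 n, v = cobd a').

End Map.
End Homology.

Section BS.
Variable gT : finGroupType.
Local Open Scope group_scope.

Definition BScat (S : {group gT}) : catdata :=
  @CatData unit predT gT (fun g => g \in S) (fun _ => tt) (fun _ => tt)
           (fun g h => g * h).

Definition Lcat (S : {group gT}) (F : fsys gT)
    (L : linking_data gT) : catdata :=
  @CatData {group gT} (fun P => Fcentric S F P) (lmor L) predT
           (lsrc L) (ltgt L) (lcomp L).

Definition Bi_obj (S : {group gT}) (_ : unit) : {group gT} := S.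
Definition Bi_mor (S : {group gT}) (L : linking_data gT) (g : gT) : lmor L :=
  ldelta L S g.

End BS.

(* Main.v *)
Require Import Defs.
From HB Require Import structures.
From mathcomp Require Import all_boot all_order all_algebra all_fingroup all_solvable.
From mathcomp Require Import all_field all_character.
From mathcomp Require Import pgroup ring zify.

(** Only centric subgroups are objects of L, so stability of classes is known only for automorphisms
    of centric subgroups. Alperin's theorem is therefore stated as an induction principle for
    arbitrary properties of morphisms, and serves both the focal arguments and the descent modulo E.
    The biset is a disjoint union of coset spaces of graphs of F-morphisms in S x S. Its
    F-invariance means that numbers of fixed points agree; these are corrected in decreasing order
    of subgroups, and Burnside's counting lemma shows that each defect is divisible by what one new
    orbit contributes. Its size is prime to p because Aut_S(S) is Sylow in Aut_F(S). In degree 2,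
    invariance of a class holds only up to a cochain k with values in F_p, about which nothing is
    known. Multiplication by p removes k; this is why elements with g^p in P' come first. K =
    [E,S]E^p makes S act trivially on E/K and gives E/K exponent p. The first makes E -> E/K
    invariant under S, the second makes the auxiliary homomorphism on S vanish on Phi(S), the only
    subgroup modulo which fusion is known to be trivial at the outset. *)

(* If F = F_S(S), every morphism of L extends uniquely over chosen inclusions
   P -> S to an element of S; this is a functor L -> BS retracting BS -> L, and
   the inclusions are a natural transformation to the identity, so Bi is an
   isomorphism on cohomology. Homology and cohomology isomorphisms are equivalent
   by linear duality over F_p.
     Conversely, surjectivity of Bi^* makes all classes of S stable under
   F-automorphisms of centric subgroups. In degree 1 this says that F acts
   trivially modulo Phi(S), by Alperin's fusion theorem. In degree 2, Bockstein
   classes of linear characters show that F acts trivially modulo S' on elements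
   g of P with g^p in P', and the transfer of the characteristic biset
   (Broto-Levi-Oliver) S -> S/S' extends this to all elements. Finally, Tate's
   theorem: let E be a normal subgroup of S such that all morphisms are
   S-conjugations modulo E, and let K = [E,S]E^p. The transfer of E -> E/K is
   F-invariant, and differs from a multiple prime to p of E -> E/K by the
   restriction of a homomorphism S -> E/K, which is F-invariant since it kills
   Phi(S). So F acts trivially on E modulo K, which kills the p'-automorphisms
   modulo K; hence all morphisms are S-conjugations modulo K, and E descends to 1. *)

Set Implicit Arguments.
Unset Strict Implicit.
Unset Printing Implicit Defensive.

Import GRing.Theory.
Local Open Scope group_scope.

(** * Morphisms of a fusion system *)

Lemma eq_mem_imp (T : finType) (x y : T) (A : {set T}) : x = y -> x \in A -> y \in A.
Proof. by move->. Qed.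

Section FusionMaps.
Variables (gT : finGroupType) (S : {group gT}) (F : fsys gT).
Implicit Types (P Q R : {group gT}) (f g : gT -> gT).

(** Morphisms to S are plain functions, truncated to 1 off P only for the membership test. Values
    off P are thus irrelevant, and composition and restriction need no normalization. *)
Definition Fm (P : {set gT}) (f : gT -> gT) : bool :=
  [ffun x => if x \in P then f x else 1] \in F P S.

(** The generated subgroup is a group for every [f]; for a morphism it is the image itself, by
    [homimgE]. *)
Definition homimg (f : gT -> gT) (P : {set gT}) : {group gT} := generated_group (imset f (mem P)).

Hypothesis fusF : fusion_system S F.

Lemma Fm_ext P f g : {in P, f =1 g} -> Fm P f = Fm P g.
Proof.
move=> efg; apply: (congr1 (fun h => h \in F P S)); apply/ffunP => x; rewrite !ffunE.
by case: ifP => // Px; apply: efg.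
Qed.

Lemma in_fsys P Q (f : {ffun gT -> gT}) : P \subset S -> Q \subset S ->
  f \in F P Q =
  [&& Fm P f, [forall x in P, f x \in Q] & [forall x, (x \notin P) ==> (f x == 1)]].
Proof.
move=> sPS sQS; apply/idP/idP.
  move=> Ff; have [_ /(_ _ Ff)/and4P[f1 _ _ fQ] _ _] := fusF sPS sQS sQS.
  have -> : [forall x in P, f x \in Q].
    by apply/forall_inP=> x Px; apply: (subsetP fQ); apply/imsetP; exists x.
  rewrite f1 !andbT.
  have [_ _ _ /(_ f (conjm Q 1) Ff)] := fusF sPS sQS (subxx S).
  have -> : conjm Q 1 \in F Q S.
    have [/subsetP sub _ _ _] := fusF sQS (subxx S) (subxx S).
    apply: sub; apply/imsetP; exists 1 => //; rewrite inE group1 /=.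
    by apply/subsetP=> _ /imsetP[x Qx ->]; rewrite mul1g invg1 mulg1 (subsetP sQS).
  move/(_ isT); rewrite /Fm; apply: eq_mem_imp; apply/ffunP => x; rewrite !ffunE.
  case: ifP => // Px; rewrite (subsetP fQ) ?mul1g ?invg1 ?mulg1 //.
  by apply/imsetP; exists x.
case/and3P=> Ff /forall_inP fQ /forallP f1.
have Ef : f = [ffun x => if x \in P then f x else 1].
  apply/ffunP=> x; rewrite ffunE; case: ifP => // /negbT Px.
  by have /implyP/(_ Px)/eqP := f1 x.
rewrite /Fm -Ef in Ff.
have [_ fh dec _] := fusF sPS (subxx S) (subxx S).
have [fim _] := dec _ Ff.
have /and4P[_ /forall_inP fM fI fimS] := fh _ Ff.
have gI : group_set (fimage f P).
  apply/group_setP; split=> [|_ _ /imsetP[x Px ->] /imsetP[y Py ->]].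
    apply/imsetP; exists 1 => //.
    have /forall_inP/(_ _ (group1 P))/eqP := fM 1 (group1 P).
    by rewrite mulg1 => e; apply: (mulgI (f 1)); rewrite -e mulg1.
  have /forall_inP/(_ _ Py)/eqP e := fM x Px.
  by apply/imsetP; exists (x * y); rewrite ?groupM.
have [_ _ _ cmp] := fusF sPS (fimS : Group gI \subset S) sQS.
have := cmp f (conjm (Group gI) 1) fim.
have -> : conjm (Group gI) 1 \in F (Group gI) Q.
  have [/subsetP sub _ _ _] := fusF (fimS : Group gI \subset S) sQS sQS.
  apply: sub; apply/imsetP; exists 1 => //; rewrite inE group1 /=.
  apply/subsetP=> _ /imsetP[_ /imsetP[y Py ->] ->].
  by rewrite mul1g invg1 mulg1 fQ.
move/(_ isT); apply: eq_mem_imp; apply/ffunP=> x; rewrite !ffunE.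
case: ifP => [Px|/negbT Px]; last by have /implyP/(_ Px)/eqP -> := f1 x.
have -> : f x \in Group gI by apply/imsetP; exists x.
by rewrite mul1g invg1 mulg1.
Qed.

Lemma Fm_M P f : P \subset S -> Fm P f -> {in P &, {morph f : x y / x * y}}.
Proof.
move=> sPS Ff x y Px Py.
have [_ fh _ _] := fusF sPS (subxx S) (subxx S).
have /and4P[_ /forall_inP/(_ x Px)/forall_inP/(_ y Py)/eqP + _ _] := fh _ Ff.
by rewrite !ffunE groupM ?Px ?Py.
Qed.

Lemma Fm_inj P f : P \subset S -> Fm P f -> {in P &, injective f}.
Proof.
move=> sPS Ff x y Px Py e.
have [_ fh _ _] := fusF sPS (subxx S) (subxx S).
have /and4P[_ _ /forall_inP/(_ x Px)/forall_inP/(_ y Py)/implyP + _] := fh _ Ff.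
by rewrite !ffunE Px Py e eqxx => /(_ isT)/eqP.
Qed.

Lemma Fm_in P f x : P \subset S -> Fm P f -> x \in P -> f x \in S.
Proof.
move=> sPS Ff Px.
have [_ fh _ _] := fusF sPS (subxx S) (subxx S).
have /and4P[_ _ _ /subsetP/(_ (f x))] := fh _ Ff.
by apply; apply/imsetP; exists x; rewrite ?ffunE ?Px.
Qed.

Lemma Fm_1 P f : P \subset S -> Fm P f -> f 1 = 1.
Proof.
move=> sPS Ff; apply: (mulgI (f 1)).
by rewrite mulg1 -(Fm_M sPS Ff) ?group1 // mulg1.
Qed.

Lemma Fm_V P f : P \subset S -> Fm P f -> {in P, {morph f : x / x^-1}}.
Proof.
move=> sPS Ff x Px; apply: (mulgI (f x)).
by rewrite -(Fm_M sPS Ff) ?groupV // !mulgV (Fm_1 sPS Ff).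
Qed.

Lemma Fm_X P f : P \subset S -> Fm P f -> forall n, {in P, {morph f : x / x ^+ n}}.
Proof.
move=> sPS Ff n x Px; elim: n => [|n IHn]; first by rewrite !expg0 (Fm_1 sPS Ff).
by rewrite !expgS (Fm_M sPS Ff) ?groupX // IHn.
Qed.

Lemma homimgE P f : P \subset S -> Fm P f -> homimg f P = f @: P :> {set gT}.
Proof.
move=> sPS Ff; rewrite /homimg /=.
have gI : group_set (f @: P).
  apply/group_setP; split=> [|_ _ /imsetP[x Px ->] /imsetP[y Py ->]].
    by apply/imsetP; exists 1; rewrite ?group1 ?(Fm_1 sPS Ff).
  by apply/imsetP; exists (x * y); rewrite ?groupM ?(Fm_M sPS Ff).
exact: (genGid (Group gI)).
Qed.

Lemma mem_homimg P f x : x \in P -> f x \in homimg f P.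
Proof. by move=> Px; apply: mem_gen; apply: imset_f. Qed.

Lemma homimg_sub P f : P \subset S -> Fm P f -> homimg f P \subset S.
Proof.
move=> sPS Ff; rewrite homimgE //; apply/subsetP=> _ /imsetP[x Px ->].
exact: Fm_in Px.
Qed.

Lemma card_homimg P f : P \subset S -> Fm P f -> #|homimg f P| = #|P|.
Proof. by move=> sPS Ff; rewrite homimgE // card_in_imset //; apply: Fm_inj. Qed.

Lemma homimg_eq P Q f : P \subset S -> Fm P f -> (forall x, x \in P -> f x \in Q) ->
  #|Q| <= #|P| -> homimg f P = Q :> {set gT}.
Proof.
move=> sPS Ff fQ le; apply/eqP; rewrite eqEcard card_homimg // le andbT homimgE //.
by apply/subsetP=> _ /imsetP[x Px ->]; apply: fQ.
Qed.

Lemma Fm_fsys P Q f : P \subset S -> Q \subset S -> Fm P f ->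
  (forall x, x \in P -> f x \in Q) -> [ffun x => if x \in P then f x else 1] \in F P Q.
Proof.
move=> sPS sQS Ff fQ; rewrite in_fsys //; apply/and3P; split.
- rewrite (@Fm_ext _ _ f) // => x Px; by rewrite ffunE Px.
- by apply/forall_inP=> x Px; rewrite ffunE Px fQ.
by apply/forallP=> x; apply/implyP=> /negbTE Px; rewrite ffunE Px.
Qed.

Lemma Fm_comp P Q f g : P \subset S -> Q \subset S -> Fm P f ->
  (forall x, x \in P -> f x \in Q) -> Fm Q g -> Fm P (g \o f).
Proof.
move=> sPS sQS Ff fQ Fg; have Ff' := Fm_fsys sPS sQS Ff fQ.
have [_ _ _ /(_ _ _ Ff' Fg)] := fusF sPS sQS (subxx S).
rewrite /Fm; apply: eq_mem_imp; apply/ffunP=> x; rewrite !ffunE.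
by case Px: (x \in P); rewrite ?Px //= fQ.
Qed.

Lemma Fm_conj P s : P \subset S -> s \in S -> Fm P (fun x => s * x * s^-1).
Proof.
move=> sPS Ss; have [/subsetP sub _ _ _] := fusF sPS (subxx S) (subxx S).
apply: sub; apply/imsetP; exists s => //; rewrite inE Ss /=.
apply/subsetP=> _ /imsetP[x Px ->]; by rewrite !groupM ?groupV ?(subsetP sPS x Px).
Qed.

Lemma Fm_id P : P \subset S -> Fm P id.
Proof.
move=> sPS; rewrite (@Fm_ext _ _ (fun x => 1 * x * 1^-1)) ?Fm_conj //.
by move=> x _; rewrite mul1g invg1 mulg1.
Qed.

Lemma Fm_sub P Q f : Q \subset S -> P \subset Q -> Fm Q f -> Fm P f.
Proof.
move=> sQS sPQ Ff; have sPS := subset_trans sPQ sQS.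
by apply: (Fm_comp sPS sQS (Fm_id sPS) _ Ff) => x; apply: (subsetP sPQ).
Qed.

Lemma Fm_inv P f : P \subset S -> Fm P f ->
  exists g, [/\ Fm (homimg f P) g, forall x, x \in P -> g (f x) = x,
                (forall y, y \in homimg f P -> g y \in P)
              & forall y, y \in homimg f P -> f (g y) = y].
Proof.
move=> sPS Ff; have [_ _ dec _] := fusF sPS (subxx S) (subxx S).
have [_ [g Fg gK]] := dec _ Ff.
have Eim : fimage [ffun x => if x \in P then f x else 1] P = homimg f P.
  rewrite homimgE //; apply: eq_in_imset => x Px; by rewrite ffunE Px.
rewrite {}Eim in Fg; rewrite in_fsys ?homimg_sub // in Fg.
have [Fg1 /forall_inP gP _] := and3P Fg.
have gfK x : x \in P -> g (f x) = x by move=> Px; rewrite -{2}(gK x Px) ffunE Px.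
exists g; split=> // y; rewrite homimgE // => /imsetP[x Px ->].
by rewrite gfK.
Qed.

Lemma eq_homimg P f g : {in P, f =1 g} -> homimg f P = homimg g P.
Proof. by move=> e; apply: val_inj; rewrite /= (eq_in_imset e). Qed.

Lemma Fconj_homimg P f : P \subset S -> Fm P f -> Fconj F P (homimg f P).
Proof.
move=> sPS Ff; apply/existsP; exists [ffun x => if x \in P then f x else 1].
rewrite Fm_fsys ?homimg_sub //; last by move=> x; apply: mem_homimg.
rewrite homimgE //= /fimage; apply/eqP; apply: eq_in_imset => x Px.
by rewrite ffunE Px.
Qed.

Lemma FconjP P Q : P \subset S -> Q \subset S ->
  reflect (exists2 f, Fm P f & homimg f P = Q) (Fconj F P Q).
Proof.
move=> sPS sQS; apply: (iffP existsP) => [[f /andP[Ff /eqP fPQ]]|[f Ff <-]].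
  rewrite in_fsys // in Ff; case/and3P: Ff => Ff _ _; exists f => //.
  by apply: group_inj; rewrite -fPQ homimgE.
by have /existsP := Fconj_homimg sPS Ff.
Qed.

Lemma homimg_comp P f g : P \subset S -> Fm P f -> Fm (homimg f P) g ->
  homimg (g \o f) P = homimg g (homimg f P).
Proof.
move=> sPS Ff Fg; have sfS := homimg_sub sPS Ff; apply: group_inj.
rewrite (homimgE sfS Fg) homimgE //; last by apply: Fm_comp Fg => // x; apply: mem_homimg.
by rewrite (homimgE sPS Ff) -imset_comp.
Qed.

Lemma Fconj_trans P Q R : P \subset S -> Q \subset S -> R \subset S ->
  Fconj F P Q -> Fconj F Q R -> Fconj F P R.
Proof.
move=> sPS sQS sRS /(FconjP sPS sQS)[f Ff <-] /(FconjP (homimg_sub sPS Ff) sRS)[g Fg <-].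
rewrite -homimg_comp //; apply: Fconj_homimg => //.
by apply: Fm_comp Fg; rewrite ?homimg_sub // => x; apply: mem_homimg.
Qed.

(** The normalizer order is maximized over the finite type of finite functions; by transitivity,
    every conjugate of the chosen image is again an image of P and so was among the candidates. *)
Lemma fully_normalized_rep P : P \subset S ->
  exists2 f, Fm P f & fully_normalized S F (homimg f P).
Proof.
move=> sPS.
pose ok (f : {ffun gT -> gT}) := Fm P f.
have ok0 : ok [ffun x => x].
  by rewrite /ok (@Fm_ext _ _ id) ?Fm_id // => x _; rewrite ffunE.
case: (@arg_maxnP _ [ffun x => x] ok (fun f : {ffun gT -> gT} => #|'N_S(homimg f P)|) ok0) => f Ff maxf.
exists f => // Q sQS cQ; have sfS := homimg_sub sPS Ff.
have /(FconjP sPS sQS)[g Fg Eg] := Fconj_trans sPS sfS sQS (Fconj_homimg sPS Ff) cQ.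
have Fg' : ok [ffun x => g x].
  by rewrite /ok (@Fm_ext _ _ g) // => x _; rewrite ffunE.
have := maxf _ Fg'; rewrite (@eq_homimg P [ffun x => g x] g) ?Eg //.
by move=> x Px; rewrite ffunE.
Qed.

End FusionMaps.

(** * Automorphism groups and the extension axiom *)

Section Saturated.
Variables (gT : finGroupType) (p : nat) (S : {group gT}) (F : fsys gT).
Implicit Types (P Q R N : {group gT}) (f g : gT -> gT).
Hypotheses (prp : prime p) (pS : p.-group S) (satF : saturated p S F).
Let fusF : fusion_system S F := satF.1.

Lemma Fm_conjg P s : P \subset S -> s \in S -> Fm S F P (conjg^~ s).
Proof.
move=> sPS Ss; rewrite (@Fm_ext _ _ _ _ _ (fun x => s^-1 * x * s^-1^-1)).
  by apply: Fm_conj; rewrite ?groupV.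
by move=> x _; rewrite /= conjgE invgK mulgA.
Qed.

Lemma Nphi_group_set P f : P \subset S -> Fm S F P f ->
  group_set (Nphi S P [ffun x => if x \in P then f x else 1]).
Proof.
move=> sPS Ff; apply/group_setP; split=> [|a b].
  rewrite inE group1; apply/existsP; exists 1; rewrite group1.
  by apply/forall_inP=> x Px; rewrite !mul1g invg1 !mulg1.
case/setIdP=> Na /existsP[h /andP[Sh /forall_inP ha]].
case/setIdP=> Nb /existsP[k /andP[Sk /forall_inP hb]].
have [_ nb] := setIP Nb.
apply/setIdP; split; first exact: groupM.
apply/existsP; exists (h * k); rewrite groupM //=.
apply/forall_inP=> x Px.
have Pb : b * x * b^-1 \in P.
  have -> : b * x * b^-1 = x ^ b^-1 by rewrite conjgE invgK mulgA.
  by rewrite memJ_norm ?groupV.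
have := ha _ Pb; rewrite (eqP (hb _ Px)) !invMg !mulgA => /eqP ->.
by rewrite ?mulgA.
Qed.

(** This is axiom (II) for any subgroup N of N_f, stated with the right conjugation [x ^ a] instead
    of c_a. *)
Lemma Fm_extend P N f : P \subset S -> N \subset 'N_S(P) -> Fm S F P f ->
    fully_centralized S F (homimg f P) ->
    (forall a, a \in N -> exists2 h, h \in S & forall x, x \in P -> f (x ^ a) = f x ^ h) ->
  exists2 g, Fm S F N g & {in P, g =1 f}.
Proof.
move=> sPS sN Ff fc ext; have [_ [_ ax2]] := satF.
have sNS : N \subset S by apply: subset_trans sN (subsetIl _ _).
set f' := [ffun x => if x \in P then f x else 1].
have Ef' : fimage f' P = homimg f P.
  by rewrite (homimgE fusF) //; apply: eq_in_imset => x Px; rewrite ffunE Px.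
have gN := Nphi_group_set sPS Ff.
have [|g Fg gf] := ax2 P f' sPS Ff; first by rewrite Ef'.
exists g; last by move=> x Px; rewrite gf // ffunE Px.
have sNN : N \subset Group gN.
  apply/subsetP=> a Na; rewrite inE (subsetP sN) //=.
  (* Since c_a is [x ^ a^-1], membership of a in N_f comes from the hypothesis at the inverse. *)
  have [|h Sh fh] := ext a^-1; first by rewrite groupV.
  apply/existsP; exists h^-1; rewrite groupV Sh; apply/forall_inP=> x Px.
  have -> : a * x * a^-1 = x ^ a^-1 by rewrite conjgE invgK mulgA.
  have /setIP[_ na] : a \in 'N_S(P) by apply: (subsetP sN).
  by rewrite !ffunE memJ_norm ?groupV // Px fh // conjgE invgK mulgA.
have sM : Group gN \subset S.
  by apply/subsetP=> a; rewrite /= !inE => /andP[/andP[]].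
apply: (Fm_sub fusF sM sNN).
by move: (Fg : g \in F (Group gN) S); rewrite (in_fsys fusF) // => /and3P[].
Qed.

(** Aut_F(Q) is realized by permutations of the whole group supported on Q, so that Sylow theory
    applies to it as to any finite group. *)
Definition AF Q : {group {perm gT}} :=
  generated_group [set s : {perm gT} | perm_on Q s && Fm S F Q s].

Lemma mem_AF Q s : Q \subset S -> (s \in AF Q) = perm_on Q s && Fm S F Q s.
Proof.
move=> sQS.
have gA : group_set [set s : {perm gT} | perm_on Q s && Fm S F Q s].
  apply/group_setP; split=> [|s1 s2].
    rewrite inE perm_on1 (@Fm_ext _ _ _ _ _ id) ?Fm_id // => x _; by rewrite perm1.
  rewrite !inE => /andP[on1 F1] /andP[on2 F2]; rewrite perm_onM //=.
  rewrite (@Fm_ext _ _ _ _ _ (s2 \o s1)); last by move=> x _; rewrite permM.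
  by apply: (Fm_comp fusF sQS sQS F1) => // x; rewrite perm_closed.
rewrite /AF -[RHS]/([fun s => perm_on Q s && Fm S F Q s] s).
by have /= -> := genGid (Group gA); rewrite inE.
Qed.

Lemma AF_in Q s x : Q \subset S -> s \in AF Q -> (s x \in Q) = (x \in Q).
Proof. by move=> sQS; rewrite mem_AF // => /andP[on _]; rewrite perm_closed. Qed.

Lemma AF_Fm Q s : Q \subset S -> s \in AF Q -> Fm S F Q s.
Proof. by move=> sQS; rewrite mem_AF // => /andP[]. Qed.

Lemma AF_perm Q f : Q \subset S -> Fm S F Q f -> (forall x, x \in Q -> f x \in Q) ->
  exists2 s, s \in AF Q & {in Q, s =1 f}.
Proof.
move=> sQS Ff fQ; pose h x := if x \in Q then f x else x.
have injh : injective h.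
  move=> x y; rewrite /h; case: ifP => Qx; case: ifP => Qy //.
  - exact: (Fm_inj fusF sQS Ff).
  - by move=> e; rewrite -e fQ in Qy.
  by move=> e; rewrite e fQ in Qx.
exists (perm injh); last by move=> x Qx; rewrite permE /h Qx.
rewrite mem_AF //; apply/andP; split.
  apply/subsetP=> x; rewrite inE permE /h; by case: ifP => //; rewrite eqxx.
by rewrite (@Fm_ext _ _ _ _ _ f) // => x Qx; rewrite permE /h Qx.
Qed.

Lemma AF_eq Q s t : Q \subset S -> s \in AF Q -> t \in AF Q -> {in Q, s =1 t} -> s = t.
Proof.
move=> sQS; rewrite !mem_AF // => /andP[os _] /andP[ot _] e.
apply/permP=> x; case Qx: (x \in Q); first exact: e.
by rewrite !(out_perm _ (negbT Qx)).
Qed.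

Lemma card_AF Q : Q \subset S -> #|AF Q| = #|F Q Q|.
Proof.
move=> sQS; pose rs (s : {perm gT}) : {ffun gT -> gT} := [ffun x => if x \in Q then s x else 1].
rewrite -(@card_in_imset _ _ rs (mem (AF Q))); last first.
  move=> s t As At e; apply: (AF_eq sQS As At) => x Qx.
  by have := congr1 (fun h : {ffun gT -> gT} => h x) e; rewrite !ffunE Qx.
apply: eq_card => h; apply/imsetP/idP=> [[s As ->]|Fh].
  by apply: Fm_fsys (AF_Fm _ As) _ => // x; rewrite (AF_in x sQS As).
rewrite (in_fsys fusF) // in Fh; case/and3P: Fh => Fh /forall_inP hQ /forallP h1.
have [s As sh] := AF_perm sQS Fh hQ; exists s => //.
apply/ffunP=> x; rewrite ffunE; case: ifP => [Qx|/negbT Qx]; first by rewrite sh.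
by apply/eqP; have /implyP := h1 x; apply.
Qed.

Definition AS Q : {group {perm gT}} :=
  generated_group [set s : {perm gT} | perm_on Q s &&
    [exists n in 'N_S(Q), [forall x in Q, s x == x ^ n]]].

Lemma mem_AS Q s : Q \subset S ->
  reflect (perm_on Q s /\ exists2 n, n \in 'N_S(Q) & {in Q, s =1 conjg^~ n}) (s \in AS Q).
Proof.
move=> sQS.
have gA : group_set [set s : {perm gT} | perm_on Q s &&
    [exists n in 'N_S(Q), [forall x in Q, s x == x ^ n]]].
  apply/group_setP; split=> [|s1 s2].
    rewrite inE perm_on1; apply/existsP; exists 1; rewrite group1.
    by apply/forall_inP=> x _; rewrite perm1 conjg1.
  rewrite !inE => /andP[on1 /existsP[n1 /andP[N1 /forall_inP e1]]].
  case/andP=> on2 /existsP[n2 /andP[N2 /forall_inP e2]].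
  rewrite perm_onM //=; apply/existsP; exists (n1 * n2); rewrite groupM //=.
  apply/forall_inP=> x Qx; rewrite permM (eqP (e1 x Qx)) (eqP (e2 _ _)) ?conjgM //.
  by have [_ n1Q] := setIP N1; rewrite memJ_norm.
have -> : (s \in AS Q) = (s \in Group gA).
  by rewrite /AS /= (genGid (Group gA)).
rewrite inE; apply: (iffP andP) => [[on /existsP[n /andP[Nn /forall_inP e]]]|[on [n Nn e]]].
  by split=> //; exists n => // x Qx; apply/eqP/e.
by split=> //; apply/existsP; exists n; rewrite Nn; apply/forall_inP=> x /e/eqP.
Qed.

Lemma AS_AF Q : Q \subset S -> AS Q \subset AF Q.
Proof.
move=> sQS; apply/subsetP=> s /(mem_AS _ sQS)[on [n /setIP[Sn nQ] e]].
by rewrite mem_AF // on (@Fm_ext _ _ _ _ _ (conjg^~ n)) ?Fm_conjg.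
Qed.

Lemma AS_conj Q n : Q \subset S -> n \in 'N_S(Q) -> exists2 s, s \in AS Q & {in Q, s =1 conjg^~ n}.
Proof.
move=> sQS Nn; have [Sn nQ] := setIP Nn.
have [|x Qx|s As e] := AF_perm (f := conjg^~ n) sQS; first exact: Fm_conjg.
  by rewrite /= memJ_norm.
exists s => //; apply/(mem_AS _ sQS); split; last by exists n.
by rewrite mem_AF // in As; case/andP: As.
Qed.

Lemma card_AS Q : Q \subset S -> #|AS Q| = #|AutS S Q|.
Proof.
move=> sQS; pose rs (s : {perm gT}) : {ffun gT -> gT} := [ffun x => if x \in Q then s x else 1].
rewrite -(@card_in_imset _ _ rs (mem (AS Q))); last first.
  move=> s t /(subsetP (AS_AF sQS)) As /(subsetP (AS_AF sQS)) At e.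
  apply: (AF_eq sQS As At) => x Qx.
  by have := congr1 (fun h : {ffun gT -> gT} => h x) e; rewrite !ffunE Qx.
apply: eq_card => h; apply/imsetP/imsetP=> [[s /(mem_AS _ sQS)[on [n Nn e]] ->]|[n Nn ->]].
  exists n^-1; first by rewrite groupV.
  by apply/ffunP=> x; rewrite !ffunE; case: ifP => // Qx; rewrite e // invgK conjgE mulgA.
have [|s As e] := @AS_conj Q n^-1 sQS; first by rewrite groupV.
by exists s => //; apply/ffunP=> x; rewrite !ffunE; case: ifP => // Qx; rewrite e // conjgE invgK mulgA.
Qed.

Lemma AS_Sylow Q : Q \subset S -> fully_normalized S F Q -> p.-Sylow(AF Q) (AS Q).
Proof.
move=> sQS fnQ; have [_ [ax1 _]] := satF; have [_ [pA iA]] := ax1 Q sQS fnQ.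
rewrite /pHall AS_AF //= /pgroup card_AS // pA /=.
by rewrite -divgS ?AS_AF // card_AF // card_AS.
Qed.

Lemma fully_normalized_S : fully_normalized S F S.
Proof.
move=> Q sQS _; apply: subset_leq_card; apply/subsetP=> x /setIP[Sx _].
by rewrite inE Sx (subsetP (normG _)).
Qed.

Lemma fully_normalized_centralized Q : Q \subset S -> fully_normalized S F Q ->
  fully_centralized S F Q.
Proof. by move=> sQS fnQ; have [_ [ax1 _]] := satF; have [] := ax1 Q sQS fnQ. Qed.

(* Sylow's theorem in Aut_F(Q) moves the p-group of automorphisms of Q induced
   by N_S(P) into Aut_S(Q); then the extension axiom applies to all of N_S(P). *)
Lemma Fm_to_fully_normalized P f : P \subset S -> Fm S F P f ->
    fully_normalized S F (homimg f P) ->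
  exists2 g, Fm S F 'N_S(P) g & homimg g P = homimg f P.
Proof.
move=> sPS Ff fnQ; set Q := homimg f P; have sQS : Q \subset S by apply: (homimg_sub fusF).
have sPN : P \subset 'N_S(P) by rewrite subsetI sPS normG.
have [f1 [Ff1 f1K f1P fK]] := Fm_inv fusF sPS Ff; rewrite -/Q in Ff1 f1P fK.
have tr n : n \in 'N_S(P) -> exists2 s, s \in AF Q & {in P, forall x, s (f x) = f (x ^ n)}.
  move=> /setIP[Sn nP].
  have [||s As e] := AF_perm (f := fun y => f (f1 y ^ n)) sQS.
  - apply: (Fm_comp fusF sQS sPS (f := fun y => f1 y ^ n) _ _ Ff).
      exact: (Fm_comp fusF sQS sPS Ff1 f1P (Fm_conjg sPS Sn)).
    by move=> x Qx; rewrite /= memJ_norm ?f1P.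
  - by move=> y Qy; apply: mem_homimg; rewrite memJ_norm ?f1P.
  by exists s => // x Px; rewrite e ?mem_homimg // f1K.
(* [B] is f Aut_S(P) f^-1, a subgroup of Aut_F(Q). *)
pose B := [set s in AF Q | [exists n in 'N_S(P), [forall x in P, s (f x) == f (x ^ n)]]].
have BP s : reflect (s \in AF Q /\ exists2 n, n \in 'N_S(P) & {in P, forall x, s (f x) = f (x ^ n)}) (s \in B).
  rewrite inE; apply: (iffP andP) => [[As /existsP[n /andP[Nn /forall_inP e]]]|[As [n Nn e]]].
    by split=> //; exists n => // x Px; apply/eqP/e.
  by split=> //; apply/existsP; exists n; rewrite Nn; apply/forall_inP=> x /e/eqP.
have gB : group_set B.
  apply/group_setP; split=> [|s t /BP[As [n Nn es]] /BP[At [m Nm et]]].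
    by apply/BP; split=> //; exists 1 => // x Px; rewrite perm1 conjg1.
  apply/BP; split; first exact: groupM.
  exists (n * m); first exact: groupM.
  move=> x Px; rewrite permM es // et ?conjgM //.
  by have [_ nP] := setIP Nn; rewrite memJ_norm.
have pB : p.-group (Group gB).
  apply: pnat_dvd (_ : #|Group gB| %| #|'N_S(P)|) _; last first.
    exact: pgroupS (subsetIl _ _) pS.
  (* [B] is the image of N_S(P) under n |-> f c_n f^-1, so its order divides that of a p-group. *)
  have NP n x : n \in 'N_S(P) -> x \in P -> x ^ n \in P.
    by case/setIP=> _ nP Px; rewrite memJ_norm.
  pose ph (n : gT) : {perm gT} := odflt 1 [pick s in AF Q | [forall x in P, s (f x) == f (x ^ n)]].
  have phP n : n \in 'N_S(P) -> ph n \in AF Q /\ {in P, forall x, ph n (f x) = f (x ^ n)}.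
    move=> /tr[s As es]; rewrite /ph; case: pickP => [t /andP[At /forall_inP et]|/(_ s)/=].
      by split=> // x /et/eqP.
    by rewrite As => /negP[]; apply/forall_inP=> x /es/eqP.
  have AFe s t : s \in AF Q -> t \in AF Q -> {in P, forall x, s (f x) = t (f x)} -> s = t.
    move=> As At e; apply: (AF_eq sQS As At) => y.
    by rewrite (homimgE fusF) // => /imsetP[x Px ->]; apply: e.
  have phM : {in 'N_S(P) &, {morph ph : x y / x * y}}.
    move=> a b Na Nb; have [Aa ea] := phP _ Na; have [Ab eb] := phP _ Nb.
    have [Aab eab] := phP _ (groupM Na Nb).
    apply: AFe => //; first exact: groupM.
    by move=> x Px; rewrite eab // permM ea // eb ?conjgM ?NP.
  have -> : #|Group gB| = #|Morphism phM @* 'N_S(P)|.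
    apply: eq_card => s; rewrite morphimEdom /=.
    apply/idP/imsetP=> [/BP[As [n Nn en]]|[n Nn ->]].
      have [A' e'] := phP _ Nn; exists n => //; apply: AFe => // x Px.
      by rewrite en // e'.
    by have [A' e'] := phP _ Nn; apply/BP; split=> //; exists n.
  exact: dvdn_morphim.
have sBA : Group gB \subset AF Q by apply/subsetP=> s /BP[].
(* Replacing f by a o f conjugates [B] into Aut_S(Q), which says that N_f becomes all of N_S(P). *)
have [a Aa sBa] := Sylow_Jsub (AS_Sylow sQS fnQ) sBA pB.
have Fg : Fm S F P (a \o f).
  by apply: (Fm_comp fusF sPS sQS Ff _ (AF_Fm sQS Aa)) => x; apply: mem_homimg.
have Eg : homimg (a \o f) P = Q.
  apply: group_inj; apply: (homimg_eq fusF) => //; last by rewrite (card_homimg fusF).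
  by move=> x Px; rewrite /= AF_in // mem_homimg.
have fcQ := fully_normalized_centralized sQS fnQ.
have [|||||g Fg' eg] := @Fm_extend P 'N_S(P)%G (a \o f) => //.
- by rewrite Eg.
- move=> n Nn; have [s As es] := tr n Nn.
  have Bs : s \in Group gB by apply/BP; split=> //; exists n.
  have : s ^ a \in AS Q by apply: (subsetP sBa); rewrite memJ_conjg.
  case/(mem_AS _ sQS)=> _ [m /setIP[Sm _] em]; exists m => // x Px /=.
  have /= := em (a (f x)); rewrite AF_in // mem_homimg // => <- //.
  by rewrite conjgE !permM permK es.
exists g => //; rewrite -Eg; exact: eq_homimg.
Qed.

Lemma fully_normalized_iso P Q f : P \subset S -> Fm S F P f -> homimg f P = Q ->
  fully_normalized S F Q -> exists2 g, Fm S F 'N_S(P) g & homimg g P = Q.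
Proof. by move=> sPS Ff <-; apply: Fm_to_fully_normalized. Qed.

End Saturated.

(** * Alperin's fusion theorem *)

Section Alperin.
Variables (gT : finGroupType) (p : nat) (S : {group gT}) (F : fsys gT).
Implicit Types (P Q R N : {group gT}) (f g : gT -> gT).
Hypotheses (prp : prime p) (pS : p.-group S) (satF : saturated p S F).
Let fusF : fusion_system S F := satF.1.

Lemma Fcentric_S : Fcentric S F S.
Proof.
rewrite /Fcentric subxx; apply/forallP=> Q; apply/implyP=> /andP[sQS].
move=> /(FconjP fusF (subxx S) sQS)[f Ff Ef].
suff -> : Q :=: S by rewrite subsetIl.
by apply/eqP; rewrite eqEcard sQS -Ef (card_homimg fusF) /=.
Qed.

(** If C_S(Q) lies in Q it equals Z(Q). For R conjugate to Q, |C_S(R)| is then at most |Z(Q)| =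
    |Z(R)|, so C_S(R) = Z(R) lies in R and Q would be centric. *)
Lemma fully_centralized_noncentric Q : Q \subset S -> fully_centralized S F Q ->
  ~~ Fcentric S F Q -> ~~ ('C_S(Q) \subset Q).
Proof.
move=> sQS fcQ; apply: contra => sCQ; rewrite /Fcentric sQS; apply/forallP=> R.
apply/implyP=> /andP[sRS cQR]; have le := fcQ R sRS cQR.
have [f Ff Ef] := FconjP fusF sQS sRS cQR.
have /eqP -> : 'C_S(R) == 'Z(R).
  rewrite eq_sym eqEcard setSI //=; apply: leq_trans le _.
  have sZ : 'C_S(Q) \subset 'Z(Q) by rewrite subsetI sCQ subsetIr.
  apply: leq_trans (subset_leq_card sZ) _.
  have iZ : {in 'Z(Q) &, injective f}.
    by apply: sub_in2 (Fm_inj fusF sQS Ff) => x /setIP[].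
  rewrite -(card_in_imset iZ); apply: subset_leq_card; apply/subsetP=> _ /imsetP[z /setIP[Qz cz] ->].
  rewrite inE -Ef mem_homimg //=; apply/centP=> y.
  rewrite (homimgE fusF) // => /imsetP[x Qx ->].
  by rewrite /commute -!(Fm_M fusF sQS Ff) // (centP cz x Qx).
exact: subsetIl.
Qed.

(** Induction on |S| - |P|. With Q a fully normalized conjugate of P, there are a : P -> Q and b :
    f(P) -> Q that extend to the normalizers in S, which are strictly larger, so both are good. Then
    f = b^-1 s a with s in Aut_F(Q), and only s remains. *)
Lemma alperin_ind (Good : {group gT} -> (gT -> gT) -> Prop) :
    (forall P f g, {in P, f =1 g} -> Good P f -> Good P g) ->
    (forall P Q f, Q \subset P -> P \subset S -> Fm S F P f -> Good P f -> Good Q f) ->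
    (forall P f g, P \subset S -> Fm S F P f -> Fm S F (homimg f P) g ->
       Good P f -> Good (homimg f P) g -> Good P (g \o f)) ->
    (forall P f g, P \subset S -> Fm S F P f -> Fm S F (homimg f P) g ->
       (forall x, x \in P -> g (f x) = x) -> Good P f -> Good (homimg f P) g) ->
    (forall Q (s : {perm gT}), Q \subset S -> Fcentric S F Q -> fully_normalized S F Q ->
       s \in AF S F Q -> Good Q s) ->
  forall P f, P \subset S -> Fm S F P f -> Good P f.
Proof.
move=> Gext Gsub Gcomp Ginv Gaut P f.
have [n] := ubnP (#|S| - #|P|); elim: n P f => // n IHn P f ltn sPS Ff.
have IH N g : N \subset S -> #|P| < #|N| -> Fm S F N g -> Good N g.
  move=> sNS ltPN Fg; apply: IHn => //; rewrite ltnS in ltn.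
  apply: leq_trans _ ltn; apply: ltn_sub2l => //.
  exact: leq_trans ltPN (subset_leq_card sNS).
have [eqPS|nPS] := eqVneq (P : {set gT}) S.
  have {}eqPS : P = S by apply: group_inj.
  subst P; have [x|s As es] := AF_perm satF (subxx S) Ff; first exact: (Fm_in fusF).
  apply: (Gext _ s) => //; apply: Gaut => //; first exact: Fcentric_S.
  exact: fully_normalized_S.
have ltN R : R \subset S -> #|R| = #|P| -> #|R| < #|'N_S(R)%G|.
  move=> sRS eRP; apply: proper_card; apply: nilpotent_proper_norm (pgroup_nil pS) _.
  rewrite properEcard sRS eRP; apply: proper_card.
  by rewrite properEneq nPS.
have [f0 Ff0 fnQ] := fully_normalized_rep fusF sPS.
set Q := homimg f0 P in fnQ; have sQS : Q \subset S := homimg_sub fusF sPS Ff0.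
set P' := homimg f P; have sP'S : P' \subset S := homimg_sub fusF sPS Ff.
have cP' : #|P'| = #|P| := card_homimg fusF sPS Ff.
have cQ : #|Q| = #|P| := card_homimg fusF sPS Ff0.
have [g1 [Fg1 g1K g1P g1f]] := Fm_inv fusF sPS Ff.
have [a Fa Ea] := fully_normalized_iso pS satF sPS Ff0 (erefl Q) fnQ.
have Ff01 : Fm S F P' (f0 \o g1) by apply: (Fm_comp fusF _ sPS).
have E01 : homimg (f0 \o g1) P' = Q.
  apply: group_inj; apply: (homimg_eq fusF) => //; last by rewrite cQ cP'.
  by move=> y P'y; rewrite /= mem_homimg // g1P.
have [b Fb Eb] := fully_normalized_iso pS satF sP'S Ff01 E01 fnQ.
have sNS R : 'N_S(R)%G \subset S by apply: subsetIl.
have sRN R : R \subset S -> R \subset 'N_S(R)%G by move=> sRS; rewrite subsetI sRS normG.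
have FaP : Fm S F P a := Fm_sub fusF (sNS _) (sRN _ sPS) Fa.
have FbP : Fm S F P' b := Fm_sub fusF (sNS _) (sRN _ sP'S) Fb.
have GaP : Good P a.
  by apply: (Gsub 'N_S(P)%G); rewrite ?sRN ?sNS //; apply: IH; rewrite ?ltN.
have GbP : Good P' b.
  by apply: (Gsub 'N_S(P')%G); rewrite ?sRN ?sNS //; apply: IH; rewrite -?cP' ?ltN.
have [a1 [Fa1 a1K a1P a1a]] := Fm_inv fusF sPS FaP; rewrite Ea in Fa1 a1P a1a.
have [b1 [Fb1 b1K b1P b1b]] := Fm_inv fusF sP'S FbP; rewrite Eb in Fb1 b1P b1b.
have Gb1 : Good Q b1 by rewrite -Eb; apply: (Ginv _ b) => //; rewrite Eb.
have bQ x : x \in P' -> b x \in Q by move=> Px; rewrite -Eb mem_homimg.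
have Fc : Fm S F Q (b \o f \o a1).
  apply: (Fm_comp fusF sQS sPS Fa1 a1P).
  by apply: (Fm_comp fusF sPS sP'S Ff) => // x; apply: mem_homimg.
have [y Qy|s As es] := AF_perm satF sQS Fc; first by rewrite /= bQ ?mem_homimg ?a1P.
have Gs : Good Q s.
  (* For Q not centric, Q C_S(Q) is strictly larger than Q and s extends to it: conjugation by qc
     acts on Q as conjugation by q, which s carries to conjugation by s(q). *)
  have [cenQ|ncQ] := boolP (Fcentric S F Q); first exact: Gaut.
  have fcQ := fully_normalized_centralized satF sQS fnQ.
  have nCQ := fully_centralized_noncentric sQS fcQ ncQ.
  have nQC : 'C_S(Q) \subset 'N(Q) by rewrite subIset // cent_sub orbT.
  have Fs := AF_Fm satF sQS As.
  have sN : (Q <*> 'C_S(Q))%G \subset 'N_S(Q).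
    by rewrite subsetI !join_subG sQS subsetIl normG nQC.
  have Es : homimg s Q = Q.
    apply: group_inj; apply: (homimg_eq fusF) => // x; by rewrite (AF_in satF).
  have [||g Fg eg] := Fm_extend satF sQS sN Fs; first by rewrite Es.
    move=> z; rewrite /= norm_joinEr // => /mulsgP[q c Qq /setIP[Sc cc] ->{z}].
    exists (s q) => [|x Qx]; first by rewrite (subsetP sQS) // (AF_in satF).
    rewrite conjgM; have -> : (x ^ q) ^ c = x ^ q.
      apply/conjg_fixP/commgP; apply: commute_sym; apply/(centP cc); exact: groupJ.
    by rewrite !conjgE !(Fm_M fusF sQS Fs) ?(Fm_V fusF sQS Fs) // ?groupM ?groupV.
  apply: (Gext _ g) => //; apply: (Gsub (Q <*> 'C_S(Q))%G) => //.
  - exact: joing_subl.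
  - exact: subset_trans sN (subsetIl _ _).
  apply: IH => //; first exact: subset_trans sN (subsetIl _ _).
  rewrite -cQ; apply: proper_card; rewrite properE joing_subl join_subG subxx /=.
  exact: nCQ.
apply: (Gext _ (b1 \o (s \o a))) => [x Px|].
  have Qa : a x \in Q by rewrite -Ea mem_homimg.
  by rewrite /= es //= a1K // b1K // mem_homimg.
have Fsa : Fm S F P (s \o a).
  apply: (Fm_comp fusF sPS sQS FaP) (AF_Fm satF sQS As) => x Px.
  by rewrite -Ea mem_homimg.
have Esa : homimg (s \o a) P = Q.
  apply: group_inj; apply: (homimg_eq fusF) => //; last by rewrite cQ.
  by move=> x Px; rewrite /= (AF_in satF _ sQS As) -Ea mem_homimg.
apply: (Gcomp); rewrite ?Esa //; apply: (Gcomp); rewrite ?Ea //.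
exact: (AF_Fm satF).
Qed.

End Alperin.

(** * Sets with equal fixed point counts are isomorphic *)

Section EquivariantBijection.
Variables (aT : finGroupType) (T : finType) (G : {group aT}).
Implicit Types (to : T -> aT -> T) (A B : {set T}) (K R : {group aT}).

(** An action of G on A only, by a total function: twisting an action by a morphism defined on P
    alone yields nothing better. *)
Definition gact_on to A :=
  [/\ forall x, x \in A -> to x 1 = x,
      forall x g h, x \in A -> g \in G -> h \in G -> to x (g * h) = to (to x g) h
    & forall x g, x \in A -> g \in G -> to x g \in A].

Definition fixpts to A (R : {set aT}) := [set x in A | [forall r in R, to x r == x]].

Lemma fixptsP to A (R : {set aT}) x :
  reflect (x \in A /\ forall r, r \in R -> to x r = x) (x \in fixpts to A R).
Proof.
rewrite inE; apply: (iffP andP) => [[Ax /forall_inP e]|[Ax e]].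
  by split=> // r /e/eqP.
by split=> //; apply/forall_inP=> r /e/eqP.
Qed.

Lemma stab_group_set to A x : gact_on to A -> x \in A ->
  group_set [set g in G | to x g == x].
Proof.
case=> t1 tM _ Ax; apply/group_setP; split=> [|g h]; first by rewrite inE group1 t1 /=.
rewrite !inE => /andP[Gg /eqP eg] /andP[Gh /eqP eh].
by rewrite groupM //= tM // eg eh.
Qed.

Lemma act_eqP to A x g h : gact_on to A -> x \in A -> g \in G -> h \in G ->
  (to x g == to x h) = (to x (g * h^-1) == x).
Proof.
case=> t1 tM tA Ax Gg Gh; apply/eqP/eqP=> e.
  by rewrite tM ?groupV // e -tM ?groupV // mulgV t1.
by rewrite -{2}e -tM ?groupM ?groupV // mulgKV.
Qed.

(* Remove from both sets an orbit whose stabilizer is as large as possible. *)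
Lemma fixpts_equivariant_bijection to1 to2 A B :
    gact_on to1 A -> gact_on to2 B ->
    (forall R, R \subset G -> #|fixpts to1 A R| = #|fixpts to2 B R|) ->
  exists th : T -> T, [/\ {in A &, injective th}, th @: A = B
    & forall x g, x \in A -> g \in G -> th (to1 x g) = to2 (th x) g].
Proof.
have [n] := ubnP #|A|; elim: n A B => // n IHn A B ltA act1 act2 eqf.
have fsub to C (K : {set aT}) : fixpts to C K \subset C by apply/subsetP=> x /fixptsP[].
have [A0 | [a0 Aa0]] := set_0Vmem A.
  exists id; split=> [x y|| x g]; rewrite ?A0 ?inE // imset0.
  have [t1 tM tA] := act2; apply/esym/eqP; rewrite -cards_eq0.
  have <- : fixpts to2 B 1%G = B.
    apply/setP=> x; apply/fixptsP/idP=> [[]//|Bx]; split=> // r.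
    by rewrite inE => /eqP ->; apply: t1.
  rewrite -(eqf _ (sub1G _)) cards_eq0 -subset0 -A0; exact: fsub.
(* Since [R] has maximal order among subgroups with a fixed point, every point fixed by [R] has
   stabilizer exactly [R]; equal fixed-point counts give the same on the side of B. *)
pose ok (R : {group aT}) := (R \subset G) && (fixpts to1 A R != set0).
have ok1 : ok 1%G.
  rewrite /ok sub1G; apply/set0Pn; exists a0; apply/fixptsP; split=> // r.
  by rewrite inE => /eqP ->; have [-> //] := act1.
case: (@arg_maxnP _ 1%G ok (fun R : {group aT} => #|R|) ok1) => R /andP[sRG nzA] maxR.
have maxS to C x (act : gact_on to C) : x \in fixpts to C R ->
    (forall K : {group aT}, K \subset G -> x \in fixpts to C K -> #|K| <= #|R|) ->
    forall g, g \in G -> (to x g == x) = (g \in R).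
  case/fixptsP=> Cx fx mx g Gg; apply/idP/idP=> [eg|/fx/eqP//].
  pose K := Group (stab_group_set act Cx).
  have sRK : R \subset K.
    by apply/subsetP=> r Rr; rewrite inE (subsetP sRG) //= fx.
  have sKG : K \subset G by apply/subsetP=> r; rewrite inE => /andP[].
  have /eqP -> : (R : {set aT}) == K.
    rewrite eqEcard sRK mx //; apply/fixptsP; split=> // r.
    by rewrite inE => /andP[_ /eqP].
  by rewrite inE Gg.
have [a fa] := set0Pn _ nzA.
have nzB : fixpts to2 B R != set0 by rewrite -cards_eq0 -eqf // cards_eq0.
have [b fb] := set0Pn _ nzB.
have stA : forall g, g \in G -> (to1 a g == a) = (g \in R).
  apply: maxS act1 fa _ => K sKG fK; apply: maxR; rewrite /ok sKG /=.
  by apply/set0Pn; exists a.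
have stB : forall g, g \in G -> (to2 b g == b) = (g \in R).
  apply: maxS act2 fb _ => K sKG fK; apply: maxR; rewrite /ok sKG /=.
  by rewrite -cards_eq0 eqf // cards_eq0; apply/set0Pn; exists b.
have /fixptsP[Aa _] := fa; have /fixptsP[Bb _] := fb.
have [t1 tM tA] := act1; have [u1 uM uB] := act2.
pose OA := [set to1 a g | g in G]; pose OB := [set to2 b g | g in G].
(* The map a g |-> b g is well defined and injective because a and b have the same stabilizer; the
   default 1 occurs only off the orbit of a. *)
pose t0 x := to2 b (odflt 1 [pick g in G | to1 a g == x]).
have t0E g : g \in G -> t0 (to1 a g) = to2 b g.
  move=> Gg; rewrite /t0; case: pickP => [h /andP[Gh]|/(_ g)]; last by rewrite Gg eqxx.
  have Ghg : h * g^-1 \in G by rewrite groupM ?groupV.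
  rewrite (act_eqP act1) // stA // => e; apply/eqP.
  by rewrite (act_eqP act2) // stB.
have sOA : OA \subset A by apply/subsetP=> _ /imsetP[g Gg ->]; apply: tA.
have sOB : OB \subset B by apply/subsetP=> _ /imsetP[g Gg ->]; apply: uB.
have t0inj : {in OA &, injective t0}.
  move=> _ _ /imsetP[g Gg ->] /imsetP[h Gh ->]; rewrite !t0E // => /eqP.
  have Ggh : g * h^-1 \in G by rewrite groupM ?groupV.
  rewrite (act_eqP act2) // stB // => e; apply/eqP.
  by rewrite (act_eqP act1) // stA.
have t0im : t0 @: OA = OB.
  apply/setP=> y; apply/imsetP/imsetP=> [[_ /imsetP[g Gg ->] ->]|[g Gg ->]].
    by exists g; rewrite ?t0E.
  by exists (to1 a g); rewrite ?t0E ?imset_f.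
have t0eq x g : x \in OA -> g \in G -> t0 (to1 x g) = to2 (t0 x) g.
  by case/imsetP=> h Gh -> Gg; rewrite -tM // !t0E ?groupM // uM.
have OAst x g : x \in OA -> g \in G -> to1 x g \in OA.
  by case/imsetP=> h Gh -> Gg; rewrite -tM // imset_f ?groupM.
have OBst x g : x \in OB -> g \in G -> to2 x g \in OB.
  by case/imsetP=> h Gh -> Gg; rewrite -uM // imset_f ?groupM.
have acD to (C O : {set T}) : gact_on to C -> O \subset C ->
    (forall x g, x \in O -> g \in G -> to x g \in O) -> gact_on to (C :\: O).
  case=> v1 vM vC sOC Ost; split=> [x /setDP[Cx _]|x g h /setDP[Cx _]|x g /setDP[Cx nO] Gg].
  - exact: v1.
  - exact: vM.
  rewrite inE vC // andbT; apply: contra nO => Ox.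
  by rewrite -(v1 x Cx) -(mulgV g) vM ?groupV // Ost ?groupV.
have fixD to (C O : {set T}) (K : {group aT}) : O \subset C ->
    #|fixpts to (C :\: O) K| = #|fixpts to C K| - #|fixpts to O K|.
  move=> sOC; rewrite -cardsDS; last first.
    apply/subsetP=> x /fixptsP[Ox fx]; apply/fixptsP; split=> //.
    exact: (subsetP sOC).
  apply: eq_card => x; rewrite !inE.
  by case: (x \in O); case: (x \in C); case: [forall r in K, to x r == x].
have fixO (K : {group aT}) : K \subset G -> #|fixpts to1 OA K| = #|fixpts to2 OB K|.
  move=> sKG; rewrite -(@card_in_imset _ _ t0 (mem (fixpts to1 OA K))); last first.
    by move=> x y /fixptsP[Ox _] /fixptsP[Oy _]; apply: t0inj.
  apply: eq_card => y; apply/imsetP/fixptsP=> [[x /fixptsP[Ox fx] ->]|[]].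
    split; first by rewrite -t0im imset_f.
    by move=> r Kr; rewrite -t0eq ?fx // (subsetP sKG).
  rewrite -t0im => /imsetP[x Ox ->] fx; exists x => //; apply/fixptsP; split=> // r Kr.
  have Gr := subsetP sKG r Kr.
  by apply: t0inj; rewrite ?OAst // t0eq // fx.
have [||||th [thi thB the]] := IHn (A :\: OA) (B :\: OB).
- have OAa : a \in OA by apply/imsetP; exists 1; rewrite ?group1 ?t1.
  have: #|A :\: OA| < #|A|.
    apply: proper_card; apply/properP; split; first exact: subsetDl.
    by exists a; rewrite // inE OAa.
  by move=> lt; apply: leq_trans lt _.
- exact: acD.
- exact: acD.
- by move=> K sKG; rewrite !fixD // eqf // fixO.
exists (fun x => if x \in OA then t0 x else th x).
have thD x : x \in A -> x \notin OA -> th x \in B :\: OB.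
  by move=> Ax nO; rewrite -thB imset_f // inE nO.
have t0O x : x \in OA -> t0 x \in OB by move=> Ox; rewrite -t0im imset_f.
split.
- move=> x y Ax Ay; case: ifP => Ox; case: ifP => Oy.
  + exact: t0inj.
  + by move=> e; have := thD y Ay (negbT Oy); rewrite -e inE t0O.
  + by move=> e; have := thD x Ax (negbT Ox); rewrite e inE t0O.
  by apply: thi; rewrite inE ?Ox ?Oy.
- apply/setP=> y; apply/imsetP/idP=> [[x Ax ->]|By].
    case: ifP => Ox; first by rewrite (subsetP sOB) ?t0O.
    by have /setDP[] := thD x Ax (negbT Ox).
  have [Oy|nOy] := boolP (y \in OB).
    move: (Oy); rewrite -t0im => /imsetP[x Ox ->]; exists x; rewrite ?Ox //.
    exact: (subsetP sOA).
  have : y \in B :\: OB by rewrite inE nOy.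
  rewrite -thB => /imsetP[x /setDP[Ax nOx] ->]; exists x => //.
  by rewrite (negbTE nOx).
move=> x g Ax Gg; case: (boolP (x \in OA)) => [Ox|nOx].
  by rewrite OAst // t0eq.
have /setDP[_ /negbTE ->] : to1 x g \in A :\: OA.
  by have [_ _ st] := acD _ _ _ act1 sOA OAst; apply: st; rewrite // inE nOx.
by apply: the; rewrite // inE nOx.
Qed.

End EquivariantBijection.

(** * Fixed points of graph subgroups *)

Section Marks.
Variables (aT : finGroupType) (D : {group aT}).
Implicit Types (H R N : {group aT}) (Hs : seq {group aT}).

(** An entry of the table of marks of D: the number of points of the right D-set H\D fixed by R. *)
Definition mark (H : {group aT}) (R : {set aT}) := #|'Fix_(rcosets H D | 'Rs)(R)|.

Definition markl Hs (R : {set aT}) := (\sum_(H <- Hs) mark H R)%N.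

(** R fixes the coset Hd exactly when R lies in the conjugate of H by d. *)
Lemma mark_gt0 H R : 0 < mark H R -> exists2 d, d \in D & R \subset H :^ d.
Proof.
rewrite /mark card_gt0 => /set0Pn[C /setIP[/rcosetsP[d Dd ->]]].
by rewrite sub_afixRs_norms; exists d.
Qed.

Lemma markl_gt0 Hs R : 0 < markl Hs R -> exists2 H, H \in Hs & 0 < mark H R.
Proof.
rewrite /markl; elim: Hs => [|H Hs IHs]; first by rewrite big_nil.
rewrite big_cons; case: (posnP (mark H R)) => [-> /IHs[K Hs_K gt0]|gt0 _].
  by exists K; rewrite // inE Hs_K orbT.
by exists H; rewrite // inE eqxx.
Qed.

Lemma markl_cat Hs Ks R : markl (Hs ++ Ks) R = (markl Hs R + markl Ks R)%N.
Proof. by rewrite /markl big_cat. Qed.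

Lemma markl_nseq k H R : markl (nseq k H) R = (k * mark H R)%N.
Proof. by rewrite /markl big_nseq iter_addn addn0 mulnC. Qed.

Lemma markJ H (R : {set aT}) d : d \in D -> mark H (R :^ d) = mark H R.
Proof.
have le (A : {set aT}) e : e \in D -> mark H A <= mark H (A :^ e).
  move=> De; rewrite /mark -(card_imset _ (act_inj 'Rs e)).
  apply: subset_leq_card; apply/subsetP=> _ /imsetP[E /setIP[/rcosetsP[x Dx ->] fE] ->].
  rewrite sub_afixRs_norms in fE; rewrite /= rcosetE -rcosetM inE mem_rcosets.
  by rewrite (subsetP (mulG_subr H D)) ?groupM //= sub_afixRs_norms conjsgM conjSg.
move=> Dd; apply/eqP; rewrite eqn_leq le // andbT.
by have := le (R :^ d) d^-1; rewrite conjsgK groupV; apply.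
Qed.

Lemma markl_J Hs (R : {set aT}) d : d \in D -> markl Hs (R :^ d) = markl Hs R.
Proof. by move=> Dd; apply: eq_bigr => H _; rewrite markJ. Qed.

Lemma mark_self R : R \subset D -> mark R R = #|'N_D(R) : R|.
Proof. by move=> sRD; rewrite /mark afixRs_rcosets. Qed.

Lemma mark_small H R : #|H| < #|R| -> mark H R = 0%N.
Proof.
move=> lt; apply/eqP; rewrite -leqn0 leqNgt; apply/negP=> /mark_gt0[d _ /subset_leq_card].
by rewrite cardJg leqNgt lt.
Qed.

Lemma mark_conj H R : #|H| = #|R| -> 0 < mark H R -> exists2 d, d \in D & R :=: H :^ d.
Proof.
move=> e /mark_gt0[d Dd sR]; exists d => //.
by apply/eqP; rewrite eqEcard sR cardJg e /=.
Qed.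

(* Burnside's orbit-counting lemma for N acting on the fixed points of R. *)
Lemma dvdn_sum_mark H R N : N \subset D -> N \subset 'N(R) ->
  #|N| %| \sum_(n in N) mark H (R <*> <[n]>).
Proof.
move=> sND nRN.
have actN : [acts N, on 'Fix_(rcosets H D | 'Rs)(R) | 'Rs].
  apply: actsI; first exact: subset_trans sND (actsRs_rcosets H D).
  exact: acts_fix_norm.
have := Frobenius_Cauchy actN.
rewrite (eq_bigr (fun n => mark H (R <*> <[n]>))) => [->|n _]; first exact: dvdn_mull.
by rewrite /mark afixYin ?subsetT // afix_cycle setIA.
Qed.

Lemma dvdn_sum_markl Hs R N : N \subset D -> N \subset 'N(R) ->
  #|N| %| \sum_(n in N) markl Hs (R <*> <[n]>).
Proof.
move=> sND nRN; rewrite exchange_big; apply: (big_ind (fun k => #|N| %| k)) => [|a b|H _].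
- exact: dvdn0.
- exact: dvdn_add.
exact: dvdn_sum_mark.
Qed.

End Marks.

(** * Graph subgroups of S x S and their transport along morphisms *)

Section Biset.
Variables (gT : finGroupType) (p : nat) (S : {group gT}) (F : fsys gT).
Implicit Types (P Q : {group gT}) (R H K N : {group gT * gT}) (f g : gT -> gT).
Implicit Types (Hs Ks : seq {group gT * gT}).
Hypotheses (prp : prime p) (pS : p.-group S) (satF : saturated p S F).
Let fusF : fusion_system S F := satF.1.
Let D : {group gT * gT} := setX_group S S.
Local Notation Fm := (Fm S F).
Local Notation mk := (mark D).
Local Notation mkl := (markl D).

Definition graph_of Q f : {group gT * gT} :=
  generated_group [set (f x, x) | x in Q].

Lemma mem_graph Q f r : Q \subset S -> Fm Q f ->
  (r \in graph_of Q f) = (r.2 \in Q) && (r.1 == f r.2).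
Proof.
move=> sQS Ff.
have gG : group_set [set (f x, x) | x in Q].
  apply/group_setP; split=> [|_ _ /imsetP[x Qx ->] /imsetP[y Qy ->]].
    by apply/imsetP; exists 1; rewrite ?group1 ?(Fm_1 fusF sQS Ff).
  by apply/imsetP; exists (x * y); rewrite ?groupM ?(Fm_M fusF sQS Ff).
rewrite /graph_of /= (genGid (Group gG)).
apply/imsetP/andP=> [[x Qx ->]|[Qr /eqP e]]; first by rewrite /= Qx eqxx.
by exists r.2; rewrite // -e -surjective_pairing.
Qed.

Lemma card_graph Q f : Q \subset S -> Fm Q f -> #|graph_of Q f| = #|Q|.
Proof.
move=> sQS Ff; rewrite -(@card_imset _ _ (fun x => (f x, x)) (mem Q)) => [|x y []//].
apply: eq_card => r; rewrite mem_graph //; apply/andP/imsetP=> [[Qr /eqP e]|[x Qx ->]].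
  by exists r.2; rewrite // -e -surjective_pairing.
by rewrite /= Qx eqxx.
Qed.

Lemma graph_sub Q f : Q \subset S -> Fm Q f -> graph_of Q f \subset D.
Proof.
move=> sQS Ff; apply/subsetP=> r; rewrite mem_graph // => /andP[Qr /eqP e].
by rewrite inE e (Fm_in fusF sQS) // (subsetP sQS).
Qed.

Definition isF R := exists Q f, [/\ Q \subset S, Fm Q f & R = graph_of Q f].

Lemma isF_graph Q f : Q \subset S -> Fm Q f -> isF (graph_of Q f).
Proof. by exists Q, f. Qed.

Lemma isF_subD R : isF R -> R \subset D.
Proof. by case=> Q [f [sQS Ff ->]]; apply: graph_sub. Qed.

(** A subgroup of the graph of f is the graph of f restricted to its second projection. *)
Lemma isF_sub R K : K \subset R -> isF R -> isF K.
Proof.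
move=> sKR [Q [f [sQS Ff defR]]].
have gQ : group_set [set x in Q | (f x, x) \in K].
  apply/group_setP; split=> [|x y].
    by rewrite inE group1 (Fm_1 fusF sQS Ff) group1.
  rewrite !inE => /andP[Qx Kx] /andP[Qy Ky]; rewrite groupM //=.
  by rewrite (Fm_M fusF sQS Ff) //; apply: (groupM Kx Ky).
have sQ : Group gQ \subset Q by apply/subsetP=> x; rewrite inE => /andP[].
have sQ' := subset_trans sQ sQS.
have Ff' : Fm (Group gQ) f by apply: (Fm_sub fusF sQS).
exists (Group gQ), f; split=> //; apply: group_inj; apply/setP=> r.
rewrite mem_graph // inE; apply/idP/andP=> [Kr|[/andP[Qr Kr] /eqP e]].
  have := subsetP sKR r Kr; rewrite defR mem_graph // => /andP[Qr /eqP e].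
  by rewrite Qr -e -surjective_pairing Kr eqxx.
by rewrite -e -surjective_pairing in Kr.
Qed.

Lemma graphJ Q f a b : Q \subset S -> Fm Q f -> a \in S -> b \in S ->
  (graph_of Q f :^ (a, b) = graph_of (Q :^ b) (fun x => f (x ^ b^-1) ^ a))%G /\
  Fm (Q :^ b)%G (fun x => f (x ^ b^-1) ^ a).
Proof.
move=> sQS Ff Sa Sb.
have sQbS : Q :^ b \subset S by rewrite -(conjGid Sb) conjSg.
have Ff' : Fm (Q :^ b)%G (fun x => f (x ^ b^-1) ^ a).
  have Sb' : b^-1 \in S by rewrite groupV.
  apply: (Fm_comp fusF sQbS sQS (f := conjg^~ b^-1) (g := fun x => f x ^ a)).
  - exact: (Fm_conjg satF sQbS Sb').
  - by move=> x; rewrite mem_conjg.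
  apply: (Fm_comp fusF sQS (subxx S) (g := conjg^~ a) Ff); first by move=> x; apply: (Fm_in fusF).
  exact: (Fm_conjg satF).
split=> //; apply: group_inj; apply/setP=> r; rewrite mem_graph //=.
rewrite mem_conjg mem_graph //= mem_conjg; congr (_ && _).
by rewrite -(inj_eq (conjg_inj a)) conjgKV.
Qed.

Lemma isF_J R d : d \in D -> isF R -> isF (R :^ d)%G.
Proof.
case: d => a b; rewrite inE /= => /andP[Sa Sb] [Q [f [sQS Ff ->]]].
have [-> Ff'] := graphJ sQS Ff Sa Sb.
by apply: isF_graph => //; rewrite -(conjGid Sb) conjSg.
Qed.

Lemma mkl_isF Hs R : (forall H, H \in Hs -> isF H) -> 0 < mkl Hs R -> isF R.
Proof.
move=> FHs /markl_gt0[H HsH /mark_gt0[d Dd sR]].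
by apply: (isF_sub sR); apply: isF_J => //; apply: FHs.
Qed.

(** For the S x S-set with stabilizers [Hs], restriction along any two morphisms from Q then gives
    the same number of points fixed by the graph. *)
Definition stable Hs Q := forall f g, Fm Q f -> Fm Q g ->
  mkl Hs (graph_of Q f) = mkl Hs (graph_of Q g).

Lemma push_morphM P f : P \subset S -> Fm P f ->
  {in setX P S &, {morph (fun r : gT * gT => (f r.1, r.2)) : x y / x * y}}.
Proof.
move=> sPS Ff x y; rewrite !inE => /andP[Px _] /andP[Py _].
by rewrite /= (Fm_M fusF sPS Ff).
Qed.

Definition graph_push P f (sPS : P \subset S) (Ff : Fm P f) := Morphism (push_morphM sPS Ff).

Lemma push_inj P f (sPS : P \subset S) (Ff : Fm P f) : 'injm (graph_push sPS Ff).
Proof.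
apply/injmP=> x y; rewrite !inE => /andP[Px _] /andP[Py _] [e1 e2].
by rewrite [x]surjective_pairing [y]surjective_pairing e2 (Fm_inj fusF sPS Ff _ _ e1).
Qed.

Lemma push_graph P Q f g (sPS : P \subset S) (Fg : Fm P g) : Q \subset S -> Fm Q f ->
  (forall x, x \in Q -> f x \in P) -> graph_push sPS Fg @* graph_of Q f = graph_of Q (g \o f).
Proof.
move=> sQS Ff fP; have Fgf : Fm Q (g \o f) by apply: (Fm_comp fusF sQS sPS).
rewrite morphimEsub; last first.
  apply/subsetP=> r; rewrite mem_graph // inE => /andP[Qr /eqP ->].
  by rewrite fP // (subsetP sQS).
apply/setP=> r; rewrite mem_graph //; apply/imsetP/andP=> [[x]|[Qr /eqP e]].
  by rewrite mem_graph // => /andP[Qx /eqP e] -> /=; rewrite Qx e.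
exists (f r.2, r.2); first by rewrite mem_graph //= Qr eqxx.
by rewrite [r]surjective_pairing e.
Qed.

(** Marks vanish off F-graphs, and R is an F-graph if and only if its image under (x, y) |-> (f x,
    y) is. When both are, they are graphs over the same Q, with |Q| = |R| > n, and stability at Q
    applies. *)
Lemma mkl_push n Hs P f (sPS : P \subset S) (Ff : Fm P f) R :
    (forall H, H \in Hs -> isF H) ->
    (forall Q, Q \subset S -> n < #|Q| -> stable Hs Q) ->
    R \subset setX P S -> n < #|R| ->
  mkl Hs (graph_push sPS Ff @* R) = mkl Hs R.
Proof.
move=> FHs stH sR ltn.
have eqF : isF R -> mkl Hs (graph_push sPS Ff @* R) = mkl Hs R.
  case=> Q [g [sQS Fg defR]]; rewrite defR.
  have gP x : x \in Q -> g x \in P.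
    move=> Qx; have : (g x, x) \in R by rewrite defR mem_graph //= Qx eqxx.
    by move/(subsetP sR); rewrite inE => /andP[].
  rewrite push_graph //; apply: stH => //; last exact: (Fm_comp fusF sQS sPS).
  by rewrite -(card_graph sQS Fg) -defR.
have Fback : isF (graph_push sPS Ff @* R)%G -> isF R.
  case=> Q [g [sQS Fg defR]].
  have [f1 [Ff1 f1K f1P fK]] := Fm_inv fusF sPS Ff.
  have gQ x : x \in Q -> g x \in homimg f P.
    move=> Qx; have : (g x, x) \in (graph_push sPS Ff @* R)%G by rewrite defR mem_graph //= Qx eqxx.
    by case/morphimP=> r; rewrite inE => /andP[Pr _] _ [-> _]; apply: mem_homimg.
  have sfS := homimg_sub fusF sPS Ff.
  have Fc : Fm Q (f1 \o g) by apply: (Fm_comp fusF sQS sfS).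
  exists Q, (f1 \o g); split=> //; apply: group_inj; apply/setP=> r.
  have memR (q : gT * gT) : q \in setX P S ->
      (q \in R) = (q.2 \in Q) && (f q.1 == g q.2).
    move=> Xq; have -> : (q \in R) = (graph_push sPS Ff q \in graph_push sPS Ff @* R).
      apply/idP/idP=> [Rq|/morphimP[q' Xq' Rq']]; first exact: mem_morphim.
      by move/(injmP (push_inj sPS Ff) _ _ Xq Xq') ->.
    by have := congr1 (fun G : {group _} => graph_push sPS Ff q \in G) defR; rewrite mem_graph.
  rewrite mem_graph //; apply/idP/andP=> [Rr|[Qr /eqP e]].
    have Xr := subsetP sR r Rr; have := Xr; rewrite inE => /andP[Pr _].
    by move: Rr; rewrite memR // => /andP[Qr /eqP e]; rewrite Qr /= -e f1K.
  rewrite memR; first by rewrite Qr e /= fK ?gQ.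
  by rewrite inE e /= f1P ?gQ // (subsetP sQS).
case: (posnP (mkl Hs R)) => [R0|/(mkl_isF FHs)//].
case: (posnP (mkl Hs (graph_push sPS Ff @* R))) => [->//|gt0].
apply: eqF; apply: Fback; exact: (mkl_isF FHs gt0).
Qed.

End Biset.

(** * A stable family of graph subgroups *)

Lemma modn_cancel r k a b c N : 0 < r -> N = (r * k)%N ->
  N %| r * a + c -> N %| r * b + c -> a = b %[mod k].
Proof.
move=> r_gt0 -> /eqP da /eqP db; apply/eqP; rewrite -(eqn_pmul2l r_gt0) !muln_modr.
by rewrite -(eqn_modDr c) da db.
Qed.

Section StableBiset.
Variables (gT : finGroupType) (p : nat) (S : {group gT}) (F : fsys gT).
Implicit Types (P Q : {group gT}) (R H K N : {group gT * gT}) (f g : gT -> gT).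
Implicit Types (Hs Ks : seq {group gT * gT}).
Hypotheses (prp : prime p) (pS : p.-group S) (satF : saturated p S F).
Let fusF : fusion_system S F := satF.1.
Let D : {group gT * gT} := setX_group S S.
Local Notation Fm := (Fm S F).
Local Notation mk := (mark D).
Local Notation mkl := (markl D).
Local Notation isF := (isF S F).
Local Notation stable := (stable S F).

(** If (a, b) normalizes the graph of f, then b normalizes Q and a acts on f(Q) as f c_b f^-1. As
    [g0] is defined on all of N_S(Q), the map g0 f^-1 carries this to conjugation by g0(b). It
    therefore extends to the first projection of the normalizer of the graph, its image being fully
    centralized. *)
Lemma push_setup Q f g0 : Q \subset S -> Fm Q f -> Fm 'N_S(Q)%G g0 ->
    fully_normalized S F (homimg g0 Q) ->
  exists P psi (sPS : P \subset S) (Fpsi : Fm P psi),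
    'N_D(graph_of Q f) \subset setX P S /\ {in Q, forall x, psi (f x) = g0 x}.
Proof.
move=> sQS Ff Fg0 fnQ; set N := 'N_D(_).
have NP r : r \in N ->
    [/\ r.1 \in S, r.2 \in 'N_S(Q) & forall x, x \in Q -> f x ^ r.1 = f (x ^ r.2)].
  case: r => a b /setIP[]; rewrite inE /= => /andP[Sa Sb] nab.
  have cf x : x \in Q -> (x ^ b \in Q) && (f x ^ a == f (x ^ b)).
    move=> Qx; have : (f x, x) ^ (a, b) \in graph_of Q f.
      by rewrite memJ_norm // (mem_graph satF) //= Qx eqxx.
    by rewrite (mem_graph satF).
  split=> //; last by move=> x /cf/andP[_ /eqP].
  rewrite inE Sb /=; apply/normP/eqP; rewrite eqEcard cardJg leqnn andbT.
  by apply/subsetP=> _ /imsetP[x /cf/andP[Qx _] ->].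
have gP : group_set [set r.1 | r in N].
  apply/group_setP; split=> [|_ _ /imsetP[r Nr ->] /imsetP[s Ns ->]].
    by apply/imsetP; exists 1; rewrite ?group1.
  by apply/imsetP; exists (r * s); rewrite ?groupM.
have sNS : 'N_S(Q)%G \subset S := subsetIl _ _.
have sQN : Q \subset 'N_S(Q)%G by rewrite subsetI sQS normG.
have Fg0Q := Fm_sub fusF sNS sQN Fg0.
have [f1 [Ff1 f1K f1Q fK]] := Fm_inv fusF sQS Ff.
have sfS := homimg_sub fusF sQS Ff.
have Fpsi0 : Fm (homimg f Q) (g0 \o f1) by apply: (Fm_comp fusF sfS sQS).
have Epsi0 : homimg (g0 \o f1) (homimg f Q) = homimg g0 Q.
  apply: group_inj; apply: (homimg_eq fusF) => //; last by rewrite !(card_homimg fusF).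
  by move=> y fy; rewrite /= mem_homimg // f1Q.
have sPN : Group gP \subset 'N_S(homimg f Q).
  apply/subsetP=> _ /imsetP[r Nr ->]; have [Sr /setIP[Sr2 nr] er] := NP r Nr.
  rewrite inE Sr; apply/normP/eqP; rewrite eqEcard cardJg leqnn andbT.
  apply/subsetP=> _ /imsetP[y + ->]; rewrite (homimgE fusF) // => /imsetP[x Qx ->].
  by rewrite er // imset_f // memJ_norm.
have [||psi Fpsi epsi] := Fm_extend satF sfS sPN Fpsi0.
- by rewrite Epsi0; apply: (fully_normalized_centralized satF) => //; apply: (homimg_sub fusF).
- move=> _ /imsetP[r Nr ->]; have [Sr Nr2 er] := NP r Nr.
  exists (g0 r.2); first by rewrite (Fm_in fusF sNS Fg0).
  move=> y; rewrite (homimgE fusF) // => /imsetP[x Qx ->].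
  have [_ nr2] := setIP Nr2.
  rewrite er //= !f1K ?memJ_norm //.
  have Nx := subsetP sQN x Qx.
  by rewrite !conjgE !(Fm_M fusF sNS Fg0) ?(Fm_V fusF sNS Fg0) ?groupM ?groupV.
have sPS : Group gP \subset S by apply: subset_trans sPN (subsetIl _ _).
exists (Group gP), psi, sPS, Fpsi; split=> [|x Qx]; last first.
  by rewrite epsi ?mem_homimg //= f1K.
apply/subsetP=> r Nr; rewrite inE; have [_ /setIP[-> _] _] := NP r Nr.
by rewrite andbT; apply/imsetP; exists r.
Qed.

Lemma push_normalizer Q f g0 : Q \subset S -> Fm Q f -> Fm 'N_S(Q)%G g0 ->
    fully_normalized S F (homimg g0 Q) ->
  exists P psi (sPS : P \subset S) (Fpsi : Fm P psi),
    [/\ 'N_D(graph_of Q f) \subset setX P S,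
        graph_push satF sPS Fpsi @* graph_of Q f = graph_of Q g0
      & graph_push satF sPS Fpsi @* 'N_D(graph_of Q f) \subset 'N_D(graph_of Q g0)].
Proof.
move=> sQS Ff Fg0 fnQ.
have [P [psi [sPS [Fpsi [sNX epsi]]]]] := push_setup sQS Ff Fg0 fnQ.
exists P, psi, sPS, Fpsi; set R := graph_of Q f; set R0 := graph_of Q g0.
set J := graph_push satF sPS Fpsi.
have sRN : R \subset 'N_D(R) by rewrite subsetI (graph_sub satF) // normG.
have defR0 : J @* R = R0.
  rewrite push_graph //; last first.
    move=> x Qx; have : (f x, x) \in R by rewrite (mem_graph satF) //= Qx eqxx.
    by move/(subsetP sRN)/(subsetP sNX); rewrite inE => /andP[].
  rewrite /R0 /graph_of /=; congr <<_>>; apply: eq_in_imset => x Qx.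
  by rewrite /= epsi.
split=> //; rewrite subsetI -defR0 morphim_norms ?subsetIr // andbT.
apply/subsetP=> _ /morphimP[r Xr Nr ->]; rewrite inE /=.
move: Xr; rewrite inE => /andP[Pr Sr].
by rewrite (Fm_in fusF sPS Fpsi).
Qed.

(** Burnside counting for N = N_D(R) and for its isomorphic image gives two sums of marks divisible
    by |N|. Terms with n outside R involve subgroups of order above |R| and agree by stability; the
    others contribute |R| times the mark of R, resp. of R0. Dividing by |R| leaves a congruence
    modulo |N : R|. *)
Lemma mkl_cong Hs Q f g0 : (forall H, H \in Hs -> isF H) ->
    (forall Q', Q' \subset S -> #|Q| < #|Q'| -> stable Hs Q') ->
    Q \subset S -> Fm Q f -> Fm 'N_S(Q)%G g0 -> fully_normalized S F (homimg g0 Q) ->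
  mkl Hs (graph_of Q f) = mkl Hs (graph_of Q g0) %[mod mk (graph_of Q f) (graph_of Q f)].
Proof.
move=> FHs stH sQS Ff Fg0 fnQ.
have [P [psi [sPS [Fpsi [sNX defR0 sJN]]]]] := push_normalizer sQS Ff Fg0 fnQ.
set R := graph_of Q f in sNX defR0 sJN *; set R0 := graph_of Q g0 in defR0 sJN *.
set N := 'N_D(R)%G in sNX sJN.
set J := graph_push satF sPS Fpsi in defR0 sJN; have injJ : 'injm J := push_inj _ _ _.
have sRD : R \subset D := graph_sub satF sQS Ff.
have sRN : R \subset N by rewrite subsetI sRD normG.
have cR : #|R| = #|Q| := card_graph satF sQS Ff.
have nRN : N \subset 'N(R) := subsetIr _ _.
have sND : N \subset D := subsetIl _ _.
have [sJD nR0] : J @* N \subset D /\ J @* N \subset 'N(R0) by apply/andP; rewrite -subsetI.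
have dv1 := dvdn_sum_markl Hs sND nRN.
have dv2 := dvdn_sum_markl Hs sJD nR0.
rewrite card_injm // in dv2.
have E2 : \sum_(n in J @* N) mkl Hs (R0 <*> <[n]>) = \sum_(n in N) mkl Hs (J @* (R <*> <[n]>)).
  rewrite morphimEsub // big_imset /=; last first.
    by move=> x y Nx Ny; apply: (injmP injJ); apply: (subsetP sNX).
  apply: eq_bigr => n Nn; have Xn := subsetP sNX n Nn.
  by rewrite morphimY ?morphim_cycle ?defR0 // ?cycle_subG // (subset_trans sRN).
rewrite {}E2 in dv2.
pose B := \sum_(n in N | n \notin R) mkl Hs (R <*> <[n]>).
have E1 : \sum_(n in N) mkl Hs (R <*> <[n]>) = #|R| * mkl Hs R + B.
  rewrite (bigID (mem R)) /=; congr (_ + _).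
  rewrite (eq_bigl (mem R)) => [|n]; last first.
    by case Rn: (n \in R); rewrite ?andbF // (subsetP sRN).
  rewrite -sum_nat_const; apply: eq_bigr => n Rn.
  by have /joing_idPl -> : <[n]> \subset R by rewrite cycle_subG.
have E2 : \sum_(n in N) mkl Hs (J @* (R <*> <[n]>)) = #|R| * mkl Hs R0 + B.
  rewrite (bigID (mem R)) /=; congr (_ + _).
    rewrite (eq_bigl (mem R)) => [|n]; last first.
      by case Rn: (n \in R); rewrite ?andbF // (subsetP sRN).
    rewrite -sum_nat_const; apply: eq_bigr => n Rn.
    by have /joing_idPl -> : <[n]> \subset R; rewrite ?cycle_subG // defR0.
  apply: eq_bigr => n /andP[Nn nRn].
  apply: (@mkl_push _ _ _ _ satF #|Q|) => //.
    by apply: subset_trans sNX; rewrite join_subG sRN cycle_subG.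
  rewrite -cR; apply: proper_card; rewrite properE joing_subl join_subG subxx /=.
  by rewrite cycle_subG.
rewrite {}E1 in dv1; rewrite {}E2 in dv2.
rewrite mark_self //; apply: modn_cancel dv1 dv2; first exact: cardG_gt0.
by rewrite Lagrange.
Qed.

(** Adding copies of the coset space of graph(h) changes, among graphs over Q, only the marks of
    D-conjugates of graph(h), each copy by |N_D(graph(h)) : graph(h)|. All marks over Q can thus be
    raised to a common value [t]. *)
Lemma stable_step Hs Q : (forall H, H \in Hs -> isF H) ->
    (forall Q', Q' \subset S -> #|Q| < #|Q'| -> stable Hs Q') -> Q \subset S ->
  exists Ks, (forall K, K \in Ks -> exists2 f, Fm Q f & K = graph_of Q f) /\
    stable (Ks ++ Hs) Q.
Proof.
move=> FHs stH sQS.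
have [f0 Ff0 fn0] := fully_normalized_rep fusF sQS.
have [g0 Fg0 E0] := Fm_to_fully_normalized pS satF sQS Ff0 fn0.
rewrite -E0 in fn0.
pose G f := graph_of Q f; pose m f := mkl Hs (G f).
(* [B] bounds every mark over Q, so [t] does too; the multiple of |D| leaves the class of [m g0]
   unchanged modulo every index that occurs. *)
pose B := \sum_(f : {ffun gT -> gT}) m f; pose t := m g0 + #|D| * B.
have idx_gt0 f : Fm Q f -> 0 < mk (G f) (G f).
  by move=> Ff; rewrite mark_self ?(graph_sub satF) ?indexg_gt0.
have GF f : {in Q, [ffun x => f x] =1 f} by move=> x _; rewrite ffunE.
have Gff f : G [ffun x => f x] = G f.
  by apply: group_inj; rewrite /G /graph_of /=; congr <<_>>; apply: eq_in_imset => x /(GF f) ->.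
have le_t f : m f <= t.
  apply: leq_trans (leq_addl _ _); apply: leq_trans (leq_pmull _ (cardG_gt0 D)).
  by rewrite -[m f]/(mkl Hs (G f)) -Gff /B (bigD1 [ffun x => f x]) //= leq_addr.
have dv_t f : Fm Q f -> mk (G f) (G f) %| t - m f.
  move=> Ff; rewrite -eqn_mod_dvd // eq_sym /m (mkl_cong FHs stH sQS Ff Fg0 fn0).
  have dv : mk (G f) (G f) %| #|D| * B.
    apply/dvdn_mulr; rewrite mark_self ?(graph_sub satF) //.
    apply: dvdn_trans (dvdn_indexg _ _) _; apply: cardSg; exact: subsetIl.
  by rewrite /t -modnDmr (eqP dv) addn0.
have conjG f h : Fm Q f -> Fm Q h -> 0 < mk (G f) (G h) ->
    forall H, mk H (G h) = mk H (G f).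
  move=> Ff Fh gt0; have [|d Dd ->] := mark_conj _ gt0; first by rewrite !(card_graph satF).
  by move=> H; rewrite markJ.
have [s] : exists s : seq {ffun gT -> gT}, forall f, Fm Q f -> [ffun x => f x] \in s.
  by exists (enum {ffun gT -> gT}) => f _; rewrite mem_enum.
move=> sP.
(* Induction over a list of all maps. The alternative (untouched or already [t]) records that a
   conjugacy class of graphs is corrected at most once. *)
suff [Ks [KsF Km Kt]] : exists Ks, [/\ forall K, K \in Ks -> exists2 f, Fm Q f & K = G f,
    forall f, Fm Q f -> mkl (Ks ++ Hs) (G f) = m f \/ mkl (Ks ++ Hs) (G f) = t
  & forall f : {ffun gT -> gT}, f \in s -> Fm Q f -> mkl (Ks ++ Hs) (G f) = t].
  exists Ks; split=> // f g Ff Fg.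
  have ff h : Fm Q h -> Fm Q [ffun x => h x] by rewrite (@Fm_ext _ _ _ _ _ h).
  have := Kt _ (sP f Ff) (ff f Ff); rewrite Gff => ->.
  by have := Kt _ (sP g Fg) (ff g Fg); rewrite Gff => ->.
elim: {sP} s => [|h s [Ks [KsF Km Kt]]].
  by exists [::]; split=> // f _; left.
have [Fh|nFh] := boolP (Fm Q h); last first.
  exists Ks; split=> // f; rewrite inE => /orP[/eqP -> Ff|]; first by rewrite Ff in nFh.
  exact: Kt.
have [mh|mh] : mkl (Ks ++ Hs) (G h) = m h \/ mkl (Ks ++ Hs) (G h) = t by apply: Km.
  pose k := (t - m h) %/ mk (G h) (G h).
  have Knew f : Fm Q f -> mkl ((nseq k (G h) ++ Ks) ++ Hs) (G f) =
      (k * mk (G h) (G f) + mkl (Ks ++ Hs) (G f))%N.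
    by move=> Ff; rewrite -catA markl_cat markl_nseq.
  have Knew_t f : Fm Q f -> 0 < mk (G h) (G f) -> mkl ((nseq k (G h) ++ Ks) ++ Hs) (G f) = t.
    move=> Ff gt0; rewrite Knew // (conjG _ _ Fh Ff gt0) /k divnK ?dv_t //.
    rewrite /markl (eq_bigr _ (fun H _ => conjG _ _ Fh Ff gt0 H)) -/(markl _ _ _).
    by rewrite mh subnK.
  have Knew_0 f : Fm Q f -> mk (G h) (G f) = 0%N ->
      mkl ((nseq k (G h) ++ Ks) ++ Hs) (G f) = mkl (Ks ++ Hs) (G f).
    by move=> Ff e; rewrite Knew // e muln0.
  exists (nseq k (G h) ++ Ks); split=> [K|f Ff|f].
  - rewrite mem_cat mem_nseq => /orP[/andP[_ /eqP ->]|/KsF//].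
    by exists h.
  - case: (posnP (mk (G h) (G f))) => [/(Knew_0 _ Ff) ->|/(Knew_t _ Ff)]; last by right.
    exact: Km.
  rewrite inE => /orP[/eqP -> _|sf Ff].
    by apply: Knew_t => //; apply: idx_gt0.
  case: (posnP (mk (G h) (G f))) => [/(Knew_0 _ Ff) ->|/(Knew_t _ Ff)//].
  exact: Kt.
by exists Ks; split=> // f; rewrite inE => /orP[/eqP ->|/Kt].
Qed.

Lemma stable_conj Hs Q b : Q \subset S -> b \in S -> stable Hs Q -> stable Hs (Q :^ b)%G.
Proof.
move=> sQS Sb stQ.
have sQbS : Q :^ b \subset S by rewrite -(conjGid Sb) conjSg.
have E f : Fm (Q :^ b)%G f -> exists2 g, Fm Q g &
    mkl Hs (graph_of (Q :^ b) f) = mkl Hs (graph_of Q g).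
  move=> Ff; have Sb' : b^-1 \in S by rewrite groupV.
  have [eG] := graphJ satF (sQbS : (Q :^ b)%G \subset S) Ff (group1 S) Sb'.
  have -> : ((Q :^ b) :^ b^-1)%G = Q by apply: group_inj; rewrite /= conjsgK.
  move=> Fg; exists (fun x => f (x ^ b^-1^-1) ^ 1) => //.
  rewrite -(@markl_J _ D Hs (graph_of (Q :^ b) f) (1, b^-1)); last by rewrite inE /= group1.
  congr (mkl Hs _); rewrite -[LHS]/(gval (_ :^ _)%G) eG; congr (gval (graph_of _ _)).
  by apply: group_inj; rewrite /= conjsgK.
by move=> f1 f2 /E[g1 Fg1 ->] /E[g2 Fg2 ->]; apply: stQ.
Qed.

(** The subgroups Q of order n are treated one at a time. Graphs over Q have zero marks at graphs of
    larger order, and at graphs of order n over subgroups not S-conjugate to Q; S-conjugates of Q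
    inherit stability from Q. *)
Lemma stable_order_step n Hs : (forall H, H \in Hs -> isF H) ->
    (forall Q, Q \subset S -> n < #|Q| -> stable Hs Q) ->
  exists Ks, (forall K, K \in Ks -> isF K /\ #|K| = n) /\
    (forall Q, Q \subset S -> n <= #|Q| -> stable (Ks ++ Hs) Q).
Proof.
move=> FHs stH.
have stbig Ks Q : (forall K, K \in Ks -> #|K| = n) -> Q \subset S -> n < #|Q| ->
    stable (Ks ++ Hs) Q.
  move=> Kn sQS ltn f g Ff Fg; rewrite !markl_cat (stH Q sQS ltn f g) //.
  congr (_ + _); rewrite /markl !big_seq !big1 // => K /Kn eK.
    by apply: mark_small; rewrite (card_graph satF) // eK.
  by apply: mark_small; rewrite (card_graph satF) // eK.
suff [Ks [KF Ks_st]] : exists Ks, (forall K, K \in Ks -> isF K /\ #|K| = n) /\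
    (forall Q, Q \in enum {group gT} -> Q \subset S -> #|Q| = n -> stable (Ks ++ Hs) Q).
  exists Ks; split=> // Q sQS; rewrite leq_eqVlt => /orP[/eqP eQ|ltn].
    by apply: Ks_st; rewrite // mem_enum.
  by apply: stbig => // K /KF[].
elim: (enum _) => [|Q s [Ks [KF Ks_st]]]; first by exists [::].
case: (boolP ((Q \subset S) && (#|Q| == n))) => [/andP[sQS /eqP eQ]|nQ]; last first.
  exists Ks; split=> // Q'; rewrite inE => /orP[/eqP -> sQS eQ|]; last exact: Ks_st.
  by rewrite sQS eQ eqxx in nQ.
have [||//|K2 [K2F st2]] := @stable_step (Ks ++ Hs) Q.
- by move=> H; rewrite mem_cat => /orP[/KF[]|/FHs].
- by rewrite eQ => Q' sQ'S ltn; apply: stbig => // K /KF[].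
exists (K2 ++ Ks); rewrite -catA; split=> [K|Q'].
  rewrite mem_cat => /orP[/K2F[f Ff ->]|/KF//].
  by rewrite (card_graph satF) //; split=> //; apply: isF_graph.
rewrite inE => /orP[/eqP -> //|sQ'] sQ'S eQ'.
case: (boolP [exists b in S, Q' == (Q :^ b)%G]) => [/existsP[b /andP[Sb /eqP ->]]|nconj].
  exact: stable_conj.
have zero f : Fm Q' f -> mkl K2 (graph_of Q' f) = 0%N.
  move=> Ff; apply/eqP; rewrite -leqn0 leqNgt; apply/negP.
  case/markl_gt0=> K /K2F[g Fg ->] /mark_conj[|d Dd e].
    by rewrite !(card_graph satF) // eQ eQ'.
  case/negP: nconj; apply/existsP; move: Dd; case: d e => a b e; rewrite inE /=.
  case/andP=> Sa Sb; exists b; rewrite Sb /=; apply/eqP; apply: group_inj; apply/eqP.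
  rewrite eq_sym eqEcard /= cardJg eQ eQ' leqnn andbT; apply/subsetP=> _ /imsetP[x Qx ->].
  have : (g x, x) ^ (a, b) \in graph_of Q' f.
    by rewrite e memJ_conjg (mem_graph satF) //= Qx eqxx.
  by rewrite (mem_graph satF) // => /andP[].
move=> f g Ff Fg; rewrite !(markl_cat D K2) !zero //; congr (_ + _).
exact: Ks_st.
Qed.

(** One graph is taken for each coset of Aut_S(S) in Aut_F(S). Graphs of automorphisms in different
    cosets are not conjugate in D, so each automorphism meets a single term; the number of cosets is
    prime to p by axiom (I). *)
Lemma stable_base : exists Ks,
  [/\ forall K, K \in Ks -> isF K /\ #|K| = #|S|, stable Ks S & coprime p (size Ks)].
Proof.
pose G (s : {perm gT}) := graph_of S s.
have fnS : fully_normalized S F S := @fully_normalized_S _ S F.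
have AFf s : s \in AF S F S -> Fm S s := AF_Fm satF (subxx S).
have rC C : C \in lcosets (AS S S) (AF S F S) ->
    repr C \in AF S F S /\ C = repr C *: AS S S.
  case/lcosetsP=> s As ->.
  have rs : repr (s *: AS S S) \in s *: AS S S by apply: mem_repr (lcoset_refl _ _).
  split; last by apply/lcoset_eqP; rewrite lcoset_sym.
  by case/lcosetP: rs => t /(subsetP (AS_AF satF (subxx S))) At ->; apply: groupM.
pose Ks := [seq G (repr C) | C in lcosets (AS S S) (AF S F S)].
have conjG s t : s \in AF S F S -> t \in AF S F S -> 0 < mk (G s) (G t) -> t \in s *: AS S S.
  move=> As At; case/mark_conj=> [|[a b] + e]; first by rewrite !(card_graph satF) ?AFf.
  rewrite inE /= => /andP[Sa Sb]; rewrite mem_lcoset.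
  have Ast : s^-1 * t \in AF S F S by rewrite groupM ?groupV.
  apply/(mem_AS _ (subxx S)); split; first by move: Ast; rewrite (mem_AF satF) // => /andP[].
  exists (s b^-1 * a); first by rewrite (setIidPl (normG S)) groupM // (AF_in satF) // groupV.
  move=> y Sy; rewrite permM; set x := s^-1 y.
  have Sx : x \in S by rewrite /x (AF_in satF) // groupV.
  have : (s (x ^ b^-1) ^ a, (x ^ b^-1) ^ b) \in G t.
    have -> : (s (x ^ b^-1) ^ a, (x ^ b^-1) ^ b) = (s (x ^ b^-1), x ^ b^-1) ^ (a, b) by [].
    rewrite e memJ_conjg (mem_graph satF) ?AFf //=.
    by rewrite memJ_norm ?Sx ?eqxx // (subsetP (normG S)) ?groupV.
  rewrite (mem_graph satF) ?AFf //= => /andP[_ /eqP]; rewrite conjgKV => <-.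
  have Sb' : b^-1 \in S by rewrite groupV.
  rewrite [x ^ _]conjgE !(Fm_M fusF (subxx S) (AFf _ As)) ?(Fm_V fusF (subxx S) (AFf _ As)) ?groupM ?groupV //.
  by rewrite -conjgE conjgM [s x]permKV.
(* [push_normalizer] embeds the normalizer of either graph into that of the other, whence equal
   orders. *)
have idxG s t : s \in AF S F S -> t \in AF S F S -> mk (G s) (G s) = mk (G t) (G t).
  have le u v : u \in AF S F S -> v \in AF S F S -> #|'N_D(G u)| <= #|'N_D(G v)|.
    move=> Au Av; have EN : 'N_S(S)%G = S by apply: group_inj; apply: (setIidPl (normG S)).
    have [||P [psi [sPS [Fpsi [sNX _ sJ]]]]] := push_normalizer (subxx S) (AFf _ Au) (g0 := v).
    - by rewrite EN AFf.
    - suff -> : homimg v S = S by [].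
      apply: group_inj; apply: (homimg_eq fusF); rewrite ?AFf // => x.
      by rewrite (AF_in satF).
    by apply: leq_trans (subset_leq_card sJ); rewrite card_injm // push_inj.
  move=> As At; rewrite !mark_self ?(graph_sub satF) ?AFf //.
  rewrite -!divgS ?subsetI ?(graph_sub satF) ?AFf ?normG // !(card_graph satF) ?AFf //.
  by congr (_ %/ _)%N; apply/eqP; rewrite eqn_leq !le.
exists Ks; split.
- move=> K /imageP[C /rC[Ar _] ->].
  by split; [apply: isF_graph; rewrite ?AFf | rewrite (card_graph satF) ?AFf].
- move=> f g Ff Fg.
  suff val h : Fm S h -> mkl Ks (graph_of S h) = mk (G 1) (G 1) by rewrite !val.
  move=> Fh; have [x|s As es] := AF_perm satF (subxx S) Fh; first exact: (Fm_in fusF).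
  have -> : graph_of S h = G s.
    by apply: group_inj; rewrite /G /graph_of /=; congr <<_>>; apply: eq_in_imset => x /es ->.
  have lcS : s *: AS S S \in lcosets (AS S S) (AF S F S) by apply/lcosetsP; exists s.
  have [Ar eC] := rC _ lcS; set r := repr _ in Ar eC.
  rewrite /markl /Ks big_image /= (bigD1 _ lcS) /= -/r big1 ?addn0.
    rewrite (idxG 1 r) ?group1 //.
    have : s \in r *: AS S S by rewrite -eC lcoset_refl.
    rewrite mem_lcoset => /(mem_AS _ (subxx S))[_ [n /setIP[Sn _] en]].
    rewrite -[RHS](@markJ _ D _ _ (n, 1)); last by rewrite inE /= Sn group1.
    congr (mk _ _); rewrite -[RHS]/(gval (_ :^ _)%G).
    have [-> Fr] := graphJ satF (subxx S) (AFf _ Ar) Sn (group1 S).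
    have -> : (S :^ 1)%G = S by apply: group_inj; apply: conjsg1.
    rewrite /G /graph_of /=; congr <<_>>; apply: eq_in_imset => x Sx.
    have Sr : r x \in S by rewrite (AF_in satF).
    by rewrite invg1 conjg1 -(en _ Sr) permM permK.
  move=> C /andP[lC nC]; apply/eqP; rewrite -leqn0 leqNgt; apply: contra nC => gt0.
  have [Arc eqC] := rC C lC; rewrite eqC; apply/eqP/lcoset_eqP.
  by rewrite lcoset_sym; apply: conjG.
rewrite size_image card_lcosets.
have /and3P[_ _] := AS_Sylow satF (subxx S) fnS.
by rewrite p'natE // prime_coprime.
Qed.

Lemma stable_list : exists Hs, [/\ forall H, H \in Hs -> isF H,
  forall Q, Q \subset S -> stable Hs Q
  & coprime p (count [pred H : {group gT * gT} | #|H| == #|S|] Hs)].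
Proof.
have [K0 [K0F K0st cop]] := stable_base.
suff [Hs [HF Hst Hc]] : exists Hs, [/\ forall H, H \in Hs -> isF H,
    forall Q, Q \subset S -> 0 <= #|Q| -> stable Hs Q
  & count [pred H : {group gT * gT} | #|H| == #|S|] Hs = size K0].
  by exists Hs; rewrite Hc; split=> // Q sQS; apply: Hst.
(* After m steps the family is stable over all subgroups of order at least |S| - m. Graphs added
   later have order below |S|, so the number of terms of order |S| stays that of the base. *)
have [m] : exists m, m = #|S| by exists #|S|.
move=> em; rewrite -(subnn #|S|) -{2}em.
have : m <= #|S| by rewrite em.
elim: m {em} => [_|m IHm ltm].
  exists K0; rewrite subn0; split=> [H /K0F[]//|Q sQS le|].
    have -> // : Q = S; apply: group_inj; apply/eqP.
    by rewrite eqEcard sQS.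
  by apply/eqP; rewrite -all_count; apply/allP=> H /K0F[_ /= ->].
have [Hs [HF Hst Hc]] := IHm (ltnW ltm).
have [|Ks [KF Kst]] := @stable_order_step (#|S| - m.+1) Hs HF.
  by move=> Q sQS lt; apply: Hst => //; apply: leq_trans lt; rewrite subnS leqSpred.
exists (Ks ++ Hs); split=> // [H|]; first by rewrite mem_cat => /orP[/KF[]|/HF].
rewrite count_cat Hc; have -> // : count [pred H : {group gT * gT} | #|H| == #|S|] Ks = 0%N.
apply/eqP; rewrite -leqn0 leqNgt -has_count; apply/hasPn=> K /KF[_ /= ->].
by rewrite neq_ltn ltn_subrL cardG_gt0.
Qed.

End StableBiset.

(** * The characteristic biset *)

Section CharacteristicBiset.
Variables (gT : finGroupType) (p : nat) (S : {group gT}) (F : fsys gT).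
Implicit Types (P Q : {group gT}) (R H K : {group gT * gT}) (f : gT -> gT).
Hypotheses (prp : prime p) (pS : p.-group S) (satF : saturated p S F).
Let fusF : fusion_system S F := satF.1.
Let D : {group gT * gT} := setX_group S S.

(* The free right S-set Y x S with left S-action g (y, s) = (g y, c(g, y) s),
   whose isomorphism type is invariant under restriction along F-morphisms. *)
Definition stable_biset (T : finType) (Y : {set T}) (act : gT -> T -> T) (c : gT -> T -> gT) :=
  [/\ forall g y, g \in S -> y \in Y -> act g y \in Y /\ c g y \in S,
      forall y, y \in Y -> act 1 y = y,
      forall g h y, g \in S -> h \in S -> y \in Y ->
        act (g * h) y = act g (act h y) /\ c (g * h) y = c g (act h y) * c h y,
      forall P y, P \subset S -> y \in Y -> (forall g, g \in P -> act g y = y) ->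
        Fm S F P (c^~ y)
    & forall P f, P \subset S -> Fm S F P f -> exists th : T -> T, exists s : T -> gT,
        [/\ {in Y &, injective th}, forall y, y \in Y -> th y \in Y /\ s y \in S
          & forall g y, g \in P -> y \in Y -> th (act g y) = act (f g) (th y) /\
              c (f g) (th y) * s y = s (act g y) * c g y]].

Section FromList.
Variable Hs : seq {group gT * gT}.
Hypotheses (FHs : forall H, H \in Hs -> isF S F H).
Hypothesis (stHs : forall Q, Q \subset S -> stable S F Hs Q).

Let k := size Hs.
(** The index in the first component makes the union of the coset spaces disjoint even when [Hs]
    repeats a subgroup. *)
Let T : finType := ('I_k * {set gT * gT})%type.
Let H_ (i : 'I_k) : {group gT * gT} := nth 1%G Hs i.
Let mv (w : T) (d : gT * gT) : T := (w.1, w.2 :* d).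
Let Om : {set T} := [set w : T | w.2 \in rcosets (H_ w.1) D].

Let FH i : isF S F (H_ i). Proof. by apply: FHs; apply: mem_nth. Qed.

Let mv1 w : mv w 1 = w. Proof. by rewrite /mv mulg1 -surjective_pairing. Qed.

Let mvM w d e : mv w (d * e) = mv (mv w d) e. Proof. by rewrite /mv /= rcosetM. Qed.

Let mvOm w d : d \in D -> w \in Om -> mv w d \in Om.
Proof.
move=> Dd; rewrite !inE /= => /rcosetsP[x Dx ->]; apply/rcosetsP.
by exists (x * d); rewrite ?groupM ?rcosetM.
Qed.

Let stabOm w : w \in Om -> exists2 K, isF S F K & forall d, (mv w d == w) = (d \in K).
Proof.
case: w => i C; rewrite inE /= => /rcosetsP[x Dx ->].
exists (H_ i :^ x)%G => [|d]; first exact: (isF_J satF Dx (FH i)).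
rewrite /mv /= -pair_eqE /= eqxx /= -rcosetM.
apply/eqP/idP=> [e|].
  have : x * d \in H_ i :* x by rewrite -e rcoset_refl.
  by rewrite mem_rcoset mem_conjg conjgE invgK mulgA.
rewrite mem_conjg conjgE invgK mulgA => e.
by apply/rcoset_eqP; rewrite mem_rcoset.
Qed.

(** A stabilizer is the graph of an injective map, hence meets 1 x S trivially. *)
Let free w s t : w \in Om -> s \in S -> t \in S -> mv w (1, s) = mv w (1, t) -> s = t.
Proof.
move=> Ow Ss St e; have [K [Q [f [sQS Ff defK]]] stK] := stabOm Ow.
have : mv w ((1, s) * (1, t)^-1) == w by rewrite mvM e -mvM mulgV mv1.
rewrite stK defK (mem_graph satF) // => /andP[Qst /eqP e1].
have {}e1 : 1 * 1^-1 = f (s * t^-1) := e1.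
apply/eqP; rewrite eq_mulgV1; apply/eqP; apply: (Fm_inj fusF sQS Ff) => //.
by rewrite -e1 invg1 mulg1 (Fm_1 fusF sQS Ff).
Qed.

Let card_fixpts (R : {set gT * gT}) : #|fixpts mv Om R| = markl D Hs R.
Proof.
rewrite /markl (big_nth 1%G) big_mkord -sum1_card.
rewrite (eq_bigl (fun w : T => w.2 \in 'Fix_(rcosets (H_ w.1) D | 'Rs)(R))).
  rewrite -(pair_big_dep xpredT
    (fun (i : 'I_k) C => C \in 'Fix_(rcosets (H_ i) D | 'Rs)(R)) (fun _ _ => 1%N)).
  by apply: eq_bigr => i _; rewrite sum1_card.
case=> i C; apply/fixptsP/setIP=> [[]|[rC]].
  by rewrite inE => rC fx; split=> //; apply/afixP=> r Rr /=; have [] := fx r Rr; rewrite rcosetE.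
rewrite inE /= => /subsetP fx; split=> [|r Rr]; first by rewrite inE.
by rewrite /mv /=; congr (_, _); have := fx r Rr; rewrite inE /= rcosetE => /eqP.
Qed.

(** Orbits of the free action of 1 x S: [rp w] is a chosen point of the orbit of w and [sg w] the
    S-coordinate of w relative to it. The representatives form [Y], and the left action of g is
    translation by (g^-1, 1). *)
Let orb w := [set mv w (1, s) | s in S].
Let rp w := odflt w [pick v in orb w].
Let sg w := odflt 1 [pick s in S | mv (rp w) (1, s) == w].

Let D1 s : s \in S -> ((1, s) : gT * gT) \in D.
Proof. by move=> Ss; rewrite inE /= group1. Qed.

Let orbM w s : s \in S -> orb (mv w (1, s)) = orb w.
Proof.
move=> Ss; apply/setP=> v; apply/imsetP/imsetP=> [[t St ->]|[t St ->]].
  exists (s * t); rewrite ?groupM // -mvM; congr (mv _ _).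
  by rewrite -[LHS]/(1 * 1, s * t) mulg1.
exists (s^-1 * t); rewrite ?groupM ?groupV // -mvM; congr (mv _ _).
by rewrite -[RHS]/(1 * 1, s * (s^-1 * t)) mulg1 mulKVg.
Qed.

Let rp_orb w : rp w \in orb w.
Proof.
rewrite /rp; case: pickP => //= /(_ w) /negP[].
by apply/imsetP; exists 1 => //; apply: esym (mv1 w).
Qed.

Let rpM w s : s \in S -> rp (mv w (1, s)) = rp w.
Proof.
move=> Ss; rewrite /rp orbM //; case: pickP => //= /(_ (rp w)).
by rewrite rp_orb.
Qed.

Let sgP w : w = mv (rp w) (1, sg w) /\ sg w \in S.
Proof.
rewrite /sg; case: pickP => [t /andP[St /eqP e]|/=]; first by rewrite /= e.
have /imsetP[s Ss e] := rp_orb w => /(_ s^-1); rewrite groupV Ss /= => /negP[].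
rewrite e -mvM -[_ * _]/(1 * 1, s * s^-1) mulg1 mulgV.
by rewrite mv1.
Qed.

Let rp_Om w : w \in Om -> rp w \in Om.
Proof. by move=> Ow; have /imsetP[s Ss ->] := rp_orb w; apply: mvOm (D1 Ss) Ow. Qed.

Let Y := [set rp w | w in Om].
Let act (g : gT) y := rp (mv y (g^-1, 1)).
Let c (g : gT) y := sg (mv y (g^-1, 1)).

Let YOm y : y \in Y -> y \in Om /\ rp y = y.
Proof.
case/imsetP=> w Ow ->; split; first exact: rp_Om.
by have [e Ss] := sgP w; rewrite -(rpM (rp w) Ss) -e.
Qed.

Let uniqY y s : y \in Y -> s \in S -> rp (mv y (1, s)) = y /\ sg (mv y (1, s)) = s.
Proof.
move=> Yy Ss; have [Oy ey] := YOm Yy; have er : rp (mv y (1, s)) = y by rewrite rpM.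
split=> //; have [e Ss'] := sgP (mv y (1, s)); rewrite er in e.
exact: (free Oy Ss' Ss).
Qed.

Let uniqYE y z s t : y \in Y -> z \in Y -> s \in S -> t \in S ->
  mv y (1, s) = mv z (1, t) -> y = z /\ s = t.
Proof.
move=> Yy Yz Ss St e; have [e1 e2] := uniqY Yy Ss; have [e3 e4] := uniqY Yz St.
by split; [rewrite -e1 e e3 | rewrite -e2 e e4].
Qed.

Let DV g : g \in S -> ((g^-1, 1) : gT * gT) \in D.
Proof. by move=> Sg; rewrite inE /= groupV Sg group1. Qed.

Let actE g y : g \in S -> y \in Y ->
  [/\ act g y \in Y, c g y \in S & mv y (g^-1, 1) = mv (act g y) (1, c g y)].
Proof.
move=> Sg Yy; have [Oy _] := YOm Yy; have [e Ss] := sgP (mv y (g^-1, 1)).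
by split=> //; apply: imset_f; apply: mvOm (DV Sg) Oy.
Qed.

Let mvC w g s : mv (mv w (1, s)) (g, 1) = mv (mv w (g, 1)) (1, s).
Proof.
rewrite -!mvM; congr (mv _ _).
by rewrite -[LHS]/(1 * g, s * 1) -[RHS]/(g * 1, 1 * s) !mulg1 !mul1g.
Qed.

Let mv1M w s t : mv (mv w (1, s)) (1, t) = mv w (1, s * t).
Proof. by rewrite -mvM -[_ * _]/(1 * 1, s * t) mulg1. Qed.

Let card_Y : #|Om| = (#|Y| * #|S|)%N.
Proof.
rewrite -cardsX -(@card_in_imset _ _ (fun u : T * gT => mv u.1 (1, u.2))); last first.
  move=> [y s] [z t]; rewrite !inE /= => /andP[Yy Ss] /andP[Yz St] e.
  by have [-> ->] := uniqYE Yy Yz Ss St e.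
apply: eq_card => w; apply/idP/imsetP=> [Ow|[[y s]]].
  have [e Ss] := sgP w; exists (rp w, sg w) => //.
  by rewrite inE /= Ss andbT; apply: imset_f.
by rewrite inE /= => /andP[/YOm[Oy _] Ss] ->; apply: mvOm (D1 Ss) Oy.
Qed.

(** Each H contributes |S|^2/|H| points, and S acts freely on them. *)
Let card_Om : #|Y| = \sum_(H <- Hs) #|S| %/ #|H|.
Proof.
apply/eqP; rewrite -(eqn_pmul2r (cardG_gt0 S)) -card_Y; apply/eqP.
have -> : Om = fixpts mv Om 1.
  apply/setP=> w; apply/idP/fixptsP=> [Ow|[]//]; split=> // r.
  by rewrite inE => /eqP ->; apply: mv1.
rewrite card_fixpts /markl big_distrl /=; apply: eq_big_seq => H HsH.
have sHD : H \subset D := isF_subD satF (FHs HsH).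
have -> : mark D H 1 = #|D : H|.
  rewrite /mark; apply: eq_card => C; rewrite inE.
  by apply/andb_idr => _; apply/afixP=> r; rewrite inE => /eqP ->; apply: act1.
have [Q [f [sQS Ff ->]]] := FHs HsH.
rewrite -divgS ?(graph_sub satF) // (card_graph satF) // /D cardsX.
by rewrite [RHS]mulnC muln_divA ?cardSg.
Qed.

Lemma stable_biset_of_list : stable_biset Y act c /\
  #|Y| = \sum_(H <- Hs) #|S| %/ #|H|.
Proof.
split; last exact: card_Om.
split.
- by move=> g y Sg Yy; have [] := actE Sg Yy.
- by move=> y Yy; have [_ ey] := YOm Yy; rewrite /act invg1 mv1.
- move=> g h y Sg Sh Yy; have [Yh Sch eh] := actE Sh Yy.
  have [Yg Scg eg] := actE Sg Yh; have [Ygh Scgh egh] := actE (groupM Sg Sh) Yy.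
  apply: uniqYE => //; first exact: groupM.
  rewrite -egh invMg.
  have -> : (h^-1 * g^-1, 1) = (h^-1, 1) * (g^-1, 1) :> gT * gT.
    by rewrite -[RHS]/(h^-1 * g^-1, 1 * 1) mulg1.
  by rewrite mvM eh mvC eg mv1M.
- move=> P y sPS Yy fixP; have [Oy _] := YOm Yy.
  have [K [Q [f [sQS Ff defK]]] stK] := stabOm Oy.
  (* If g fixes y, then (g, c(g, y)) stabilizes the point y, so it lies in the graph of some f;
     hence c(g, y) is f^-1(g). *)
  have [f1 [Ff1 f1K f1P fK]] := Fm_inv fusF sQS Ff.
  have val g : g \in P -> c g y \in Q /\ f (c g y) = g.
    move=> Pg; have Sg := subsetP sPS g Pg; have [_ Sc] := actE Sg Yy.
    rewrite fixP // => e.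
    have : mv y (g, c g y) == y.
      have -> : (g, c g y) = (1, c g y) * (g, 1) :> gT * gT.
        by rewrite -[RHS]/(1 * g, c g y * 1) mulg1 mul1g.
      by rewrite mvM -e -mvM -[_ * _]/(g^-1 * g, 1 * 1) mulVg mulg1 mv1.
    by rewrite stK defK (mem_graph satF) // => /andP[Qc /eqP e1]; split=> //; apply: esym e1.
  have sPf : P \subset homimg f Q.
    by apply/subsetP=> g /val[Qc e]; rewrite -e mem_homimg.
  have sfS := homimg_sub fusF sQS Ff.
  have Ff1P : Fm S F P f1 := Fm_sub fusF sfS sPf Ff1.
  have ecf : {in P, f1 =1 c^~ y} by move=> g /val[Qc e]; rewrite -{1}e f1K.
  by rewrite -(Fm_ext S F ecf).
move=> P f sPS Ff.
(* The two actions of P x S, through the inclusion and through f, have equal fixed-point counts by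
   stability, hence are isomorphic. The threshold 0 means that no order is excluded. Reading the
   isomorphism in the coordinates [rp] and [sg] gives the required maps. *)
pose G : {group gT * gT} := setX_group P S.
pose mv2 (w : T) (d : gT * gT) : T := mv w (f d.1, d.2).
have sGD : G \subset D by rewrite setXS.
have GP d : d \in G -> d.1 \in P /\ d.2 \in S by rewrite inE => /andP[].
have GfD d : d \in G -> (f d.1, d.2) \in D.
  by move=> /GP[Pd Sd]; rewrite inE /= Sd (Fm_in fusF sPS).
have act1 : gact_on G mv Om.
  split=> [w _|w d e _ _ _|w d Ow Gd]; [exact: mv1|exact: mvM|].
  by apply: mvOm Ow; apply: (subsetP sGD).
have act2 : gact_on G mv2 Om.
  split=> [w _|w d e _ Gd Ge|w d Ow Gd].
  - rewrite /mv2 /= (Fm_1 fusF sPS Ff); exact: mv1.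
  - have [Pd _] := GP d Gd; have [Pe _] := GP e Ge.
    by rewrite /mv2 -mvM /= (Fm_M fusF sPS Ff).
  by apply: mvOm Ow; apply: GfD.
have [|th [thi thOm the]] := fixpts_equivariant_bijection act1 act2.
  move=> R sRG; rewrite card_fixpts -(@mkl_push _ _ _ _ satF 0 Hs P f sPS Ff R) //.
  - rewrite -card_fixpts; apply: eq_card => w.
    rewrite morphimEsub //; apply/fixptsP/fixptsP=> [][Ow fx]; split=> //.
      by move=> r Rr; apply: fx; apply/imsetP; exists r.
    by move=> _ /imsetP[r Rr ->]; apply: fx.
  - by move=> Q sQS _; apply: stHs.
have thO w : w \in Om -> th w \in Om by move=> Ow; rewrite -thOm imset_f.
exists (fun y => rp (th y)), (fun y => sg (th y)); split.
- move=> y z Yy Yz e; have [Oy _] := YOm Yy; have [Oz _] := YOm Yz.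
  have [ey Sy] := sgP (th y); have [ez Sz] := sgP (th z).
  set sy := sg (th y) in ey Sy *; set sz := sg (th z) in ez Sz *.
  have Gs : (1, sy^-1 * sz) \in G by rewrite inE /= group1 groupM ?groupV.
  have : th (mv y (1, sy^-1 * sz)) = th z.
    by rewrite the // /mv2 /= (Fm_1 fusF sPS Ff) ey mv1M mulKVg ez e.
  move/thi => /(_ (mvOm (subsetP sGD _ Gs) Oy) Oz); rewrite -[z in RHS]mv1 => ezy.
  by have [|->] := uniqYE Yy Yz _ (group1 S) ezy; rewrite ?groupM ?groupV.
- move=> y Yy; have [Oy _] := YOm Yy; have [_ Sy] := sgP (th y); split=> //.
  by apply: imset_f; apply: thO.
move=> g y Pg Yy; have Sg := subsetP sPS g Pg; have Sfg := Fm_in fusF sPS Ff Pg.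
have [Oy _] := YOm Yy; have [Ygy Sc egy] := actE Sg Yy; have [Ogy _] := YOm Ygy.
have Yth z : z \in Om -> rp (th z) \in Y by move=> Oz; apply: imset_f; apply: thO.
have [Yf Scf ef] := actE Sfg (Yth _ Oy).
have [ey Sy] := sgP (th y); have [ey' Sy'] := sgP (th (act g y)).
set sy := sg (th y) in ey Sy *; set sy' := sg (th (act g y)) in ey' Sy' *.
have Gg : (g^-1, 1) \in G by rewrite inE /= groupV Pg group1.
have Gc : (1, c g y) \in G by rewrite inE /= group1.
have E1 := the y _ Oy Gg; have E2 := the (act g y) _ Ogy Gc.
rewrite egy E2 /mv2 /= (Fm_1 fusF sPS Ff) (Fm_V fusF sPS Ff) // ey' ey in E1.
rewrite mvC ef !mv1M in E1.
by have [||||-> ->] := uniqYE _ _ _ _ E1; rewrite ?groupM ?Yth.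
Qed.

End FromList.

(** Modulo p only the graphs of order |S| count, each contributing 1 to |Y|; the others contribute a
    proper index in a p-group. *)
Lemma characteristic_biset : exists (T : finType) (Y : {set T}) act c,
  stable_biset Y act c /\ coprime p #|Y|.
Proof.
have [Hs [FHs stHs cop]] := stable_list prp pS satF.
have [bis cY] := stable_biset_of_list FHs stHs.
do 4!eexists; split; first exact: bis.
rewrite cY (bigID (fun H : {group gT * gT} => #|H| == #|S|)) /=.
rewrite (eq_bigr (fun=> 1%N)) => [|H /eqP ->]; last by rewrite divnn cardG_gt0.
rewrite sum1_count addnC -coprime_modr -modnDml.
suff /eqP -> : p %| \sum_(H <- Hs | #|H| != #|S|) #|S| %/ #|H| by rewrite add0n coprime_modr.
rewrite big_seq_cond; apply: dvdn_sum => H /andP[/FHs[Q [f [sQS Ff ->]]]].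
rewrite (card_graph satF) // => ne; rewrite divgS //.
have pi : p.-nat #|S : Q| by apply: pnat_dvd (dvdn_indexg _ _) pS.
have [n e] := p_natP pi; rewrite e; case: n e => [|n] e; last by rewrite expnS dvdn_mulr.
by case/eqP: ne; rewrite -(Lagrange sQS) e muln1.
Qed.

End CharacteristicBiset.

(** * Additive maps *)

Section AdditiveMaps.
Variables (gT : finGroupType) (G : {group gT}) (A : zmodType) (a : gT -> A).

Definition additive_on := {in G &, forall x y, a (x * y) = a x + a y}%R.
Hypothesis aM : additive_on.

Lemma additive_on1 : a 1 = 0%R.
Proof. by apply: (addrI (a 1)); rewrite -aM ?group1 // mulg1 addr0. Qed.

Lemma additive_onV : {in G, forall x, a x^-1 = - a x}%R.
Proof.
by move=> x Gx; apply/eqP; rewrite -addr_eq0 -aM ?groupV // mulVg additive_on1.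
Qed.

Lemma additive_onX n : {in G, forall x, a (x ^+ n) = a x *+ n}%R.
Proof.
move=> x Gx; elim: n => [|n IHn]; first by rewrite expg0 additive_on1 mulr0n.
by rewrite expgS mulrS aM ?groupX // IHn.
Qed.

Lemma additive_onJ : {in G &, forall x y, a (x ^ y) = a x}%R.
Proof.
move=> x y Gx Gy; rewrite conjgE !aM ?groupM ?groupV // additive_onV // addrA.
by rewrite addrC addrA addrN add0r.
Qed.

Lemma additive_on_prod (I : Type) (s : seq I) (Q : pred I) (h : I -> gT) :
  (forall i, Q i -> h i \in G) -> a (\prod_(i <- s | Q i) h i) = (\sum_(i <- s | Q i) a (h i))%R.
Proof.
move=> hG; pose R x u := x \in G /\ a x = u.
suff [] : R (\prod_(i <- s | Q i) h i) (\sum_(i <- s | Q i) a (h i))%R by [].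
apply: (big_rec2 R) => [|i x y Qi [Gx <-]]; first by rewrite /R additive_on1.
by rewrite /R groupM ?hG // aM ?hG.
Qed.

Lemma additive_on_ker_group_set : group_set [set x in G | a x == 0%R].
Proof.
apply/group_setP; split=> [|x y]; first by rewrite inE group1 additive_on1 /=.
rewrite !inE => /andP[Gx /eqP ax] /andP[Gy /eqP ay].
by rewrite groupM // aM // ax ay addr0 /=.
Qed.

Lemma additive_on_der1 x : x \in G^`(1) -> a x = 0%R.
Proof.
move=> Gx; suff : G^`(1) \subset Group additive_on_ker_group_set.
  by move/subsetP/(_ x Gx); rewrite inE => /andP[_ /eqP].
rewrite gen_subG; apply/subsetP=> _ /imset2P[u v Gu Gv ->].
rewrite inE groupR //= commgEl aM ?groupJ ?groupV // additive_onV //.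
by rewrite additive_onJ // addNr.
Qed.

Lemma additive_on_Phi (p : nat) x : p.-group G -> {in G, forall y, a y *+ p = 0}%R ->
  x \in 'Phi(G) -> a x = 0%R.
Proof.
move=> pG pA; rewrite (Phi_joing pG) => Gx.
suff : G^`(1) <*> 'Mho^1(G) \subset Group additive_on_ker_group_set.
  by move/subsetP/(_ x Gx); rewrite inE => /andP[_ /eqP].
rewrite join_subG; apply/andP; split.
  apply/subsetP=> y Gy; rewrite inE (subsetP (der_sub 1 G)) //=.
  by rewrite additive_on_der1.
rewrite (MhoE _ pG) gen_subG; apply/subsetP=> _ /imsetP[z Gz ->].
by rewrite inE groupX //= additive_onX // expn1 pA.
Qed.

End AdditiveMaps.

Lemma mulrn_coprime_eq0 (A : zmodType) (v : A) m n : coprime m n ->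
  (v *+ m = 0 -> v *+ n = 0 -> v = 0)%R.
Proof.
case: m => [|m]; first by rewrite /coprime gcd0n => /eqP ->; rewrite mulr1n.
case/(coprimeP _ (ltn0Sn m))=> [[a b] /= e] vm vn.
by rewrite -[v]mulr1n -e mulrnBr ?[(a * _)%N]mulnC ?[(b * _)%N]mulnC ?mulrnA ?vm ?vn ?mul0rn ?subr0 //;
   apply: ltnW; rewrite -subn_gt0 mulnC [X in _ - X]mulnC e.
Qed.

(** The quotient is made additive so that transfers become finite sums. *)
Lemma abelian_quotient_map (gT : finGroupType) (G K : {group gT}) :
    K <| G -> abelian (G / K) ->
  exists (A : zmodType) (a : gT -> A),
    additive_on G a /\ {in G, forall x, (a x == 0%R) = (x \in K)}.
Proof.
move=> nKG abGK; have [sKG nGK] := andP nKG.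
exists (FiniteModule.fmod_of abGK), (fun x => FiniteModule.fmod abGK (coset K x)).
split=> [x y Gx Gy|x Gx].
  rewrite morphM ?(subsetP nGK) //; apply: FiniteModule.fmod_inj.
  by rewrite FiniteModule.fmvalA !FiniteModule.fmodK ?groupM ?mem_quotient.
have Q1 : FiniteModule.fmval (0%R : FiniteModule.fmod_of abGK) = 1 := FiniteModule.fmval0 _.
apply/eqP/idP=> [e|Kx].
  have := FiniteModule.congr_fmod e; rewrite FiniteModule.fmodK ?mem_quotient //.
  by move=> e1; apply: (coset_idr (subsetP nGK x Gx)); rewrite e1 Q1.
by apply: FiniteModule.fmod_inj; rewrite FiniteModule.fmodK ?mem_quotient // coset_id // Q1.
Qed.

(** * Transfer *)

Section Transfer.
Variables (gT : finGroupType) (S : {group gT}) (F : fsys gT).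
Implicit Types (P Q : {group gT}) (f : gT -> gT).
Variables (T : finType) (Y : {set T}) (act : gT -> T -> T) (c : gT -> T -> gT).
Hypothesis bis : stable_biset S F Y act c.

Lemma biset_act g y : g \in S -> y \in Y -> act g y \in Y.
Proof. by case: bis => + _ _ _ _ => /(_ g y) st Sg Yy; case: st. Qed.

Lemma biset_c g y : g \in S -> y \in Y -> c g y \in S.
Proof. by case: bis => + _ _ _ _ => /(_ g y) st Sg Yy; case: st. Qed.

Lemma biset_act1 y : y \in Y -> act 1 y = y.
Proof. by case: bis => _ + _ _ _; apply. Qed.

Lemma biset_actM g h y : g \in S -> h \in S -> y \in Y -> act (g * h) y = act g (act h y).
Proof. by case: bis => _ _ + _ _ => /(_ g h y) st Sg Sh Yy; case: st. Qed.

Lemma biset_cM g h y : g \in S -> h \in S -> y \in Y -> c (g * h) y = c g (act h y) * c h y.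
Proof. by case: bis => _ _ + _ _ => /(_ g h y) st Sg Sh Yy; case: st. Qed.

Lemma biset_act_inj g : g \in S -> {in Y &, injective (act g)}.
Proof.
move=> Sg y z Yy Yz e; rewrite -(biset_act1 Yy) -(biset_act1 Yz) -(mulVg g).
by rewrite !biset_actM ?groupV // e.
Qed.

Lemma biset_sum_act (A : zmodType) (u : T -> A) g : g \in S ->
  (\sum_(y in Y) u (act g y) = \sum_(y in Y) u y)%R.
Proof.
move=> Sg; rewrite -(big_imset u (biset_act_inj Sg)); apply: eq_bigl => y.
apply/imsetP/idP=> [[z Yz ->]|Yy]; first exact: biset_act.
exists (act g^-1 y); first by rewrite biset_act ?groupV.
by rewrite -biset_actM ?groupV // mulgV biset_act1.
Qed.

(** [z] picks one point in each S-orbit of Y and [t y] moves it to y. *)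
Lemma biset_orbit_reps : exists (z : T -> T) (t : T -> gT),
  (forall y, y \in Y -> [/\ z y \in Y, t y \in S & act (t y) (z y) = y]) /\
  (forall g y, g \in S -> y \in Y -> z (act g y) = z y).
Proof.
pose orb y := [set act g y | g in S].
have orbE g y : g \in S -> y \in Y -> orb (act g y) = orb y.
  move=> Sg Yy; apply/setP=> w; apply/imsetP/imsetP=> [[h Sh ->]|[h Sh ->]].
    by exists (h * g); rewrite ?groupM ?biset_actM.
  exists (h * g^-1); rewrite ?groupM ?groupV // -biset_actM ?groupM ?groupV //.
  by rewrite mulgKV.
pose z y := odflt y [pick w in orb y].
have zo y : y \in Y -> z y \in orb y.
  move=> Yy; rewrite /z; case: pickP => //= /(_ y) /negP[].
  by apply/imsetP; exists 1; rewrite ?biset_act1.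
exists z, (fun y => odflt 1 [pick g in S | act g (z y) == y]); split.
  move=> y Yy; have /imsetP[g Sg ez] := zo y Yy.
  have Yz : z y \in Y by rewrite ez biset_act.
  case: pickP => [h /andP[Sh /eqP e]|/(_ g^-1)] //=.
  by rewrite groupV Sg ez -biset_actM ?groupV // mulVg biset_act1 // eqxx.
move=> g y Sg Yy; rewrite /z orbE //; case: pickP => //= /(_ (z y)).
by rewrite zo.
Qed.

Section Coefficients.
Variables (E : {group gT}) (A : zmodType) (lam : gT -> A) (r : T -> gT).
Hypotheses (nES : E <| S) (lamM : additive_on E lam).
Hypothesis lamJ : forall x s, x \in E -> s \in S -> lam (x ^ s) = lam x.
Hypothesis rS : forall y, y \in Y -> r y \in S.

(** This is the cocycle c after moving the base point of each fibre from (y, 1) to (y, r y). *)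
Definition tcocycle g y := (r (act g y))^-1 * c g y * r y.

Hypothesis tE : forall g y, g \in S -> y \in Y -> tcocycle g y * g^-1 \in E.

Definition transfer_sum (g : gT) : A := (\sum_(y in Y) lam (tcocycle g y))%R.

Definition transfer_diff (g : gT) : A := (\sum_(y in Y) lam (tcocycle g y * g^-1))%R.

Let sES : E \subset S. Proof. exact: normal_sub. Qed.

Let EJ x s : x \in E -> s \in S -> x ^ s \in E.
Proof. by move=> Ex Ss; rewrite memJ_norm // (subsetP (normal_norm nES)). Qed.

Let tcE g y : g \in E -> y \in Y -> tcocycle g y \in E.
Proof.
move=> Eg Yy; rewrite -(groupMr _ (groupVr Eg)) tE //; exact: (subsetP sES).
Qed.

(** The elements e(g, y) g^-1 multiply as a crossed homomorphism, with a conjugation by g^-1 that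
    the S-invariant [lam] does not see; then the sum is reindexed by y |-> h y. *)
Lemma transfer_diffM : additive_on S transfer_diff.
Proof.
move=> g h Sg Sh; rewrite /transfer_diff.
rewrite (eq_bigr (fun y => lam (tcocycle g (act h y) * g^-1) + lam (tcocycle h y * h^-1)))%R.
  rewrite big_split /=; congr (_ + _)%R.
  by rewrite (biset_sum_act (fun y => lam (tcocycle g y * g^-1))).
move=> y Yy; have Yhy := biset_act Sh Yy.
have -> : tcocycle (g * h) y * (g * h)^-1 =
    tcocycle g (act h y) * g^-1 * (tcocycle h y * h^-1) ^ g^-1.
  by rewrite /tcocycle biset_actM // biset_cM // conjgE invMg invgK !mulgA !mulgKV mulgK.
by rewrite lamM ?tE ?lamJ ?EJ ?groupV // tE.
Qed.

Lemma transfer_sum_diff g : g \in E ->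
  (transfer_sum g = transfer_diff g + lam g *+ #|Y|)%R.
Proof.
move=> Eg; rewrite /transfer_diff -sumr_const -big_split; apply: eq_bigr => y Yy /=.
by rewrite -lamM ?mulgKV // tE // (subsetP sES).
Qed.

(* On <g>-orbits in Y the two trivializations differ by an element of S which
   is constant modulo E, so the difference of the two sums telescopes. *)
Lemma transfer_sum_stable P f g : P \subset S -> Fm S F P f -> g \in P ->
  g \in E -> f g \in E -> transfer_sum (f g) = transfer_sum g.
Proof.
move=> sPS Ff Pg Eg Efg; have Sg := subsetP sES g Eg; have Sfg := subsetP sES _ Efg.
have [th [s [thi thY the]]] : exists th : T -> T, exists s : T -> gT,
    [/\ {in Y &, injective th}, forall y, y \in Y -> th y \in Y /\ s y \in S
      & forall g y, g \in P -> y \in Y -> th (act g y) = act (f g) (th y) /\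
          c (f g) (th y) * s y = s (act g y) * c g y].
  by case: bis => _ _ _ _; apply.
have thim : th @: Y = Y.
  apply/eqP; rewrite eqEcard card_in_imset // leqnn andbT.
  by apply/subsetP=> _ /imsetP[y /thY[Yt _] ->].
have -> : (transfer_sum (f g) = \sum_(y in Y) lam (tcocycle (f g) (th y)))%R.
  by rewrite -(big_imset (fun y => lam (tcocycle (f g) y)) thi) thim.
(* [u y] compares the base point at y, carried along by the isomorphism, with the base point chosen
   at [th y]. *)
pose u y := (r y)^-1 * (s y)^-1 * r (th y).
have uS y : y \in Y -> u y \in S.
  by move=> Yy; have [Yt Ss] := thY y Yy; rewrite !groupM ?groupV ?rS.
have eu y : y \in Y -> tcocycle (f g) (th y) = (u (act g y))^-1 * u y * tcocycle g y ^ u y.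
  move=> Yy; have [e1 e2] := the g y Pg Yy.
  rewrite [_ ^ u y]conjgE !mulgA mulgK /tcocycle /u -e1.
  have -> : c (f g) (th y) = s (act g y) * c g y * (s y)^-1 by rewrite -e2 mulgK.
  by rewrite !invMg !invgK !mulgA !mulgK !mulgKV mulgK.
have uE y : y \in Y -> (u (act g y))^-1 * u y \in E.
  move=> Yy; have [Yt _] := thY y Yy.
  have := tcE Efg Yt; rewrite eu // groupMr //.
  by apply: EJ (uS y Yy); apply: tcE.
(* [u y] itself need not lie in E, where [lam] is additive. Dividing by a representative of its
   coset, constant along the orbits of g, gives [k y] in E with the same quotients. *)
pose w y := repr (u y *: E); pose k y := (w y)^-1 * u y.
have wk y : y \in Y -> k y \in E.
  move=> Yy; have : w y \in u y *: E by apply: mem_repr (lcoset_refl _ _).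
  by rewrite mem_lcoset => h; rewrite -groupV invMg invgK.
have weq y : y \in Y -> w (act g y) = w y.
  move=> Yy; rewrite /w; congr (repr _); apply/lcoset_eqP.
  by rewrite lcoset_sym mem_lcoset uE.
have kE y : y \in Y -> (u (act g y))^-1 * u y = (k (act g y))^-1 * k y.
  by move=> Yy; rewrite /k weq // [RHS]mulgA (invMg (w y)^-1) invgK !mulgA mulgK.
rewrite (eq_bigr (fun y => (lam (k y) - lam (k (act g y))) + lam (tcocycle g y)))%R.
  rewrite big_split /= sumrB (biset_sum_act (fun y => lam (k y)) Sg).
  by rewrite subrr add0r.
move=> y Yy; have Ygy := biset_act Sg Yy.
rewrite eu // lamM ?uE ?EJ ?uS ?tcE // lamJ ?uS ?tcE //.
by rewrite kE // lamM ?groupV ?wk // (additive_onV lamM) ?wk // addrC addrC [(- _ + _)%R]addrC.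
Qed.

End Coefficients.

End Transfer.

(** * Fusion on classes of order p *)

Lemma transfer_shuffle (A : zmodType) (a1 a2 a3 b1 b2 b3 : A) :
  ((a1 + a2 - a3) - (b1 + b2 - b3) = (a2 - b2) + ((a1 - b1) - (a3 - b3)))%R.
Proof. by rewrite !opprD !opprK !addrA [LHS](ACl (2*5*1*4*3*6))%R. Qed.

Section Tate.
Variables (gT : finGroupType) (p : nat) (S : {group gT}) (F : fsys gT).
Implicit Types (P Q E K : {group gT}) (f : gT -> gT).
Hypotheses (prp : prime p) (pS : p.-group S) (satF : saturated p S F).
Let fusF : fusion_system S F := satF.1.
Local Notation Fm := (Fm S F).

(* The transfer V : S -> S / S' is F-invariant. On classes of order p in S / S'
   it is multiplication by #|Y|: there each contribution of an S-orbit S / P of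
   Y is a class of order p in P / P', on which F acts as the inclusion does. *)
Lemma focal_der1 :
    (forall P f g, P \subset S -> Fm P f -> g \in P -> g ^+ p \in P^`(1) ->
       f g * g^-1 \in S^`(1)) ->
  forall P f g, P \subset S -> Fm P f -> g \in P -> f g * g^-1 \in S^`(1).
Proof.
move=> H2 P0 f0 g0 sP0S Ff0 P0g0.
have [T [Y [act [c [bis cop]]]]] := characteristic_biset prp pS satF.
have [A [lam [lamM lam0]]] := abelian_quotient_map (der_normal 1 S) (der_abelian 0 S).
have lamJ := additive_onJ lamM.
have r1 y : y \in Y -> (fun _ : T => 1 : gT) y \in S by rewrite group1.
have tc g y : tcocycle act c (fun=> 1) g y = c g y by rewrite /tcocycle invg1 mul1g mulg1.
have tE g y : g \in S -> y \in Y -> tcocycle act c (fun=> 1) g y * g^-1 \in S.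
  by move=> Sg Yy; rewrite tc groupM ?groupV ?(biset_c bis).
pose V := transfer_sum Y act c lam (fun=> 1).
pose W := transfer_diff Y act c lam (fun=> 1).
have VW g : g \in S -> (V g = W g + lam g *+ #|Y|)%R.
  by move=> Sg; apply: (transfer_sum_diff (normal_refl S) lamM tE).
have WM : additive_on S W by apply: (transfer_diffM bis (normal_refl S) lamM _ tE).
have VM : additive_on S V.
  by move=> x y Sx Sy; rewrite !VW ?groupM // WM // lamM // mulrnDl addrACA.
have Vst P f g : P \subset S -> Fm P f -> g \in P -> V (f g) = V g.
  move=> sPS Ff Pg.
  apply: (transfer_sum_stable bis (normal_refl S) lamM _ r1 tE sPS Ff Pg) => //.
    exact: (subsetP sPS).
  exact: (Fm_in fusF sPS Ff).
(* [W b] is the transfer of b minus |Y| times its class, so its vanishing is the claim that V is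
   multiplication by |Y| on such b. *)
have W0 b : b \in S -> b ^+ p \in S^`(1) -> W b = 0%R.
  move=> Sb Sbp; have [z [t [ztP zg]]] := biset_orbit_reps bis.
  pose d g y := (t (act g y))^-1 * g * t y.
  have dM g h y : g \in S -> h \in S -> y \in Y -> d (g * h) y = d g (act h y) * d h y.
    by move=> Sg Sh Yy; rewrite /d (biset_actM bis) // !mulgA mulgK.
  have dS g y : g \in S -> y \in Y -> d g y \in S.
    move=> Sg Yy; have [_ Sty _] := ztP y Yy; have [_ Stgy _] := ztP _ (biset_act bis Sg Yy).
    by rewrite !groupM ?groupV.
  have dz g y : g \in S -> y \in Y -> act (d g y) (z y) = z y.
    move=> Sg Yy; have [Yz Sty ey] := ztP y Yy.
    have Yg := biset_act bis Sg Yy; have [_ Stgy egy] := ztP _ Yg.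
    rewrite zg // in egy; rewrite /d !(biset_actM bis) ?groupM ?groupV // ?ey //.
    by rewrite -{2}egy -(biset_actM bis) ?groupV // mulVg (biset_act1 bis).
  pose mu zz x := (lam (c x zz) - lam x)%R.
  transitivity (\sum_(y in Y) mu (z y) (d b y))%R.
    (* Since b t(y) = t(by) d(b, y), the summands lam(c(b, y)) - lam(b) and [mu (z y) (d b y)]
       differ by [u (act b y) - u y], whose sum over Y is zero. *)
    pose u y := (lam (c (t y) (z y)) - lam (t y))%R.
    have -> : (\sum_(y in Y) mu (z y) (d b y) = \sum_(y in Y) mu (z y) (d b y) +
        (\sum_(y in Y) u (act b y) - \sum_(y in Y) u y))%R.
      by rewrite (biset_sum_act bis u Sb) subrr addr0.
    rewrite -sumrB -big_split; apply: eq_bigr => y Yy /=.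
    have [Yz Sty ey] := ztP y Yy.
    have Yg := biset_act bis Sb Yy; have [_ Stgy egy] := ztP _ Yg.
    have Sd := dS b y Sb Yy; rewrite tc.
    have eb : b * t y = t (act b y) * d b y by rewrite /d !mulgA mulgV mul1g.
    have ec : c b y * c (t y) (z y) = c (t (act b y)) (z y) * c (d b y) (z y).
      by rewrite -{1}ey -(biset_cM bis Sb Sty Yz) eb (biset_cM bis Stgy Sd Yz) dz.
    have := congr1 lam ec; rewrite !lamM ?groupV ?(biset_c bis) // => /(canRL (addrK _)) e1.
    have : (lam b + lam (t y) = lam (t (act b y)) + lam (d b y))%R.
      by rewrite -(lamM _ _ Sb Sty) eb; apply: lamM.
    move/(canRL (addrK _)) => e2.
    rewrite (additive_onV lamM) // e1 e2 /mu /u zg //.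
    exact: transfer_shuffle.
  have dv zz : (\sum_(y in Y | z y == zz) mu zz (d b y) = 0)%R.
    case: (boolP (zz \in Y)) => [Yzz|nYz]; last first.
      rewrite big1 // => y /andP[Yy /eqP ez]; have [Yz _ _] := ztP y Yy.
      by rewrite -ez Yz in nYz.
    have gP : group_set [set g in S | act g zz == zz].
      apply/group_setP; split=> [|g h]; first by rewrite inE group1 (biset_act1 bis) /=.
      rewrite !inE => /andP[Sg /eqP eg] /andP[Sh /eqP eh].
      by rewrite groupM //= (biset_actM bis) // eh eg.
    pose P := Group gP.
    have sPS : P \subset S by apply/subsetP=> g; rewrite inE => /andP[].
    have Pd g y : g \in S -> y \in Y -> z y = zz -> d g y \in P.
      by move=> Sg Yy ez; rewrite inE dS //= -ez dz.
    have Feta : Fm P (c^~ zz).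
      case: bis => _ _ _ st _; apply: st => // g; by rewrite inE => /andP[_ /eqP].
    have muM : additive_on P (mu zz).
      move=> x y Px Py; have Sx := subsetP sPS x Px; have Sy := subsetP sPS y Py.
      have := Fm_M fusF sPS Feta Px Py => /= e; rewrite /mu e.
      rewrite !lamM ?(biset_c bis) //; by rewrite opprD addrACA.
    have [B [pi [piM pi0]]] := abelian_quotient_map (der_normal 1 P) (der_abelian 0 P).
    (* [U] is the transfer S -> P/P' for the stabilizer P of the orbit representative. It is a
       homomorphism, so b^p in S' forces the product [x] to satisfy x^p in P'; the hypothesis then
       applies to the morphism [c^~ zz] at [x]. *)
    pose U g := (\sum_(y in Y | z y == zz) pi (d g y))%R.
    have UM : additive_on S U.
      move=> g h Sg Sh; rewrite /U.
      rewrite (eq_bigr (fun y => pi (d g (act h y)) + pi (d h y))%R) => [|y /andP[Yy /eqP ez]].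
        rewrite big_split /=; congr (_ + _)%R; rewrite !big_mkcondr.
        rewrite -[RHS](biset_sum_act bis _ Sh); apply: eq_bigr => y Yy /=.
        by rewrite zg.
      rewrite dM // piM ?Pd //; first exact: (biset_act bis).
      by rewrite zg.
    pose x := \prod_(y in Y | z y == zz) d b y.
    have Pdb y : (y \in Y) && (z y == zz) -> d b y \in P by move=> /andP[Yy /eqP]; apply: Pd.
    have Px : x \in P by apply: group_prod.
    have xp : x ^+ p \in P^`(1).
      rewrite -pi0 ?groupX // (additive_onX piM) //.
      rewrite /x (additive_on_prod piM) // -/(U b) -(additive_onX UM) //.
      by rewrite (additive_on_der1 UM).
    rewrite -(additive_on_prod muM) // -/x; apply/eqP.
    have Sx := subsetP sPS x Px; have Sc := biset_c bis Sx Yzz.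
    have Sx' : x^-1 \in S by rewrite groupV.
    have : c x zz * x^-1 \in S^`(1) := H2 P (c^~ zz) x sPS Feta Px xp.
    by rewrite -(lam0 _ (groupM Sc Sx')) (lamM _ _ Sc Sx') (additive_onV lamM).
  rewrite (partition_big z (mem Y)) => [|y Yy]; last by have [] := ztP y Yy.
  rewrite big1 // => zz _; rewrite -[RHS](dv zz); apply: eq_bigr => y /andP[_ /eqP ->].
  by [].
(* The kernel of V lies in S': by induction b^p is in S', so W b = 0 and the class of b is killed
   both by |Y| and by p. *)
have key n b : b \in S -> V b = 0%R -> b ^+ (p ^ n) \in S^`(1) -> b \in S^`(1).
  elim: n b => [|n IHn] b Sb Vb; first by rewrite expn0 expg1.
  rewrite expnS expgM => bn.
  have {}bn : b ^+ p \in S^`(1).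
    by apply: IHn bn; rewrite ?groupX // (additive_onX VM) // Vb mul0rn.
  rewrite -lam0 //; apply/eqP; apply: (mulrn_coprime_eq0 cop).
    by rewrite -(additive_onX lamM) //; apply/eqP; rewrite (lam0 _ (groupX p Sb)).
  by have := VW b Sb; rewrite Vb W0 // add0r.
have Sg0 := subsetP sP0S g0 P0g0; have Sfg := Fm_in fusF sP0S Ff0 P0g0.
have Sw : f0 g0 * g0^-1 \in S by rewrite groupM ?groupV.
have [n en] := p_natP (mem_p_elt pS Sw).
apply: (key n) => //; last by rewrite -en expg_order group1.
by rewrite VM ?groupV // (additive_onV VM) // (Vst P0) // subrr.
Qed.

End Tate.

(** * Fusion modulo a normal subgroup *)

Section TateNilpotency.
Variables (gT : finGroupType) (p : nat) (S : {group gT}) (F : fsys gT).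
Implicit Types (P Q E K : {group gT}) (f : gT -> gT).
Hypotheses (prp : prime p) (pS : p.-group S) (satF : saturated p S F).
Let fusF : fusion_system S F := satF.1.
Local Notation Fm := (Fm S F).

Lemma cosetMS K x y : K <| S -> x \in S -> y \in S ->
  coset K (x * y) = coset K x * coset K y.
Proof. by move=> /normal_norm/subsetP NK Sx Sy; rewrite morphM ?NK. Qed.

Lemma cosetVS K x : K <| S -> x \in S -> coset K x^-1 = (coset K x)^-1.
Proof. by move=> /normal_norm/subsetP NK Sx; rewrite morphV ?NK. Qed.

Lemma cosetJS K x y : K <| S -> x \in S -> y \in S ->
  coset K (x ^ y) = coset K x ^ coset K y.
Proof. by move=> /normal_norm/subsetP NK Sx Sy; rewrite morphJ ?NK. Qed.

Lemma coset_div_in K x y : K <| S -> x \in S -> y \in S ->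
  (x * y^-1 \in K) = (coset K x == coset K y).
Proof.
move=> nKS Sx Sy; have NK := subsetP (normal_norm nKS).
rewrite [RHS]eq_mulgV1 -cosetVS // -cosetMS ?groupV //.
apply/idP/eqP=> [/coset_id//|]; apply: coset_idr.
by rewrite NK ?groupM ?groupV.
Qed.

(** For E = S this holds trivially; for E = 1 it says that every morphism is conjugation by an
    element of S. *)
Definition trivial_mod E := forall P f, P \subset S -> Fm P f ->
  exists2 s, s \in S & {in P, forall x, coset E (f x) = coset E x ^ coset E s}.

(* An automorphism of p'-order of Q which is S-conjugation modulo E fixes Q / E
   pointwise, as conjugation has p-power order; then it acts on Q by
   x |-> e x with e in E fixed modulo K, so e^n = 1 modulo K with n prime to p. *)
Lemma AF_p'_elt_fixes_mod E K Q (s : {perm gT}) : E <| S -> K <| S -> trivial_mod E ->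
    (forall P f g, P \subset S -> Fm P f -> g \in P -> g \in E -> f g * g^-1 \in K) ->
    Q \subset S -> s \in AF S F Q -> p^'.-elt s ->
  {in Q, forall x, coset K (s x) = coset K x}.
Proof.
move=> nES nKS triv focE sQS As p's x Qx.
have NE := subsetP (normal_norm nES); have NK := subsetP (normal_norm nKS).
have Fs := AF_Fm satF sQS As; have [t St et] := triv Q s sQS Fs.
have sX n : (s ^+ n) x \in Q by rewrite (AF_in satF) // groupX.
have SQ y : y \in Q -> y \in S by apply: (subsetP sQS).
have cop m : p.-nat m -> coprime m #[s] by move=> pm; apply: pnat_coprime pm p's.
have fixE : coset E (s x) = coset E x.
  have iter n : coset E ((s ^+ n) x) = coset E x ^ (coset E t ^+ n).
    elim: n => [|n IHn]; first by rewrite !expg0 perm1 conjg1.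
    by rewrite expgSr permM et // IHn -conjgM -expgSr.
  have := iter #[s]; rewrite expg_order perm1 => e; rewrite et //.
  set u := coset E t in e *; suff cu : u \in 'C[coset E x].
    by rewrite conjgE -(cent1P cu) mulKg.
  have pu : p.-nat #[u] by apply: morph_p_elt (NE t St) _; apply: mem_p_elt pS St.
  have cm : u ^+ #[s] \in 'C[coset E x].
    have cXu : commute (coset E x) (u ^+ #[s]) by rewrite /commute conjgC -e.
    by apply/cent1P; first [exact: cXu | exact: commute_sym].
  (* [u] has p-power order and [s] has order prime to p, so [u] is a power of [u ^+ #[s]], which
     centralizes the class of x. *)
  have : u \in <[u ^+ #[s]]>.
    have /eqP <- : generator <[u]> (u ^+ #[s]) by rewrite generator_coprime cop.
    exact: cycle_id.
  by case/cycleP=> k ->; rewrite groupX.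
pose g := s x * x^-1.
have Qg : g \in Q by rewrite groupM ?groupV // (AF_in satF).
have Eg : g \in E.
  by rewrite coset_div_in ?fixE // SQ // (AF_in satF).
have sg u : u \in AF S F Q -> coset K (u g) = coset K g.
  move=> Au; have Kug := focE Q u g sQS (AF_Fm satF sQS Au) Qg Eg.
  have Qug : u g \in Q by rewrite (AF_in satF).
  by apply/eqP; rewrite -coset_div_in // SQ.
have iter n : coset K ((s ^+ n) x) = coset K g ^+ n * coset K x.
  elim: n => [|n IHn]; first by rewrite !expg0 perm1 mul1g.
  have Asn : s ^+ n \in AF S F Q by apply: groupX.
  have esx : s x = g * x by rewrite /g mulgKV.
  have Sg : (s ^+ n) g \in S by rewrite SQ ?(AF_in satF).
  rewrite expgS permM esx (Fm_M fusF sQS (AF_Fm satF sQS Asn)) //.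
  by rewrite (cosetMS nKS Sg) ?SQ // IHn sg // expgS mulgA.
have := iter #[s]; rewrite expg_order perm1 => /(canLR (mulgK _)); rewrite mulgV => e1.
have pg : p.-nat #[coset K g].
  by apply: morph_p_elt; rewrite ?NK ?SQ //; apply: mem_p_elt pS _; apply: SQ.
have g1 : coset K g = 1.
  apply/eqP; rewrite -order_eq1 -dvdn1 -(eqnP (cop _ pg)) dvdn_gcd dvdnn /=.
  by rewrite order_dvdn -e1.
have -> : s x = g * x by rewrite /g mulgKV.
by rewrite (cosetMS nKS (SQ g Qg)) ?SQ // g1 mul1g.
Qed.

Definition AFmod K Q := [set s in AF S F Q | [forall x in Q, coset K (s x) == coset K x]].

(** The automorphisms of Q trivial modulo K contain all those of order prime to p, so they form a
    normal subgroup N with Aut_F(Q)/N a p-group. As Aut_S(Q) is Sylow, Aut_F(Q) = Aut_S(Q) N. *)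
Lemma AF_mod K Q (s : {perm gT}) : K <| S ->
    (forall P f g, P \subset S -> Fm P f -> g \in P -> g \in K -> f g * g^-1 \in K) ->
    (forall s, s \in AF S F Q -> p^'.-elt s -> {in Q, forall x, coset K (s x) = coset K x}) ->
    Q \subset S -> fully_normalized S F Q -> s \in AF S F Q ->
  exists2 t, t \in S & {in Q, forall x, coset K (s x) = coset K x ^ coset K t}.
Proof.
move=> nKS focK p'K sQS fnQ As.
have NK := subsetP (normal_norm nKS).
have SQ y : y \in Q -> y \in S by apply: (subsetP sQS).
have AFfix u x : u \in AFmod K Q -> x \in Q -> coset K (u x) = coset K x.
  by rewrite inE => /andP[_ /forall_inP h] /h/eqP.
have gN : group_set (AFmod K Q).
  apply/group_setP; split=> [|u v Nu Nv].
    by rewrite inE group1; apply/forall_inP=> x _; rewrite perm1.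
  have [/setIdP[Au _] /setIdP[Av _]] := (Nu, Nv).
  rewrite inE groupM //; apply/forall_inP=> x Qx.
  by rewrite permM !AFfix ?(AF_in satF).
pose N := Group gN.
have sNA : N \subset AF S F Q by apply/subsetP=> u /setIdP[].
(* Normality needs automorphisms of Q to preserve the intersection of Q and K, which [focK]
   provides. *)
have nNA : AF S F Q \subset 'N(N).
  apply/subsetP=> u Au; rewrite inE; apply/subsetP=> _ /imsetP[v Nv ->].
  have Av := subsetP sNA v Nv.
  rewrite inE groupJ //; apply/forall_inP=> x Qx; rewrite conjgE !permM.
  set y := u^-1 x; have Qy : y \in Q by rewrite (AF_in satF) // groupV.
  have ex : u y = x by rewrite /y permKV.
  have Qvy : v y \in Q by rewrite (AF_in satF).
  set k := v y * y^-1; have Qk : k \in Q by rewrite groupM ?groupV.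
  have Kk : k \in K.
    by rewrite coset_div_in ?SQ // AFfix.
  have Fu := AF_Fm satF sQS Au.
  have Kuk : u k \in K by rewrite -(groupMr _ (groupVr Kk)); apply: (focK Q).
  have -> : v y = k * y by rewrite /k mulgKV.
  rewrite (Fm_M fusF sQS Fu) // ex.
  have Quk : u k \in Q by rewrite (AF_in satF).
  by rewrite (cosetMS nKS (SQ _ Quk)) ?SQ // (coset_id Kuk) mul1g.
have pAN : p.-group (AF S F Q / N).
  apply/pgroupP=> q prq /(Cauchy prq)[ux /morphimP[u nNu Au ->] ou].
  apply: contraT => p'q.
  have : coset N u.`_p^' = 1.
    apply: coset_id; rewrite inE groupX //; apply/forall_inP=> x Qx.
    by apply/eqP/p'K; rewrite ?groupX ?p_elt_constt.
  rewrite morph_constt // => u1.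
  have : p.-elt (coset N u) by rewrite -p_eltNK; apply/constt1P.
  by rewrite /p_elt ou pnatE // (negbTE p'q).
have /and3P[sSA pAS iAS] := AS_Sylow satF sQS fnQ.
have nNS : AS S Q \subset 'N(N) := subset_trans sSA nNA.
have defA : AS S Q <*> N = AF S F Q.
  apply/eqP; rewrite eqEsubset join_subG sSA sNA /= -indexg_eq1.
  apply/eqP; apply: (@pnat_1 p).
    apply: pnat_dvd pAN; rewrite card_quotient //; apply: indexgS; exact: joing_subr.
  apply: pnat_dvd iAS; apply: indexgS; exact: joing_subl.
move: As; rewrite -defA norm_joinEl // => /mulsgP[a n ASa Nn ->].
have /(mem_AS _ sQS)[_ [t /setIP[St nt] et]] := ASa.
exists t => // x Qx; have Aa := subsetP sSA a ASa.
by rewrite permM AFfix ?(AF_in satF) // et // morphJ ?(NK _ St) ?(NK _ (SQ x Qx)).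
Qed.

End TateNilpotency.

(** * Tate's nilpotency criterion *)

Section TateTheorem.
Variables (gT : finGroupType) (p : nat) (S : {group gT}) (F : fsys gT).
Implicit Types (P Q E K : {group gT}) (f : gT -> gT).
Hypotheses (prp : prime p) (pS : p.-group S) (satF : saturated p S F).
Let fusF : fusion_system S F := satF.1.
Local Notation Fm := (Fm S F).

(** Being an S-conjugation modulo K passes through restriction, composition and inversion, so
    Alperin's theorem leaves only automorphisms of fully normalized subgroups. *)
Lemma trivial_mod_step E K : E <| S -> K <| S -> K \subset E -> trivial_mod S F E ->
    (forall P f g, P \subset S -> Fm P f -> g \in P -> g \in E -> f g * g^-1 \in K) ->
  trivial_mod S F K.
Proof.
move=> nES nKS sKE triv focE.
have NK := subsetP (normal_norm nKS).
apply: (alperin_ind pS satF) => [P f g efg|P Q f sQP sPS Ff|P f g sPS Ff Fg|P f g sPS Ff Fg fK|Q s sQS _ fnQ As].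
- by case=> s Ss es; exists s => // x Px; rewrite -efg // es.
- by case=> s Ss es; exists s => // x Qx; rewrite es // (subsetP sQP).
- case=> s Ss es [t St et]; exists (s * t); first exact: groupM.
  by move=> x Px; rewrite /= et ?mem_homimg // es // (cosetMS nKS) // conjgM.
- case=> s Ss es; exists s^-1; rewrite ?groupV // => y; rewrite (homimgE fusF) //.
  by case/imsetP=> x Px ->; rewrite fK // es // (cosetVS nKS Ss) conjgK.
apply: (AF_mod satF nKS) => //.
  by move=> P f g sPS Ff Pg Kg; apply: (focE P) => //; apply: (subsetP sKE).
by move=> u Au p'u; apply: (AF_p'_elt_fixes_mod pS satF nES nKS triv focE).
Qed.

(* Given trivial_mod E, twist the cocycle c of the biset so that e(g, y) = g
   modulo E. Then g |-> \sum_y lam (e(g, y) g^-1) is a homomorphism on S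
   extending (F-invariant transfer of lam) - #|Y| lam on E; being F-invariant
   by hypothesis, it shows that lam itself is F-invariant. *)
Lemma tate_step E K : E <| S -> K <| S -> K \subset E -> [~: E, S] \subset K ->
    (forall x, x \in E -> x ^+ p \in K) -> trivial_mod S F E ->
    (forall P f g, P \subset S -> Fm P f -> g \in P -> f g * g^-1 \in 'Phi(S)) ->
  forall P f g, P \subset S -> Fm P f -> g \in P -> g \in E -> f g * g^-1 \in K.
Proof.
move=> nES nKS sKE cEK expK triv focPhi P f g sPS Ff Pg Eg.
have [sES nE] := andP nES; have NE := subsetP nE.
have [T [Y [act [c [bis cop]]]]] := characteristic_biset prp pS satF.
have nKE : K <| E by apply: normalS nKS.
have abEK : abelian (E / K).
  rewrite sub_der1_abelian //; apply: subset_trans cEK.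
  exact: commgS.
have [A [lam [lamM lam0]]] := abelian_quotient_map nKE abEK.
have lamJ x s : x \in E -> s \in S -> lam (x ^ s) = lam x.
  move=> Ex Ss; have Kc : [~ x, s] \in K by apply: (subsetP cEK); apply: mem_commg.
  have Ec : [~ x, s] \in E := subsetP sKE _ Kc.
  rewrite -[x ^ s](mulKVg x) -commgEl lamM // addrC.
  by have := lam0 _ Ec; rewrite Kc => /eqP ->; rewrite add0r.
have plam x : x \in E -> (lam x *+ p = 0)%R.
  move=> Ex; rewrite -(additive_onX lamM) //; apply/eqP.
  by rewrite (lam0 _ (groupX p Ex)) expK.
have [z [t [ztP zg]]] := biset_orbit_reps bis.
(* On the stabilizer of zz the map [c^~ zz] is a morphism, hence conjugation by some s(zz) modulo
   E. *)
have [s sP] : exists s : T -> gT, forall zz, zz \in Y -> s zz \in S /\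
    forall h, h \in S -> act h zz = zz -> coset E (c h zz) = coset E h ^ coset E (s zz).
  apply: (@fin_all_exists T (fun=> gT) (fun zz u => zz \in Y -> u \in S /\
    forall h, h \in S -> act h zz = zz -> coset E (c h zz) = coset E h ^ coset E u)) => zz.
  case: (boolP (zz \in Y)) => [Yz|]; last by exists 1.
  have gP : group_set [set g in S | act g zz == zz].
    apply/group_setP; split=> [|h k]; first by rewrite inE group1 (biset_act1 bis) /=.
    rewrite !inE => /andP[Sh /eqP eh] /andP[Sk /eqP ek].
    by rewrite groupM //= (biset_actM bis) // ek eh.
  have sRS : Group gP \subset S by apply/subsetP=> h; rewrite inE => /andP[].
  have Feta : Fm (Group gP) (c^~ zz).
    case: bis => _ _ _ st _; apply: st => // h; by rewrite inE => /andP[_ /eqP].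
  have [s Ss es] := triv _ _ sRS Feta; exists s => _; split=> // h Sh eh.
  by apply: es; rewrite inE Sh eh eqxx.
(* With this base point e(h, y) becomes t(hy) s c(d) s^-1 t(y)^-1, where d = t(hy)^-1 h t(y)
   stabilizes z(y). Modulo E, s c(d) s^-1 is d, which leaves h. *)
pose r y := c (t y) (z y) * (s (z y))^-1 * (t y)^-1.
have rS y : y \in Y -> r y \in S.
  move=> Yy; have [Yz St _] := ztP y Yy; have [Ss _] := sP _ Yz.
  by rewrite !groupM ?groupV // (biset_c bis).
have tE h y : h \in S -> y \in Y -> tcocycle act c r h y * h^-1 \in E.
  move=> Sh Yy; have [Yz St ey] := ztP y Yy; have [Ss ecs] := sP _ Yz.
  have Yhy := biset_act bis Sh Yy; have [_ St' ey'] := ztP _ Yhy.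
  pose d := (t (act h y))^-1 * h * t y.
  have Sd : d \in S by rewrite !groupM ?groupV.
  have zh := zg h y Sh Yy; rewrite zh in ey'.
  have dz : act d (z y) = z y.
    rewrite /d !(biset_actM bis) ?groupM ?groupV // ?ey //.
    by rewrite -{2}ey' -(biset_actM bis) ?groupV // mulVg (biset_act1 bis).
  have Sc1 := biset_c bis St Yz; have Sc2 := biset_c bis St' Yz; have Scd := biset_c bis Sd Yz.
  have Sch := biset_c bis Sh Yy.
  have et : h * t y = t (act h y) * d by rewrite /d !mulgA mulgV mul1g.
  have ec : c h y * c (t y) (z y) = c (t (act h y)) (z y) * c d (z y).
    by rewrite -{1}ey -(biset_cM bis Sh St Yz) et (biset_cM bis St' Sd Yz) dz.
  have -> : tcocycle act c r h y =
      t (act h y) * s (z y) * c d (z y) * (s (z y))^-1 * (t y)^-1.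
    rewrite /tcocycle /r zh !invMg !invgK.
    have -> : c h y = c (t (act h y)) (z y) * c d (z y) * (c (t y) (z y))^-1.
      by rewrite -ec mulgK.
    by rewrite !mulgA !mulgKV.
  have Stt : t (act h y) * s (z y) * c d (z y) * (s (z y))^-1 * (t y)^-1 \in S.
    by rewrite !groupM ?groupV.
  rewrite (coset_div_in nES) //.
  have eh : coset E h = coset E (t (act h y)) * coset E d * (coset E (t y))^-1.
    rewrite -(cosetVS nES St) -!(cosetMS nES) ?groupM ?groupV //.
    by rewrite -et mulgK.
  rewrite eh !(cosetMS nES) ?(cosetVS nES) ?groupM ?groupV // ecs // conjgE.
  by rewrite !mulgA !mulgK mulgV mul1g -eh.
pose V := transfer_sum Y act c lam r; pose W := transfer_diff Y act c lam r.
have WM : additive_on S W := transfer_diffM bis nES lamM lamJ tE.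
have Sg := subsetP sES g Eg; have Sfg := Fm_in fusF sPS Ff Pg.
have Efg : f g \in E.
  have [u Su eu] := triv P f sPS Ff.
  apply: coset_idr; first exact: NE.
  by rewrite eu // (coset_id Eg) conj1g.
have Vst : V (f g) = V g by apply: (transfer_sum_stable bis nES lamM lamJ rS tE sPS Ff).
have VW x : x \in E -> (V x = W x + lam x *+ #|Y|)%R := transfer_sum_diff nES lamM tE (g := x).
have Wp : {in S, forall x, W x *+ p = 0}%R.
  move=> x Sx; rewrite /W /transfer_diff -sumrMnl big1 // => y Yy.
  by rewrite plam // tE.
have Wst : W (f g) = W g.
  apply/eqP; rewrite -subr_eq0 -(additive_onV WM) // -WM ?groupV //.
  by apply/eqP; apply: (additive_on_Phi WM pS Wp); apply: (focPhi P).
(* V and W agree on f(g) and g, so |Y| (lam(f g) - lam(g)) = 0; p also kills this difference. *)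
have lam_eq : (lam (f g) - lam g = 0)%R.
  apply: (mulrn_coprime_eq0 cop); first by rewrite mulrnBl !plam // subrr.
  rewrite mulrnBl; have := VW _ Efg; rewrite Vst (VW _ Eg) Wst => /addrI ->.
  exact: subrr.
have Eg' : g^-1 \in E by rewrite groupV.
by rewrite -(lam0 _ (groupM Efg Eg')) lamM // (additive_onV lamM) // lam_eq.
Qed.

(* The induction goes down along normal subgroups E of S with trivial_mod E,
   starting from E = S. *)
Theorem tate_nilpotent :
    (forall P f g, P \subset S -> Fm P f -> g \in P -> f g * g^-1 \in 'Phi(S)) ->
  nilpotent_fs S F.
Proof.
move=> focPhi.
suff triv1 : trivial_mod S F 1%G.
  move=> P Q sPS sQS; apply/setP=> f; apply/idP/imsetP=> [Ff|[g /setIdP[Sg sgQ] ->]].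
    have := Ff; rewrite (in_fsys fusF) // => /and3P[FfP /forall_inP fQ /forallP f1].
    have [s Ss es] := triv1 P f sPS FfP; have {}es x : x \in P -> f x = x ^ s.
      move=> Px; have Px1 := es x Px.
      have Sx := subsetP sPS x Px; have Sfx := Fm_in fusF sPS FfP Px.
      have : f x * (x ^ s)^-1 \in 1%G.
        rewrite (coset_div_in (normal1 S)) ?groupJ //.
        by rewrite (cosetJS (normal1 S)) // Px1.
      by rewrite inE -eq_mulgV1 => /eqP.
    exists s^-1.
      rewrite inE groupV Ss /=; apply/subsetP=> _ /imsetP[x Px ->].
      by rewrite invgK -mulgA -conjgE -es // fQ.
    apply/ffunP=> x; rewrite ffunE; case: ifP => [Px|/negbT nPx].
      by rewrite invgK -mulgA -conjgE es.
    by have /implyP/(_ nPx)/eqP := f1 x.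
  have [/subsetP sub _ _ _] := fusF sPS sQS sQS.
  by apply: sub; apply/imsetP; exists g; rewrite // inE Sg.
suff main n E : E <| S -> #|E| < n -> trivial_mod S F E -> trivial_mod S F 1%G.
  apply: (main #|S|.+1 S) => // P f sPS Ff; exists 1 => // x Px.
  have Sx := subsetP sPS x Px; have Sfx := Fm_in fusF sPS Ff Px.
  by rewrite !coset_id // ?group1 // conj1g.
elim: n E => // n IHn E nES ltE triv.
have [E1|ntE] := eqVneq (E : {set gT}) 1.
  by have <- : E = 1%G by apply: group_inj.
have [sES nE] := andP nES.
pose K := ([~: E, S] <*> 'Mho^1(E))%G.
have sKE : K \subset E.
  by rewrite join_subG commg_subl nE Mho_sub.
have nKS : K <| S.
  rewrite /normal (subset_trans sKE sES) normsY ?normsR ?normG //.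
  exact: char_norm_trans (Mho_char 1 E) nE.
have pE : p.-group E := pgroupS sES pS.
(* [E,S] is proper because S is nilpotent, and E^p lies in Phi(E), so it cannot help to generate
   E. *)
have prK : K \proper E.
  rewrite properEneq sKE andbT; apply/eqP=> eK.
  have prR : [~: E, S] \proper E.
    by apply: (nil_comm_properl (pgroup_nil pS)); rewrite // subsetI subxx.
  have sME : 'Mho^1(E) \subset 'Phi(E) by rewrite (Phi_joing pE) joing_subr.
  have : <<[~: E, S]>> = E.
    apply: Phi_nongen; apply/eqP; rewrite eqEsubset join_subG Phi_sub (proper_sub prR) /=.
    by rewrite -{1}eK /K /= join_subG joing_subr (subset_trans sME) ?joing_subl.
  by rewrite genGid => eR; rewrite eR properxx in prR.
apply: (IHn K) => //; first exact: leq_trans (proper_card prK) _.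
apply: (trivial_mod_step nES) => //.
apply: (tate_step nES) => //; first exact: joing_subl.
move=> x Ex; apply: (subsetP (joing_subr _ _)).
by rewrite (MhoE _ pE); apply: mem_gen; apply/imsetP; exists x.
Qed.

End TateTheorem.

(** * Cochains of a nerve *)

Lemma alternating_sum3 (R : pzRingType) (a b c : R) :
  ((-1) ^+ 0 * a + ((-1) ^+ 1 * b + ((-1) ^+ 2 * c + 0)) = a - b + c)%R.
Proof. by rewrite expr0 expr1 sqrrN expr1n !mul1r mulN1r addr0 !addrA. Qed.

Lemma alternating_sum4 (R : pzRingType) (a b c d : R) :
  ((-1) ^+ 0 * a + ((-1) ^+ 1 * b + ((-1) ^+ 2 * c + ((-1) ^+ 3 * d + 0))) =
   a - b + c - d)%R.
Proof.
by rewrite expr0 expr1 sqrrN expr1n exprS sqrrN expr1n mulr1 !mul1r !mulN1r addr0 !addrA.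
Qed.

Section NerveCochains.
Variables (p : nat) (C : catdata).
Local Open Scope ring_scope.
Local Notation rawT := (cobj C * seq (cmor C))%type.
Local Notation chains := (chains p C).

Definition raw_ok n (x : rawT) := nerve_ok x.1 x.2 && (size x.2 == n).

Lemma raw_ok_raw n (s : simplex C n) : raw_ok n (raw s).
Proof. by rewrite /raw_ok /raw /= size_tuple eqxx andbT; apply: valP s. Qed.

Lemma raw_inj n : injective (@raw C n).
Proof.
move=> s t e; apply: val_inj; move: e; rewrite /raw.
by case: (val s) (val t) => [x u] [y v] [-> /val_inj ->].
Qed.

Lemma raw_okP n x : raw_ok n x -> exists s : simplex C n, raw s = x.
Proof.
case: x => x s /andP[ok sz]; have ok' : nerve_ok (x, Tuple sz).1 (Tuple sz : n.-tuple _).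
  exact: ok.
by exists (Sub (x, Tuple sz) ok').
Qed.

(** A cochain extended by zero to raw pairs, so that faces are computed on lists without proofs that
    they are simplices. *)
Definition ev n (u : chains n) (x : rawT) : 'F_p :=
  \sum_(t : simplex C n) (if raw t == x then u t else 0).

Lemma ev_raw n (u : chains n) s : ev u (raw s) = u s.
Proof.
rewrite /ev (bigD1 s) //= eqxx big1 ?addr0 // => t /negbTE nts.
by rewrite (inj_eq (@raw_inj n)) nts.
Qed.

Lemma chains_ext n (u v : chains n) : (forall x, raw_ok n x -> ev u x = ev v x) -> u = v.
Proof. by move=> e; apply/ffunP=> s; rewrite -!ev_raw e ?raw_ok_raw. Qed.

Lemma evD n (u v : chains n) x : ev (u + v) x = ev u x + ev v x.
Proof.
rewrite /ev -big_split; apply: eq_bigr => t _ /=.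
by case: ifP => _; rewrite ?ffunE ?addr0.
Qed.

Lemma ev0 n x : ev (0 : chains n) x = 0.
Proof. by rewrite /ev big1 // => t _; case: ifP => // _; rewrite ffunE. Qed.

Definition mkc n (U : rawT -> 'F_p) : chains n := [ffun s => U (raw s)].

Lemma ev_mkc n U x : raw_ok n x -> ev (mkc n U) x = U x.
Proof. by case/raw_okP=> s <-; rewrite ev_raw ffunE. Qed.

Lemma ev_cobd n (u : chains n) x : raw_ok n.+1 x ->
  ev (cobd u) x = \sum_(i < n.+2) (-1) ^+ i * ev u (face C i x).
Proof.
case/raw_okP=> s <-; rewrite ev_raw ffunE; apply: eq_bigr => i _.
rewrite /ev big_distrr; apply: eq_bigr => t _ /=.
by case: ifP => _; rewrite ?mulr0.
Qed.

Definition comp1 f := cob C (csrc C f) && cvalid C f.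
Definition comp2 f g := [&& comp1 f, cvalid C g & csrc C g == ctgt C f].
Definition comp3 f g h := [&& comp2 f g, cvalid C h & csrc C h == ctgt C g].

Lemma raw_ok1P x : raw_ok 1 x -> exists2 f, comp1 f & x = (csrc C f, [:: f]).
Proof.
case: x => y [|f [|g s]]; rewrite /raw_ok /nerve_ok /= ?andbF ?andbT //.
by case/and3P=> oy vf /eqP e; exists f; rewrite /comp1 e ?oy.
Qed.

Lemma raw_ok2P x : raw_ok 2 x -> exists f g, comp2 f g /\ x = (csrc C f, [:: f; g]).
Proof.
case: x => y [|f [|g [|h s]]]; rewrite /raw_ok /nerve_ok /= ?andbF ?andbT //.
case/and5P=> oy vf /eqP e vg sg; exists f, g.
by rewrite /comp2 /comp1 e oy vf vg.
Qed.

Lemma raw_ok3P x : raw_ok 3 x -> exists f g h, comp3 f g h /\ x = (csrc C f, [:: f; g; h]).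
Proof.
case: x => y [|f [|g [|h [|k s]]]]; rewrite /raw_ok /nerve_ok /= ?andbF ?andbT //.
case/and5P=> oy vf /eqP e vg /and3P[sg vh sh]; exists f, g, h.
by rewrite /comp3 /comp2 /comp1 e oy vf vg sg vh sh.
Qed.

Lemma raw_ok1 f : comp1 f -> raw_ok 1 (csrc C f, [:: f]).
Proof. by rewrite /raw_ok /nerve_ok /comp1 /= eqxx !andbT. Qed.

Lemma raw_ok2 f g : comp2 f g -> raw_ok 2 (csrc C f, [:: f; g]).
Proof. by rewrite /raw_ok /nerve_ok /comp2 /comp1 /= eqxx !andbT -andbA. Qed.

Lemma raw_ok3 f g h : comp3 f g h -> raw_ok 3 (csrc C f, [:: f; g; h]).
Proof. by rewrite /raw_ok /nerve_ok /comp3 /comp2 /comp1 /= eqxx !andbT -!andbA. Qed.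

Hypothesis comp_src : forall f g, comp2 f g -> csrc C (ccomp C g f) = csrc C f.

Definition ev1 (u : chains 1) f := ev u (csrc C f, [:: f]).
(** The arguments follow the order of composition g o f, while the simplex lists f first. *)
Definition ev2 (u : chains 2) g f := ev u (csrc C f, [:: f; g]).

Lemma ev_cobd0 (a : chains 0) f : comp1 f ->
  ev1 (cobd a) f = ev a (ctgt C f, [::]) - ev a (csrc C f, [::]).
Proof.
move=> cf; rewrite /ev1 ev_cobd ?raw_ok1 // !big_ord_recl big_ord0 /=.
by rewrite !expr0 mul1r addr0 expr1 mulN1r.
Qed.

Lemma ev_cobd1 (a : chains 1) f g : comp2 f g ->
  ev2 (cobd a) g f = ev1 a g - ev1 a (ccomp C g f) + ev1 a f.
Proof.
move=> cfg; rewrite /ev2 ev_cobd ?raw_ok2 // !big_ord_recl big_ord0 /=.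
have /and3P[_ _ /eqP e] := cfg.
etransitivity; first exact: alternating_sum3.
by rewrite /ev1 comp_src // e.
Qed.

Lemma ev_cobd2 (a : chains 2) f g h : comp3 f g h ->
  ev (cobd a) (csrc C f, [:: f; g; h]) =
    ev2 a h g - ev2 a h (ccomp C g f) + ev2 a (ccomp C h g) f - ev2 a g f.
Proof.
move=> cfgh; rewrite ev_cobd ?raw_ok3 // !big_ord_recl big_ord0 /=.
have /and3P[cfg _ /eqP e2] := cfgh; have /and3P[_ _ /eqP e] := cfg.
etransitivity; first exact: alternating_sum4.
by rewrite /ev2 comp_src // e.
Qed.

End NerveCochains.

Section PullCochains.
Variables (p : nat) (C1 C2 : catdata) (fo : cobj C1 -> cobj C2) (fm : cmor C1 -> cmor C2).

Lemma ev_pull n (u : chains p C2 n) x : raw_ok n x ->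
  ev (pull fo fm u) x = ev u (fmap_raw fo fm x).
Proof. by case/raw_okP=> s <-; rewrite ev_raw ffunE. Qed.

End PullCochains.

(** * Cocycles on a linking system *)

Lemma prism_identity (R : comNzRingType) (fx fxy w1 w2 xy xf fy XY XYf yf : R) :
  (fx - fxy + w1 - xy = 0 -> xf - w2 + w1 - fy = 0 -> XY - w2 + XYf - yf = 0 ->
   XY - xy = (fxy - XYf) - (fx - xf) - (fy - yf))%R.
Proof.
move=> E1 E2 E3; apply/eqP; rewrite -subr_eq0; apply/eqP.
transitivity ((XY - w2 + XYf - yf) + (fx - fxy + w1 - xy) - (xf - w2 + w1 - fy))%R.
  by ring.
by rewrite E1 E2 E3 subr0 addr0.
Qed.

Section LinkingCocycles.
Variables (gT : finGroupType) (p : nat) (S : {group gT}) (F : fsys gT) (L : linking_data gT).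
Implicit Types (P Q : {group gT}) (f g h : lmor L).
Hypotheses (pS : p.-group S) (satF : saturated p S F) (linkL : linking_system S F L).
Let fusF : fusion_system S F := satF.1.
Local Notation Fm := (Fm S F).
Local Notation cent := (Fcentric S F).
Local Notation BS := (BScat S).
Local Notation BL := (Lcat S F L).
Local Notation src := (lsrc L).
Local Notation tgt := (ltgt L).
Local Notation comp := (lcomp L).
Local Notation delta := (ldelta L).
Local Notation pi := (lpi L).

Lemma cent_sub P : cent P -> P \subset S.
Proof. by case/andP. Qed.

Lemma src_cent f : cent (src f).
Proof. by case: linkL => [[H0 _ _ _ _] _]; case: (H0 f). Qed.

Lemma tgt_cent f : cent (tgt f).
Proof. by case: linkL => [[H0 _ _ _ _] _]; case: (H0 f). Qed.

Lemma lid_ends P : cent P -> src (lid L P) = P /\ tgt (lid L P) = P.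
Proof. by case: linkL => [[_ h _ _ _] _]; apply: h. Qed.

Lemma comp_ends f g : src f = tgt g -> src (comp f g) = src g /\ tgt (comp f g) = tgt f.
Proof. by case: linkL => [[_ _ h _ _] _]; apply: h. Qed.

Lemma compA f g h : src f = tgt g -> src g = tgt h -> comp f (comp g h) = comp (comp f g) h.
Proof. by case: linkL => [[_ _ _ H0 _] _]; apply: H0. Qed.

Lemma comp_idl f : comp (lid L (tgt f)) f = f.
Proof. by case: linkL => [[_ _ _ _ h] _]; case: (h f). Qed.

Lemma comp_idr f : comp f (lid L (src f)) = f.
Proof. by case: linkL => [[_ _ _ _ h] _]; case: (h f). Qed.

Lemma pi_F f : pi f \in F (src f) (tgt f).
Proof. by case: linkL => [_ [[h _ _] _]]; apply: h. Qed.

Lemma pi_comp f g : src f = tgt g -> pi (comp f g) = fcomp (src g) (pi f) (pi g).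
Proof. by case: linkL => [_ [[_ h _] _]]; apply: h. Qed.

Lemma pi_id P : cent P -> pi (lid L P) = conjm P 1.
Proof. by case: linkL => [_ [[_ _ h] _]]; apply: h. Qed.

Lemma delta_ends P x : cent P -> x \in P -> src (delta P x) = P /\ tgt (delta P x) = P.
Proof. by case: linkL => [_ [_ [h _]]] cP; have [+ _ _ _] := h P cP; apply. Qed.

Lemma deltaM P x y : cent P -> x \in P -> y \in P ->
  delta P (x * y) = comp (delta P x) (delta P y).
Proof. by case: linkL => [_ [_ [h _]]] cP; have [_ + _ _] := h P cP; apply. Qed.

Lemma lfree f z : z \in 'Z(src f) -> comp f (delta (src f) z) = f -> z = 1.
Proof.
case: linkL => [_ [_ [_ [h _]]]]; have [fr _ _] := h _ _ (src_cent f) (tgt_cent f).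
exact: fr.
Qed.

Lemma pi_lift P Q phi : cent P -> cent Q -> phi \in F P Q ->
  exists f, [/\ src f = P, tgt f = Q & pi f = phi].
Proof. by case: linkL => [_ [_ [_ [h _]]]] cP cQ; have [_ + _] := h P Q cP cQ; apply. Qed.

Lemma pi_lift_uniq f f' : src f = src f' -> tgt f = tgt f' -> pi f = pi f' ->
  exists2 z, z \in 'Z(src f) & f' = comp f (delta (src f) z).
Proof.
case: linkL => [_ [_ [_ [h _]]]]; have [_ _ un] := h _ _ (src_cent f) (tgt_cent f).
by move=> e1 e2 e3; apply: un.
Qed.

Lemma pi_delta P x : cent P -> x \in P -> pi (delta P x) = conjm P x.
Proof. by case: linkL => [_ [_ [_ [_ [h _]]]]]; apply: h. Qed.

Lemma delta_comm f x : x \in src f ->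
  comp f (delta (src f) x) = comp (delta (tgt f) (pi f x)) f.
Proof. by case: linkL => [_ [_ [_ [_ [_ h]]]]]; apply: h. Qed.

Lemma pi_in f x : x \in src f -> pi f x \in tgt f.
Proof.
move=> sx; have := pi_F f; rewrite (in_fsys fusF) ?cent_sub ?src_cent ?tgt_cent //.
by case/and3P=> _ /forall_inP h _; apply: h.
Qed.

Lemma pi_Fm f : Fm (src f) (pi f).
Proof.
have := pi_F f; rewrite (in_fsys fusF) ?cent_sub ?src_cent ?tgt_cent //.
by case/and3P.
Qed.

Lemma piM f : {in src f &, {morph pi f : x y / x * y}}.
Proof. by apply: Fm_M (pi_Fm f); rewrite ?cent_sub ?src_cent. Qed.

Lemma comp1_BL f : comp1 (C := BL) f.
Proof. by rewrite /comp1 /= src_cent. Qed.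

Lemma comp2_BL f g : comp2 (C := BL) f g = (src g == tgt f).
Proof. by rewrite /comp2 comp1_BL. Qed.

Lemma comp_src_BL f g : comp2 (C := BL) f g -> csrc BL (ccomp BL g f) = csrc BL f.
Proof. by rewrite comp2_BL => /eqP e; have [] := comp_ends e. Qed.

Lemma comp2_BS x y : comp2 (C := BS) x y = (x \in S) && (y \in S).
Proof. by rewrite /comp2 /comp1 /= andbT. Qed.

Lemma comp_src_BS x y : comp2 (C := BS) x y -> csrc BS (ccomp BS y x) = csrc BS x.
Proof. by []. Qed.

Local Open Scope ring_scope.

Definition cocycle1 (v : lmor L -> 'F_p) := forall f g, src g = tgt f ->
  v (comp g f) = v g + v f.

Definition cocycle2 (v : lmor L -> lmor L -> 'F_p) := forall f g h, src g = tgt f ->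
  src h = tgt g -> v h g - v h (comp g f) + v (comp h g) f - v g f = 0.

Definition gcocycle2 (u : gT -> gT -> 'F_p) := forall x y z, x \in S -> y \in S -> z \in S ->
  u z y - u z (y * x)%g + u (z * y)%g x - u y x = 0.

Lemma cobd1_eq0 (v : chains p BL 1) : cobd v = 0 <-> cocycle1 (ev1 v).
Proof.
split=> [v0 f g e|vc].
  have c2 : comp2 (C := BL) f g by rewrite comp2_BL e.
  have := ev_cobd1 (C := BL) comp_src_BL v c2; rewrite v0 /ev2 ev0 => /eqP.
  by rewrite eq_sym addrAC subr_eq0 => /eqP <-.
apply: chains_ext => x /raw_ok2P[f [g [c2 ->]]].
have e : src g = tgt f by move: (c2); rewrite comp2_BL => /eqP.
rewrite ev0; have := ev_cobd1 (C := BL) comp_src_BL v c2; rewrite /ev2 => ->.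
by rewrite (vc f g e) addrAC subrr.
Qed.

Lemma comp3_BL f g h : comp3 (C := BL) f g h = (src g == tgt f) && (src h == tgt g).
Proof. by rewrite /comp3 comp2_BL. Qed.

Lemma cobd2_eq0 (v : chains p BL 2) : cobd v = 0 <-> cocycle2 (ev2 v).
Proof.
split=> [v0 f g h e1 e2|vc].
  have c3 : comp3 (C := BL) f g h by rewrite comp3_BL e1 e2 !eqxx.
  by have := ev_cobd2 (C := BL) comp_src_BL v c3; rewrite v0 ev0.
apply: chains_ext => x /raw_ok3P[f [g [h [c3 ->]]]].
move: (c3); rewrite comp3_BL => /andP[/eqP e1 /eqP e2].
by rewrite ev0 (ev_cobd2 (C := BL) comp_src_BL v c3) vc.
Qed.

Lemma comp3_BS x y z : comp3 (C := BS) x y z = [&& x \in S, y \in S & z \in S].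
Proof. by rewrite /comp3 comp2_BS /= andbT -andbA. Qed.

Lemma gcobd1_eq0 (u : chains p BS 1) : cobd u = 0 <-> additive_on S (ev1 (C := BS) u).
Proof.
split=> [u0 x y Sx Sy|uc].
  have c2 : comp2 (C := BS) y x by rewrite comp2_BS Sx Sy.
  have := ev_cobd1 (C := BS) comp_src_BS u c2; rewrite u0 /ev2 ev0 => /eqP.
  by rewrite eq_sym addrAC subr_eq0 => /eqP <-.
apply: chains_ext => x /raw_ok2P[f [g [c2 ->]]].
move: (c2); rewrite comp2_BS => /andP[Sf Sg].
rewrite ev0; have := ev_cobd1 (C := BS) comp_src_BS u c2; rewrite /ev2 => ->.
by rewrite (uc g f Sg Sf) addrAC subrr.
Qed.

Lemma gcobd2_eq0 (u : chains p BS 2) : cobd u = 0 <-> gcocycle2 (ev2 (C := BS) u).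
Proof.
split=> [u0 x y z Sx Sy Sz|uc].
  have c3 : comp3 (C := BS) x y z by rewrite comp3_BS Sx Sy Sz.
  by have := ev_cobd2 (C := BS) comp_src_BS u c3; rewrite u0 ev0.
apply: chains_ext => x /raw_ok3P[f [g [h [c3 ->]]]].
move: (c3); rewrite comp3_BS => /and3P[Sf Sg Sh].
by rewrite ev0 (ev_cobd2 (C := BS) comp_src_BS u c3) uc.
Qed.

Lemma ev1_pull (v : chains p BL 1) x : x \in S ->
  ev1 (C := BS) (@pull p BS BL (@Bi_obj gT S) (@Bi_mor gT S L) _ v) x = ev1 v (delta S x).
Proof.
move=> Sx; have [e _] := delta_ends (Fcentric_S satF) Sx.
by rewrite /ev1 ev_pull ?raw_ok1 // /fmap_raw /= e.
Qed.

Lemma ev2_pull (v : chains p BL 2) x y : x \in S -> y \in S ->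
  ev2 (C := BS) (@pull p BS BL (@Bi_obj gT S) (@Bi_mor gT S L) _ v) x y = ev2 v (delta S x) (delta S y).
Proof.
move=> Sx Sy; have [e _] := delta_ends (Fcentric_S satF) Sy.
by rewrite /ev2 ev_pull ?raw_ok2 ?comp2_BS ?Sx ?Sy // /fmap_raw /= e.
Qed.

Lemma inclusion_lift P : cent P ->
  exists f, [/\ src f = P, tgt f = S & {in P, pi f =1 id}].
Proof.
move=> cP; have sPS := cent_sub cP.
have [|f [e1 e2 e3]] := pi_lift (phi := conjm P 1) cP (Fcentric_S satF).
  have [/subsetP sub _ _ _] := fusF sPS (subxx S) (subxx S).
  apply: sub; apply/imsetP; exists 1%g => //; rewrite inE group1 /=.
  by apply/subsetP=> _ /imsetP[x Px ->]; rewrite mul1g invg1 mulg1 (subsetP sPS).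
by exists f; split=> // x Px; rewrite e3 ffunE Px mul1g invg1 mulg1.
Qed.

Lemma aut_lift P s : cent P -> s \in AF S F P ->
  exists f, [/\ src f = P, tgt f = P & {in P, pi f =1 s}].
Proof.
move=> cP As; have sPS := cent_sub cP.
have [|f [e1 e2 e3]] := pi_lift (phi := [ffun x => if x \in P then s x else 1%g]) cP cP.
  by apply: (Fm_fsys fusF) => // [|x Px]; rewrite ?(AF_Fm satF) ?(AF_in satF).
by exists f; split=> // x Px; rewrite e3 ffunE Px.
Qed.

(** Evaluating v on both sides of axiom (C) and cancelling v(f). *)
Lemma cocycle1_delta v f x : cocycle1 v -> x \in src f ->
  v (delta (tgt f) (pi f x)) = v (delta (src f) x).
Proof.
move=> vc sx; have := congr1 v (delta_comm sx).
have [_ e1] := delta_ends (src_cent f) sx; have [e2 _] := delta_ends (tgt_cent f) (pi_in sx).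
by rewrite !vc ?e1 ?e2 // [RHS]addrC => /addrI.
Qed.

(* A natural transformation induces a cochain homotopy: k is the prism on f. *)
Lemma cocycle2_delta v f : cocycle2 v -> exists k : gT -> 'F_p,
  {in src f &, forall x y, v (delta (tgt f) (pi f x)) (delta (tgt f) (pi f y)) -
    v (delta (src f) x) (delta (src f) y) = k (x * y)%g - k x - k y}.
Proof.
move=> vc; exists (fun x => v f (delta (src f) x) - v (delta (tgt f) (pi f x)) f).
move=> x y sx sy; have sxy := groupM sx sy.
have [a1 a2] := delta_ends (src_cent f) sx; have [b1 b2] := delta_ends (src_cent f) sy.
have [c1 c2] := delta_ends (tgt_cent f) (pi_in sx).
have [d1 d2] := delta_ends (tgt_cent f) (pi_in sy).
have := vc (delta (src f) y) (delta (src f) x) f; rewrite a1 a2 b2 => /(_ erefl erefl) E1.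
have := vc (delta (src f) y) f (delta (tgt f) (pi f x)); rewrite b2 c1 => /(_ erefl erefl) E2.
have := vc f (delta (tgt f) (pi f y)) (delta (tgt f) (pi f x)).
rewrite d1 c1 d2 => /(_ erefl erefl) E3.
have e1 := delta_comm sx; have e2 := delta_comm sy.
have e3 := deltaM (src_cent f) sx sy.
have e4 : delta (tgt f) (pi f (x * y)%g) =
    comp (delta (tgt f) (pi f x)) (delta (tgt f) (pi f y)).
  by rewrite piM // deltaM ?tgt_cent ?pi_in.
rewrite e3 e4; rewrite e1 in E1; rewrite e2 in E2.
exact: prism_identity E1 E2 E3.
Qed.

End LinkingCocycles.

(** * Cohomology of a linking system *)

Lemma retraction_identity (R : comNzRingType) (a b c d e f g h k l : R) :
  (a - b + k - c = 0 -> d - l + k - e = 0 -> f - l + g - h = 0 ->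
   c = (a - d) - (b - g) + (e - h) + f)%R.
Proof.
move=> E1 E2 E3; apply/eqP; rewrite -subr_eq0; apply/eqP.
transitivity (- ((a - b + k - c) - (d - l + k - e) + (f - l + g - h)))%R.
  by ring.
by rewrite E1 E2 E3 subr0 addr0 oppr0.
Qed.

Section CohomologyIso.
Variables (gT : finGroupType) (p : nat) (S : {group gT}) (F : fsys gT) (L : linking_data gT).
Implicit Types (P Q : {group gT}) (f g h : lmor L).
Hypotheses (pS : p.-group S) (satF : saturated p S F) (linkL : linking_system S F L).
Let fusF : fusion_system S F := satF.1.
Local Notation Fm := (Fm S F).
Local Notation cent := (Fcentric S F).
Local Notation BS := (BScat S).
Local Notation BL := (Lcat S F L).
Local Notation src := (lsrc L).
Local Notation tgt := (ltgt L).
Local Notation comp := (lcomp L).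
Local Notation delta := (ldelta L).
Local Notation pi := (lpi L).
Local Notation coh_iso := (@cohomology_iso p BS BL (@Bi_obj gT S) (@Bi_mor gT S L)).
Let centS : cent S := Fcentric_S satF.

Local Open Scope ring_scope.

Definition cochain1 (C : catdata) (u : cmor C -> 'F_p) : chains p C 1 :=
  mkc 1 (fun x : cobj C * seq (cmor C) => if x.2 is [:: f] then u f else 0).

Definition cochain2 (C : catdata) (u : cmor C -> cmor C -> 'F_p) : chains p C 2 :=
  mkc 2 (fun x : cobj C * seq (cmor C) => if x.2 is [:: f; g] then u g f else 0).

Lemma ev1_cochain1 (C : catdata) (u : cmor C -> 'F_p) (f : cmor C) : comp1 f -> ev1 (cochain1 u) f = u f.
Proof. by move=> cf; rewrite /ev1 ev_mkc ?raw_ok1. Qed.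

Lemma ev2_cochain2 (C : catdata) (u : cmor C -> cmor C -> 'F_p) (f g : cmor C) :
  comp2 f g -> ev2 (cochain2 u) g f = u g f.
Proof. by move=> cf; rewrite /ev2 ev_mkc ?raw_ok2. Qed.

(** [chi] is the restriction of a cocycle of L, exactly and not just up to coboundary, since degree
    0 coboundaries vanish on a one-object category. The cocycle is then compared along lifts of the
    inclusion of P in S and of s. *)
Lemma H1_stable (chi : gT -> 'F_p) P (s : {perm gT}) x : coh_iso 0 -> additive_on S chi ->
  cent P -> s \in AF S F P -> x \in P -> chi (s x) = chi x.
Proof.
move=> [surj _] chiM cP As Px; have sPS := cent_sub cP.
have [|v [v0 [a ea]]] := surj (cochain1 (C := BS) chi).
  apply/gcobd1_eq0 => y z Sy Sz; rewrite !ev1_cochain1 //; first exact: chiM.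
  by rewrite /comp1 /= groupM.
have ec y : y \in S -> chi y = ev1 v (delta S y).
  move=> Sy; rewrite -(ev1_pull satF linkL) // -(@ev1_cochain1 BS chi y Sy) ea.
  by rewrite /ev1 evD -/(ev1 _ _) -[X in _ + X]/(ev1 _ _) ev_cobd0 // subrr addr0.
have vc := (cobd1_eq0 linkL v).1 v0.
have [f [e1 e2 e3]] := aut_lift satF linkL cP As.
have [i [i1 i2 i3]] := inclusion_lift satF linkL cP.
have vP y : y \in P -> ev1 v (delta S y) = ev1 v (delta P y).
  move=> Py; have Py' : y \in src i by rewrite i1.
  by have := cocycle1_delta satF linkL vc Py'; rewrite i1 i2 i3.
have Psx : s x \in P by rewrite (AF_in satF).
rewrite !ec ?(subsetP sPS) // !vP //.
have Px' : x \in src f by rewrite e1.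
by have := cocycle1_delta satF linkL vc Px'; rewrite e1 e2 e3.
Qed.

(** [k] collects three corrections: the homotopy for the lift of s, the homotopy for the inclusion
    of P at s x and at x, and the coboundary by which u differs from a restricted cocycle. *)
Lemma H2_stable (u : gT -> gT -> 'F_p) P (s : {perm gT}) : coh_iso 1 -> gcocycle2 S u ->
    cent P -> s \in AF S F P ->
  exists k : gT -> 'F_p, {in P &, forall x y,
    u (s x) (s y) - u x y = k (x * y)%g - k x - k y}.
Proof.
move=> [surj _] uc cP As; have sPS := cent_sub cP.
have [|v [v0 [a ea]]] := surj (cochain2 (C := BS) u).
  apply/gcobd2_eq0 => x y z Sx Sy Sz.
  by rewrite !ev2_cochain2 ?comp2_BS ?Sx ?Sy ?Sz ?groupM //; apply: uc.
have eu x y : x \in S -> y \in S -> u x y = ev2 v (delta S x) (delta S y) +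
    (ev1 (C := BS) a x - ev1 (C := BS) a (x * y)%g + ev1 (C := BS) a y).
  move=> Sx Sy; have c2 : comp2 (C := BS) y x by rewrite comp2_BS Sx Sy.
  rewrite -(ev2_pull satF linkL) // -(@ev2_cochain2 BS u y x c2) ea.
  by rewrite /ev2 evD -[X in _ + X]/(ev2 _ _ _) (ev_cobd1 (C := BS) (@comp_src_BS _ S)).
have vc := (cobd2_eq0 linkL v).1 v0.
have [f [e1 e2 e3]] := aut_lift satF linkL cP As.
have [i [i1 i2 i3]] := inclusion_lift satF linkL cP.
have [k1 ek1] := cocycle2_delta satF linkL f vc; rewrite e1 e2 in ek1.
have [k2 ek2] := cocycle2_delta satF linkL i vc; rewrite i1 i2 in ek2.
have Ps x : x \in P -> s x \in P by move=> Px; rewrite (AF_in satF).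
exists (fun x => k1 x + k2 (s x) - k2 x - ev1 (C := BS) a (s x) + ev1 (C := BS) a x).
move=> x y Px Py; have SP := subsetP sPS.
have sM : (s (x * y) = s x * s y)%g := Fm_M fusF sPS (AF_Fm satF sPS As) Px Py.
rewrite !eu ?SP ?Ps // sM.
have E1 := ek1 _ _ Px Py; rewrite !e3 // in E1.
have E2 := ek2 _ _ Px Py; rewrite !i3 // in E2.
have E3 := ek2 _ _ (Ps _ Px) (Ps _ Py); rewrite !i3 ?Ps // in E3.
move/(canRL (subrK _)): E2 => ->; move/(canRL (subrK _)): E3 => ->.
move/(canRL (subrK _)): E1 => ->.
by ring.
Qed.

Section Retraction.
Hypothesis nilF : nilpotent_fs S F.

Lemma cent_self P : cent P -> 'C_S(P) \subset P.
Proof.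
case/andP=> sPS /forallP/(_ P)/implyP; apply; rewrite sPS /=.
by apply/(FconjP fusF sPS sPS); exists id; [apply: Fm_id | apply: group_inj; rewrite /= imset_id genGid].
Qed.

(** The lift at S is taken to be the identity, so that the resulting functor restricts to the
    identity on S. *)
Lemma inclusions : exists iota : {group gT} -> lmor L,
  [/\ forall P, cent P -> [/\ src (iota P) = P, tgt (iota P) = S & {in P, pi (iota P) =1 id}]
    & iota S = lid L S].
Proof.
have [iota iP] : exists iota : {group gT} -> lmor L, forall P, cent P ->
    [/\ src (iota P) = P, tgt (iota P) = S, {in P, pi (iota P) =1 id} & P = S -> iota P = lid L S].
  apply: (@fin_all_exists {group gT} (fun=> lmor L) (fun P i => cent P ->
    [/\ src i = P, tgt i = S, {in P, pi i =1 id} & P = S -> i = lid L S])) => P.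
  have [cP|ncP] := boolP (cent P); last by exists (lid L P).
  have [eP|nP] := eqVneq P S.
    exists (lid L S) => _; have [e1 e2] := lid_ends linkL centS.
    rewrite eP e1 e2; split=> // x Sx.
    by rewrite (pi_id linkL) // ffunE Sx mul1g invg1 mulg1.
  have [i [e1 e2 e3]] := inclusion_lift satF linkL cP.
  by exists i => _; split=> // e; rewrite e eqxx in nP.
by exists iota; split=> [P cP|]; [have [] := iP P cP | have [_ _ _] := iP S centS; apply].
Qed.

Lemma retraction : exists (iota : {group gT} -> lmor L) (r : lmor L -> gT),
  [/\ forall P, cent P -> src (iota P) = P /\ tgt (iota P) = S,
      forall f, r f \in S /\ comp (iota (tgt f)) f = comp (delta S (r f)) (iota (src f)),
      forall f g, src g = tgt f -> r (comp g f) = (r g * r f)%g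
    & forall x, x \in S -> r (delta S x) = x].
Proof.
have [iota [iP iS]] := inclusions.
have dE x : x \in S -> src (delta S x) = S /\ tgt (delta S x) = S by move=> Sx; apply: (delta_ends linkL).
have is_ P : cent P -> src (iota P) = P by case/iP.
have it P : cent P -> tgt (iota P) = S by case/iP.
have piI P x : cent P -> x \in P -> pi (iota P) x = x by case/iP=> _ _ + Px; apply.
have shift P z : cent P -> z \in P ->
    comp (iota P) (delta P z) = comp (delta S z) (iota P).
  move=> cP Pz; have Pz' : z \in src (iota P) by rewrite is_.
  by have := delta_comm linkL Pz'; rewrite is_ // it // piI.
have dI x P : x \in S -> cent P -> src (delta S x) = tgt (iota P).
  by move=> Sx cP; rewrite it //; have [] := dE x Sx.
have dMI x y P : x \in S -> y \in S -> cent P ->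
    comp (delta S x) (comp (delta S y) (iota P)) = comp (delta S (x * y)%g) (iota P).
  move=> Sx Sy cP; have [e1 e2] := dE x Sx; have [e3 e4] := dE y Sy.
  by rewrite (compA linkL) ?e1 ?e3 ?e4 ?it // (deltaM linkL).
(* Applying pi shows that x^-1 y centralizes P, so it lies in P since P is centric; freeness of the
   action of Z(P) makes it 1. *)
have uniq P x y : cent P -> x \in S -> y \in S ->
    comp (delta S x) (iota P) = comp (delta S y) (iota P) -> x = y.
  move=> cP Sx Sy e; have sPS := cent_sub cP.
  pose c := (x^-1 * y)%g; have Sc : c \in S by rewrite groupM ?groupV.
  have [f1 f2] := comp_ends linkL (dI x P Sx cP).
  have Cc : c \in 'C_S(P).
    rewrite inE Sc; apply/centP=> z Pz.
    have := congr1 (fun f : lmor L => pi f z) e.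
    rewrite !(pi_comp linkL) ?(dI _ P) // is_ // !ffunE Pz piI // !(pi_delta linkL) //.
    rewrite !ffunE (subsetP sPS) // => e1.
    have e2 : (y * z = x * z * x^-1 * y)%g by rewrite e1 mulgKV.
    by rewrite /commute /c -mulgA e2 !mulgA mulVg mul1g.
  have Pc : c \in P := subsetP (cent_self cP) c Cc.
  have Zc : c \in 'Z(src (comp (delta S x) (iota P))).
    by rewrite f1 is_ // inE Pc; have /setIP[] := Cc.
  suff c1 : c = 1%g by rewrite -[y](mulKVg x) -/c c1 mulg1.
  apply: (lfree linkL Zc); rewrite f1 is_ //.
  have [d1 d2] := delta_ends linkL cP Pc.
  rewrite -(compA linkL) ?(dI _ P) ?is_ ?d2 // shift // dMI // /c mulKVg.
  exact: esym e.
(* As pi f is conjugation by some g in S, both composites P -> S lie over the same morphism and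
   differ by some z in Z(P). Moving z across the inclusion gives r f = gz. *)
have [r rP] : exists r : lmor L -> gT, forall f, r f \in S /\
    comp (iota (tgt f)) f = comp (delta S (r f)) (iota (src f)).
  apply: (@fin_all_exists (lmor L) (fun=> gT) (fun f x => x \in S /\
    comp (iota (tgt f)) f = comp (delta S x) (iota (src f)))) => f.
  have cP := src_cent linkL f; have cQ := tgt_cent linkL f.
  have sPS := cent_sub cP; have sQS := cent_sub cQ.
  have /imsetP[g /setIdP[Sg _] eg] : pi f \in HomS S (src f) (tgt f).
    by rewrite -nilF // (pi_F linkL).
  have sI : src (iota (tgt f)) = tgt f by apply: is_.
  have [a1 a2] := comp_ends linkL (dI g _ Sg cP).
  have [b1 b2] := comp_ends linkL sI.
  have [dg1 dg2] := dE g Sg.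
  have [|||z] := pi_lift_uniq linkL (f := comp (delta S g) (iota (src f))) (f' := comp (iota (tgt f)) f).
  - by rewrite a1 b1 is_.
  - by rewrite a2 b2 it // dg2.
  - rewrite !(pi_comp linkL) ?(dI _ (src f)) // is_ //; apply/ffunP=> x; rewrite !ffunE.
    case: ifP => // Px; rewrite piI // (pi_delta linkL) // ffunE (subsetP sPS) //.
    rewrite piI ?(pi_in satF linkL) // eg ffunE Px.
    by [].
  rewrite a1 is_ // => /setIP[Pz _] ->; have Sz := subsetP sPS z Pz.
  exists (g * z)%g; split; first exact: groupM.
  have [d1 d2] := delta_ends linkL cP Pz.
  by rewrite -(compA linkL) ?(dI _ (src f)) ?is_ ?d2 // shift // dMI.
exists iota, r; split=> // [P cP|f g e|x Sx].
- by have [] := iP P cP.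
- have [Sf ef] := rP f; have [Sg eg] := rP g; have [a1 a2] := comp_ends linkL e.
  have [Sgf] := rP (comp g f); rewrite a1 a2 => egf.
  have cf := src_cent linkL f; have cg := src_cent linkL g; have ctg := tgt_cent linkL g.
  apply: (uniq (src f)) => //; first exact: groupM.
  rewrite -egf (compA linkL) ?is_ // eg -(compA linkL) ?(dI _ (src g)) ?is_ // e ef dMI //.
have [Sr] := rP (delta S x); have [e1 e2] := dE x Sx; rewrite e1 e2 => e.
apply: (uniq S) => //; rewrite -e iS.
have := comp_idl linkL (delta S x); rewrite e2 => ->.
by have := comp_idr linkL (delta S x); rewrite e1 => ->.
Qed.

Lemma nilpotent_coh_iso0 : coh_iso 0.
Proof.
have [iota [r [iP rP rM rS]]] := retraction.
have dE x : x \in S -> src (delta S x) = S /\ tgt (delta S x) = S by move=> Sx; apply: (delta_ends linkL).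
split=> [u u0|v v0 [a ea]].
  have uM := (gcobd1_eq0 u).1 u0.
  exists (cochain1 (C := BL) (fun f => ev1 (C := BS) u (r f))); split.
    apply/(cobd1_eq0 linkL) => f g e; rewrite !ev1_cochain1 ?(comp1_BL linkL) // rM //.
    by apply: uM; [case: (rP g) | case: (rP f)].
  exists 0; apply: chains_ext => x /raw_ok1P[g Sg ->].
  rewrite evD -[RHS]/(ev1 _ _ + ev1 _ _) (ev1_pull satF linkL) // ev_cobd0 // !ev0 subrr addr0.
  by rewrite ev1_cochain1 ?(comp1_BL linkL) // rS.
have vc := (cobd1_eq0 linkL v).1 v0.
have vS x : x \in S -> ev1 v (delta S x) = 0.
  by move=> Sx; rewrite -(ev1_pull satF linkL) // ea ev_cobd0 // subrr.
(* As v vanishes on S, the square defining r gives v(f) = v(iota(src f)) - v(iota(tgt f)); this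
   accounts for the sign. *)
exists (mkc 0 (fun x : cobj BL * seq (cmor BL) => - ev1 v (iota x.1))).
apply: chains_ext => x /raw_ok1P[f cf ->].
rewrite -[LHS]/(ev1 v f) -[RHS]/(ev1 _ f) ev_cobd0 // !ev_mkc; last first.
- by rewrite /raw_ok /nerve_ok /= (tgt_cent linkL f).
- by rewrite /raw_ok /nerve_ok /= (src_cent linkL f).
have [Sr er] := rP f; have [is_ it] := iP _ (src_cent linkL f).
have [is' it'] := iP _ (tgt_cent linkL f); have [d1 d2] := dE _ Sr.
have := congr1 (ev1 v) er; rewrite !vc ?is' ?it ?d1 // vS // add0r /= => <-.
by rewrite opprK addrA addNr add0r.
Qed.

Lemma nilpotent_coh_iso1 : coh_iso 1.
Proof.
have [iota [r [iP rP rM rS]]] := retraction.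
have dE x : x \in S -> src (delta S x) = S /\ tgt (delta S x) = S by move=> Sx; apply: (delta_ends linkL).
have rin f : r f \in S by case: (rP f).
split=> [u u0|v v0 [a ea]].
  have uM := (gcobd2_eq0 u).1 u0.
  exists (cochain2 (C := BL) (fun g f => ev2 (C := BS) u (r g) (r f))); split.
    apply/(cobd2_eq0 linkL) => f g h e1 e2.
    have [a1 a2] := comp_ends linkL e1; have [b1 b2] := comp_ends linkL e2.
    rewrite !ev2_cochain2 ?(comp2_BL linkL) ?a1 ?a2 ?b1 ?b2 ?e1 ?e2 // !rM //.
    exact: uM.
  exists 0; apply: chains_ext => x /raw_ok2P[f [g [c2 ->]]].
  move: (c2); rewrite comp2_BS => /andP[Sf Sg].
  rewrite evD -[RHS]/(ev2 _ g f + ev2 _ g f) (ev2_pull satF linkL) //.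
  rewrite (ev_cobd1 (C := BS) (@comp_src_BS _ S)) // /ev1 !ev0 subrr !addr0.
  have [f1 f2] := dE f Sf; have [g1 g2] := dE g Sg.
  by rewrite ev2_cochain2 ?(comp2_BL linkL) ?g1 ?f2 // !rS.
have vc := (cobd2_eq0 linkL v).1 v0.
have vS x y : x \in S -> y \in S -> ev2 v (delta S x) (delta S y) =
    ev1 (C := BS) a x - ev1 (C := BS) a (x * y)%g + ev1 (C := BS) a y.
  move=> Sx Sy; rewrite -(ev2_pull satF linkL) // ea.
  by rewrite (ev_cobd1 (C := BS) (@comp_src_BS _ S)) // comp2_BS Sx Sy.
(* The first two terms are the homotopy given by the inclusions, between v and its pullback through
   r; the last is the given primitive on S composed with r. *)
exists (cochain1 (C := BL) (fun f => ev2 v (iota (tgt f)) f -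
  ev2 v (delta S (r f)) (iota (src f)) + ev1 (C := BS) a (r f))).
apply: chains_ext => x /raw_ok2P[f [g [c2 ->]]].
rewrite -[LHS]/(ev2 v g f) -[RHS]/(ev2 _ g f) (ev_cobd1 (C := BL) (comp_src_BL linkL)) //.
rewrite !ev1_cochain1 ?(comp1_BL linkL) //=.
have e : src g = tgt f by move: c2; rewrite (comp2_BL linkL) => /eqP.
have [a1 a2] := comp_ends linkL e; rewrite a1 a2 rM //.
have [is1 it1] := iP _ (src_cent linkL f); have [is2 it2] := iP _ (tgt_cent linkL f).
have [is3 it3] := iP _ (tgt_cent linkL g).
have [Sf ef] := rP f; have [Sg eg] := rP g.
have [df1 df2] := dE _ Sf; have [dg1 dg2] := dE _ Sg.
have E1 := vc f g (iota (tgt g)) e is3.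
have E2 := vc f (iota (tgt f)) (delta S (r g)) is2 (etrans dg1 (esym it2)).
have E3 := vc (iota (src f)) (delta S (r f)) (delta S (r g)) (etrans df1 (esym it1)) (etrans dg1 (esym df2)).
rewrite eg e in E1; rewrite ef in E2; rewrite -(deltaM linkL) // in E3.
rewrite (retraction_identity E1 E2 E3) vS // e.
by ring.
Qed.

End Retraction.
End CohomologyIso.

(** * Duality of homology and cohomology *)

Section MatrixDuality.
Variable K : fieldType.
Local Open Scope ring_scope.

(** The column space of B is contained in the annihilator of its left kernel and has the same
    dimension. *)
Lemma kermx_colP m n (B : 'M[K]_(m, n)) (y : 'cV_m) :
  kermx B *m y = 0 -> exists a : 'cV_n, y = B *m a.
Proof.
move=> Ky; have sub : (y^T <= kermx (kermx B)^T)%MS.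
  by rewrite sub_kermx -trmx_mul Ky trmx0.
have sB : (B^T <= kermx (kermx B)^T)%MS.
  by rewrite sub_kermx -trmx_mul mulmx_ker trmx0.
have : (kermx (kermx B)^T <= B^T)%MS.
  rewrite -(geq_leqif (mxrank_leqif_sup sB)) mxrank_ker !mxrank_tr mxrank_ker.
  by rewrite subKn // rank_leq_row.
move=> /(submx_trans sub)/submxP[a ea]; exists a^T.
by rewrite -[y]trmxK ea trmx_mul trmxK.
Qed.

Lemma submx_colP m1 m2 n (X : 'M[K]_(m1, n)) (Z : 'M[K]_(m2, n)) :
  (forall y : 'cV_n, Z *m y = 0 -> X *m y = 0) -> (X <= Z)%MS.
Proof.
move=> h; rewrite submxE; have := mulmx_coker Z; move: (cokermx Z) => W ZW.
apply/eqP/matrixP=> i j; have := h (W *m delta_mx j 0); rewrite !mulmxA ZW mul0mx.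
by move=> /(_ erefl); rewrite -colE => /matrixP/(_ i 0); rewrite !mxE.
Qed.

Variables c0 c1 d0 d1 d2 : nat.
Variables (A1 : 'M[K]_(c1, c0)) (B1 : 'M[K]_(d1, d0)) (B2 : 'M[K]_(d2, d1)) (P : 'M[K]_(c1, d1)).

(* Both sides say that the annihilators of ker B1 and of (ker A1) P + im B2
   coincide. *)
Lemma surj_dual_inj :
  (forall z : 'rV_d1, z *m B1 = 0 -> exists w : 'rV_c1, w *m A1 = 0 /\
     exists b : 'rV_d2, z = w *m P + b *m B2) <->
  (forall y : 'cV_d1, B2 *m y = 0 -> (exists a : 'cV_c0, P *m y = A1 *m a) ->
     exists a' : 'cV_d0, y = B1 *m a').
Proof.
split=> [surj y By [a Py]|inj z zB].
  apply: kermx_colP; apply/row_matrixP=> i; rewrite row_mul row0.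
  have [|w [wA [b ->]]] := surj (row i (kermx B1)); first by rewrite -row_mul mulmx_ker row0.
  by rewrite mulmxDl -!mulmxA Py By mulmx0 addr0 mulmxA wA mul0mx.
have sub : (kermx B1 <= kermx A1 *m P + B2)%MS.
  apply: submx_colP => y Zy.
  have [Ay By] : kermx A1 *m P *m y = 0 /\ B2 *m y = 0.
    split.
      have /submxP[D ->] := addsmxSl (kermx A1 *m P) B2.
      by rewrite -mulmxA Zy mulmx0.
    have /submxP[D ->] := addsmxSr (kermx A1 *m P) B2.
    by rewrite -mulmxA Zy mulmx0.
  rewrite -mulmxA in Ay; have [a' ->] := inj y By (kermx_colP Ay).
  by rewrite mulmxA mulmx_ker mul0mx.
have : (z <= kermx A1 *m P + B2)%MS by apply: submx_trans sub; rewrite sub_kermx zB.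
case/sub_addsmxP=> [[u1 u2]] /= ez; exists (u1 *m kermx A1); split.
  by rewrite -mulmxA mulmx_ker mulmx0.
by exists u2; rewrite ez mulmxA.
Qed.

End MatrixDuality.

(** * From matrices to functions on finite sets *)

Section FunctionDuality.
Variable K : fieldType.
Local Open Scope ring_scope.

Definition fmx (I J : finType) (k : I -> J -> K) : 'M[K]_(#|I|, #|J|) :=
  \matrix_(i, j) k (enum_val i) (enum_val j).

Definition frow (I : finType) (c : {ffun I -> K}) : 'rV[K]_#|I| := \row_i c (enum_val i).

Definition ffrow (I : finType) (v : 'rV[K]_#|I|) : {ffun I -> K} :=
  [ffun i => v 0 (enum_rank i)].

Lemma frowK (I : finType) : cancel (@frow I) (@ffrow I).
Proof. by move=> c; apply/ffunP=> i; rewrite ffunE mxE enum_rankK. Qed.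

Lemma ffrowK (I : finType) : cancel (@ffrow I) (@frow I).
Proof. by move=> v; apply/rowP=> i; rewrite mxE ffunE enum_valK. Qed.

Lemma frowD (I : finType) (c d : {ffun I -> K}) : frow (c + d) = frow c + frow d.
Proof. by apply/rowP=> i; rewrite !mxE ffunE. Qed.

Lemma frow0 (I : finType) : frow (0 : {ffun I -> K}) = 0.
Proof. by apply/rowP=> i; rewrite !mxE ffunE. Qed.

Definition fpush (I J : finType) (k : I -> J -> K) (c : {ffun I -> K}) : {ffun J -> K} :=
  [ffun t => \sum_s c s * k s t].

Definition fpull (I J : finType) (k : I -> J -> K) (u : {ffun J -> K}) : {ffun I -> K} :=
  [ffun s => \sum_t k s t * u t].

Lemma frow_push (I J : finType) (k : I -> J -> K) c : frow (fpush k c) = frow c *m fmx k.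
Proof.
apply/rowP=> j; rewrite !mxE ffunE (reindex (@enum_val I I)) /=.
  by apply: eq_bigr => i _; rewrite !mxE.
by apply: onW_bij; apply: enum_val_bij.
Qed.

Lemma frow_pull (I J : finType) (k : I -> J -> K) u : frow (fpull k u) = frow u *m (fmx k)^T.
Proof.
apply/rowP=> j; rewrite !mxE ffunE (reindex (@enum_val J J)) /=.
  by apply: eq_bigr => i _; rewrite !mxE mulrC.
by apply: onW_bij; apply: enum_val_bij.
Qed.

Variables (C0 C1 D0 D1 D2 : finType).
Variables (a1 : C1 -> C0 -> K) (b1 : D1 -> D0 -> K) (b2 : D2 -> D1 -> K) (q : C1 -> D1 -> K).

Lemma fsurj_dual_inj :
  (forall z, fpush b1 z = 0 -> exists w, fpush a1 w = 0 /\
     exists b, z = fpush q w + fpush b2 b) <->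
  (forall y, fpull b2 y = 0 -> (exists a, fpull q y = fpull a1 a) ->
     exists a', y = fpull b1 a').
Proof.
have frow_inj I := can_inj (@frowK I).
have eq0 (I : finType) (c : {ffun I -> K}) : frow c = 0 <-> c = 0.
  by split=> [e|->]; [apply: (frow_inj I); rewrite e frow0 | apply: frow0].
split=> [surj y by0 [a ea]|inj z zb].
  have [|||a' ea'] := (surj_dual_inj (fmx a1) (fmx b1) (fmx b2) (fmx q)).1 _ (frow y)^T.
  - move=> z zb; have [|w [wa [b e]]] := surj (ffrow z).
      by apply/eq0; rewrite frow_push ffrowK.
    exists (frow w); split; first by rewrite -frow_push wa frow0.
    by exists (frow b); rewrite -!frow_push -frowD -e ffrowK.
  - by apply: trmx_inj; rewrite trmx_mul trmxK -frow_pull by0 frow0 trmx0.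
  - exists (frow a)^T; apply: trmx_inj.
    by rewrite !trmx_mul !trmxK -!frow_pull ea.
  exists (ffrow a'^T); apply: frow_inj; rewrite frow_pull ffrowK -trmx_mul -ea'.
  by rewrite trmxK.
have [||w [wa [b e]]] := (surj_dual_inj (fmx a1) (fmx b1) (fmx b2) (fmx q)).2 _ (frow z).
- move=> y by0 [a ea]; have [||a' ea'] := inj (ffrow y^T).
  + by apply/eq0; rewrite frow_pull ffrowK -trmx_mul by0 trmx0.
  + by exists (ffrow a^T); apply: frow_inj; rewrite !frow_pull !ffrowK -!trmx_mul ea.
  exists (frow a')^T; apply: trmx_inj; rewrite trmx_mul trmxK -frow_pull -ea'.
  by rewrite ffrowK.
- by rewrite -frow_push zb frow0.
exists (ffrow w); split; first by apply/eq0; rewrite frow_push ffrowK.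
by exists (ffrow b); apply: frow_inj; rewrite frowD !frow_push !ffrowK.
Qed.

End FunctionDuality.

(** * Boundary and induced maps as transposed matrices *)

Section HomologyDuality.
Variables (p : nat) (C1 C2 : catdata) (fo : cobj C1 -> cobj C2) (fm : cmor C1 -> cmor C2).
Local Open Scope ring_scope.

Definition bdmx (C : catdata) n (s : simplex C n.+1) (t : simplex C n) : 'F_p :=
  \sum_(i < n.+2) (if face C i (raw s) == raw t then (-1) ^+ i else 0).

Definition pushmx n (s : simplex C1 n) (t : simplex C2 n) : 'F_p :=
  if fmap_raw fo fm (raw s) == raw t then 1 else 0.

Lemma bdE (C : catdata) n (c : chains p C n.+1) : bd c = fpush (@bdmx C n) c.
Proof.
apply/ffunP=> t; rewrite !ffunE; apply: eq_bigr => s _; rewrite big_distrr /=.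
by apply: eq_bigr => i _; case: ifP => _; rewrite ?mulr0 // mulrC.
Qed.

Lemma cobdE (C : catdata) n (u : chains p C n) : cobd u = fpull (@bdmx C n) u.
Proof.
apply/ffunP=> s; rewrite !ffunE exchange_big; apply: eq_bigr => t _ /=.
rewrite big_distrl; apply: eq_bigr => i _ /=.
by rewrite eq_sym; case: ifP => _; rewrite ?mul0r.
Qed.

Lemma pushE n (c : chains p C1 n) : push fo fm c = fpush (@pushmx n) c.
Proof.
apply/ffunP=> t; rewrite !ffunE; apply: eq_bigr => s _.
by rewrite /pushmx; case: ifP => _; rewrite ?mulr1 ?mulr0.
Qed.

Lemma pullE n (u : chains p C2 n) : pull fo fm u = fpull (@pushmx n) u.
Proof.
apply/ffunP=> s; rewrite !ffunE; apply: eq_bigr => t _.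
by rewrite /pushmx eq_sym; case: ifP => _; rewrite ?mul1r ?mul0r.
Qed.

(** [D1] matches surjectivity on homology with injectivity on cohomology; [D2], for the transposed
    kernels, matches injectivity on homology with surjectivity on cohomology. *)
Lemma homology_cohomology_iso n :
  @homology_iso p C1 C2 fo fm n <-> @cohomology_iso p C1 C2 fo fm n.
Proof.
have D1 := fsurj_dual_inj (@bdmx C1 n) (@bdmx C2 n) (@bdmx C2 n.+1) (@pushmx n.+1).
have D2 := fsurj_dual_inj (fun t s => @bdmx C2 n.+1 s t) (fun t s => @bdmx C1 n.+1 s t)
   (fun t s => @bdmx C1 n s t) (fun t s => @pushmx n.+1 s t).
have tr (I J : finType) (k : I -> J -> 'F_p) c : fpush (fun t s => k s t) c = fpull k c.
  by apply/ffunP=> i; rewrite !ffunE; apply: eq_bigr => t _; rewrite mulrC.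
have tr' (I J : finType) (k : I -> J -> 'F_p) c : fpull (fun t s => k s t) c = fpush k c.
  by apply/ffunP=> i; rewrite !ffunE; apply: eq_bigr => t _; rewrite mulrC.
rewrite /homology_iso /cohomology_iso; split=> [[surj inj]|[surj inj]]; split.
- move=> u; rewrite cobdE -tr => u0.
  have [|w [w0 [b ->]]] := D2.2 _ u u0.
    move=> y; rewrite !tr' => y0 [a ea]; have [||b eb] := inj y; rewrite ?bdE //.
      by exists a; rewrite pushE ea tr' bdE.
    by exists b; rewrite tr' eb bdE.
  by exists w; rewrite cobdE -tr; split=> //; exists b; rewrite pullE cobdE !tr.
- move=> v; rewrite cobdE => v0 [a ea].
  have [||a' ->] := D1.1 _ v v0.
  + move=> z; rewrite -bdE => z0; have [w [w0 [b ->]]] := surj z z0.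
    by exists w; rewrite -bdE; split=> //; exists b; rewrite pushE bdE.
  + by exists a; rewrite -pullE ea cobdE.
  by exists a'; rewrite cobdE.
- move=> z; rewrite bdE => z0.
  have [|w [w0 [b ->]]] := D1.2 _ z z0.
    move=> y; rewrite -cobdE => y0 [a ea]; have [|a' ->] := inj y y0.
      by exists a; rewrite pullE ea cobdE.
    by exists a'; rewrite cobdE.
  by exists w; rewrite bdE; split=> //; exists b; rewrite pushE bdE.
move=> w; rewrite bdE -tr' => w0 [b eb].
have [||b' ->] := D2.1 _ w w0.
- move=> u; rewrite tr -cobdE => u0; have [v [v0 [a ->]]] := surj u u0.
  by exists v; rewrite tr -cobdE; split=> //; exists a; rewrite pullE cobdE !tr.
- by exists b; rewrite !tr' -pushE -bdE.
by exists b'; rewrite bdE tr'.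
Qed.

End HomologyDuality.

(** * The theorem *)

Lemma carry_cocycle_identity (R : comNzRingType) (a b c d : R) :
  (a + b = c + d -> a - c + b - d = 0)%R.
Proof. by move=> e; transitivity ((a + b) - (c + d))%R; [ring | rewrite e subrr]. Qed.

Lemma carry_lift_identity (R : comNzRingType) (x y xy c sx sy sxy d kx ky kxy : R) :
  (x + y = c + xy -> sx + sy = d + sxy -> d - c = kxy - kx - ky ->
   sxy - xy + kxy = (sx - x + kx) + (sy - y + ky))%R.
Proof.
move=> e1 e2 e3; apply/eqP; rewrite -subr_eq0; apply/eqP.
transitivity (((x + y) - (c + xy)) - ((sx + sy) - (d + sxy)) - ((d - c) - (kxy - kx - ky)))%R.
  by ring.
by rewrite e1 e2 e3 !subrr ?subr0.
Qed.

(** A maximal subgroup M missing w has index p, and [chi] is the discrete logarithm to base w in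
    S/M. *)
Lemma Phi_detect (gT : finGroupType) (p : nat) (S : {group gT}) w :
    prime p -> p.-group S -> w \in S -> w \notin 'Phi(S) ->
  exists2 chi : gT -> 'F_p, additive_on S chi & chi w != 0%R.
Proof.
move=> prp pS Sw nPw.
have [M maxM nMw] : exists2 M : {group gT}, maximal M S & w \notin M.
  apply/exists_inP; apply: contraNT nPw; rewrite negb_exists_in => /forall_inP h.
  apply/bigcapP=> M; rewrite /maximal_eq => /orP[/eqP e|maxM]; first by rewrite e.
  by have := h M maxM; rewrite negbK.
have nMS := p_maximal_normal pS maxM; have iM := p_maximal_index pS maxM.
have NM := subsetP (normal_norm nMS).
have cw1 : coset M w != 1 by apply: contra nMw => /eqP/coset_idr; apply; apply: NM.
have ow : #[coset M w] = p.
  have dv : #[coset M w] %| p by rewrite -iM -card_quotient ?normal_norm // order_dvdG ?mem_quotient.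
  by have /primeP[_ /(_ _ dv)/orP[|/eqP//]] := prp; rewrite order_eq1 (negbTE cw1).
have gQ x : x \in S -> exists i : nat, coset M x = coset M w ^+ i.
  move=> Sx; apply/cycleP; suff -> : <[coset M w]> = S / M by apply: mem_quotient.
  apply/eqP; rewrite eqEcard cycle_subG mem_quotient //= card_quotient ?normal_norm //.
  by rewrite iM -orderE ow.
have [dl dlP] : exists dl : gT -> nat, forall x, x \in S -> coset M x = coset M w ^+ dl x.
  apply: (@fin_all_exists gT (fun=> nat) (fun x i => x \in S -> coset M x = coset M w ^+ i)) => x.
  case: (boolP (x \in S)) => [/gQ[i ei]|_]; last by exists 0%N.
  by exists i.
have dl_eq i j : coset M w ^+ i = coset M w ^+ j -> (i%:R = j%:R :> 'F_p)%R.
  move/eqP; rewrite eq_expg_mod_order ow => /eqP e.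
  by rewrite -[LHS](Fp_nat_mod prp) e Fp_nat_mod.
exists (fun x => (dl x)%:R)%R => [x y Sx Sy|].
  rewrite -natrD; apply: dl_eq; rewrite -dlP ?groupM // expgD -!dlP //.
  by rewrite morphM ?NM.
have -> : ((dl w)%:R = 1%:R :> 'F_p)%R by apply: dl_eq; rewrite -dlP // expg1.
exact: oner_neq0.
Qed.

(** Linear characters of S have common kernel S'. Their values are powers of a fixed primitive
    |S|-th root of unity, and [chi] is the exponent, kept as a natural number so that carries can be
    formed. *)
Lemma der1_detect (gT : finGroupType) (S : {group gT}) w : w \in S -> w \notin S^`(1) ->
  exists chi : gT -> nat, [/\ forall x, x \in S -> chi x < #|S|,
    {in S &, forall x y, chi (x * y) = ((chi x + chi y) %% #|S|)%N} & chi w != 0%N].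
Proof.
move=> Sw; rewrite -cap_cfker_lin_irr => nw.
have [i lin_i nker] : exists2 i, ('chi[S]_i)%R \is a linear_char & w \notin cfker ('chi_i)%R.
  apply/exists_inP; apply: contraNT nw; rewrite negb_exists_in => /forall_inP h.
  by apply/bigcapP=> i li; have := h i li; rewrite negbK.
have [z prz] := C_prim_root_exists (cardG_gt0 S).
have [chi chiP] : exists chi : gT -> nat, forall x, x \in S ->
    chi x < #|S| /\ ('chi_i x = z ^+ chi x)%R.
  apply: (@fin_all_exists gT (fun=> nat) (fun x j => x \in S ->
    j < #|S| /\ ('chi_i x = z ^+ j)%R)) => x.
  case: (boolP (x \in S)) => [Sx|_]; last by exists 0%N.
  have : ('chi_i x ^+ #|S| = 1)%R.
    by rewrite -lin_charX // expg_cardG // lin_char1.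
  by case/(prim_rootP prz)=> j ej; exists j => _.
exists chi; split=> [x /chiP[]//|x y Sx Sy|].
  have [_ ex] := chiP x Sx; have [_ ey] := chiP y Sy.
  have [lxy exy] := chiP _ (groupM Sx Sy).
  have : (z ^+ chi (x * y)%g == z ^+ (chi x + chi y))%R.
    by rewrite -exy exprD -ex -ey lin_charM.
  by rewrite (eq_prim_root_expr prz) (modn_small lxy) => /eqP.
apply: contra nker => /eqP e; have [_ ew] := chiP w Sw.
by rewrite cfkerEirr inE ew e expr0 lin_char1.
Qed.

(** * Focal elements through Alperin's theorem *)

Section FocalAlperin.
Variables (gT : finGroupType) (p : nat) (S : {group gT}) (F : fsys gT).
Implicit Types (P Q : {group gT}) (f g : gT -> gT).
Hypotheses (pS : p.-group S) (satF : saturated p S F).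
Let fusF : fusion_system S F := satF.1.
Local Notation Fm := (Fm S F).

(** [C] selects the elements to be controlled. It must be preserved by morphisms, because in a
    composite the second factor is applied to the image of the element. *)
Lemma focal_alperin (K : {group gT}) (C : {group gT} -> gT -> bool) : K <| S ->
    (forall P Q x, Q \subset P -> C Q x -> C P x) ->
    (forall P f x, P \subset S -> Fm P f -> x \in P -> C P x -> C (homimg f P) (f x)) ->
    (forall Q (s : {perm gT}) x, Fcentric S F Q -> s \in AF S F Q -> x \in Q -> C Q x ->
       s x * x^-1 \in K) ->
  forall P f x, P \subset S -> Fm P f -> x \in P -> C P x -> f x * x^-1 \in K.
Proof.
move=> nKS Cmono Chom Caut.
suff main P f : P \subset S -> Fm P f ->
    forall x, x \in P -> C P x -> f x * x^-1 \in K.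
  by move=> P f x sPS Ff Px Cx; apply: main Cx.
move: P f; apply: (alperin_ind pS satF).
- by move=> P f g e h x Px Cx; rewrite -e ?h.
- by move=> P Q f sQP sPS Ff h x Qx Cx; apply: h (Cmono _ _ _ sQP Cx); apply: (subsetP sQP).
- move=> P f g sPS Ff Fg hf hg x Px Cx /=.
  rewrite -[g (f x)](mulgKV (f x)) -mulgA groupM ?hf // hg ?mem_homimg //.
  exact: Chom.
- move=> P f g sPS Ff Fg fK h y fy Cy; have sfS := homimg_sub fusF sPS Ff.
  have gim : homimg g (homimg f P) = P.
    rewrite -(homimg_comp fusF) // (@eq_homimg _ P _ id) //.
    by apply: group_inj; rewrite /= imset_id genGid.
  have CPy := Chom _ _ _ sfS Fg fy Cy; rewrite gim in CPy.
  move: fy CPy; rewrite (homimgE fusF) // => /imsetP[x Px ->]; rewrite fK // => Cx.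
  by have := h x Px Cx; rewrite -groupV invMg invgK.
move=> Q s sQS cQ fnQ As x Qx Cx; exact: (Caut Q).
Qed.

Lemma der1_homimg P f x : P \subset S -> Fm P f -> x \in P^`(1) -> f x \in (homimg f P)^`(1).
Proof.
move=> sPS Ff Px; pose m := Morphism (Fm_M fusF sPS Ff).
have -> : homimg f P = m @* P :> {set gT} by rewrite (homimgE fusF) // morphimEdom.
by rewrite -morphim_der //; apply: (mem_morphim m); rewrite // (subsetP (der_sub 1 P)).
Qed.

End FocalAlperin.

(* For chi : S -> Z/q the class of u is the Bockstein of chi: its invariance
   under s yields a lift of chi o s - chi to Z/pq which is a homomorphism on Q. *)
Lemma carry_stable (gT : finGroupType) (p : nat) (S : {group gT}) (F : fsys gT)
    (L : linking_data gT) (Q : {group gT}) (s : {perm gT}) g :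
    prime p -> p.-group S -> saturated p S F -> linking_system S F L ->
    @cohomology_iso p (BScat S) (Lcat S F L) (@Bi_obj gT S) (@Bi_mor gT S L) 1 ->
    Fcentric S F Q -> s \in AF S F Q -> g \in Q -> g ^+ p \in Q^`(1) ->
  s g * g^-1 \in S^`(1).
Proof.
move=> prp pS satF linkL iso2 cQ As Qg gp; have sQS := cent_sub cQ.
have SQ x : x \in Q -> x \in S by apply: (subsetP sQS).
have sQ x : x \in Q -> s x \in Q by move=> Qx; rewrite (AF_in satF).
have Sg := SQ g Qg; have Ssg := SQ _ (sQ _ Qg).
have Sw : s g * g^-1 \in S by rewrite groupM ?groupV.
apply: contraT => /(der1_detect Sw)[chi [chi_lt chiM chi_w]].
pose q := #|S|; have q_gt0 : 0 < q := cardG_gt0 S.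
(* [car] is the carry of the addition of exponents modulo q, a 2-cocycle representing the Bockstein
   of [chi]. *)
pose car x y := ((chi x + chi y) %/ q)%N.
have carE x y : x \in S -> y \in S -> (chi x + chi y = car x y * q + chi (x * y)%g)%N.
  by move=> Sx Sy; rewrite chiM // -divn_eq.
have [|k ek] := @H2_stable _ p S F L satF linkL (fun x y => (car x y)%:R)%R Q s iso2 _ cQ As.
  move=> x y z Sx Sy Sz; apply: carry_cocycle_identity.
  have e : (car z y + car (z * y)%g x = car z (y * x)%g + car y x)%N.
    apply/eqP; rewrite -(eqn_pmul2r q_gt0) !mulnDl; apply/eqP.
    have e1 := carE z y Sz Sy; have e2 := carE _ x (groupM Sz Sy) Sx.
    have e3 := carE z _ Sz (groupM Sy Sx); have e4 := carE y x Sy Sx.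
    rewrite mulgA in e3; move: e1 e2 e3 e4.
    move: (car z y * q)%N (car (z * y)%g x * q)%N (car z (y * x)%g * q)%N (car y x * q)%N.
    move: (chi z) (chi y) (chi x) (chi (z * y)%g) (chi (y * x)%g) (chi (z * y * x)%g).
    by clear; lia.
  by rewrite -!natrD e.
have pq_gt1 : 1 < q * p.
  by apply: leq_trans (prime_gt1 prp) _; rewrite leq_pmull.
pose Z := 'Z_(q * p).
(* [e] is the additive embedding of F_p in Z/pq as the multiples of q. *)
pose e (a : 'F_p) : Z := ((q * a)%:R)%R.
have natrE a b : (a%:R = b%:R :> Z)%R <-> a = b %[mod q * p].
  split=> [/(congr1 val)|h]; first by rewrite /= !val_Zp_nat.
  by apply: val_inj; rewrite /= !val_Zp_nat.
have e_nat n : (e n%:R = (q * n)%:R)%R.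
  by apply/natrE; rewrite val_Fp_nat // -!muln_modr modn_mod.
have eD : {morph e : a b / (a + b)%R}.
  move=> a b; have nat_a (c : 'F_p) : (c = (c : nat)%:R)%R.
    by apply: val_inj; rewrite /= val_Fp_nat // modn_small // -{2}(Fp_cast prp) ltn_ord.
  by rewrite {1}(nat_a a) {1}(nat_a b) -natrD e_nat mulnDr natrD.
have eB : {morph e : a b / (a - b)%R}.
  by move=> a b; apply: (addIr (e b)); rewrite subrK -eD subrK.
pose H x : Z := ((chi (s x))%:R - (chi x)%:R + e (k x))%R.
have HM : additive_on Q H.
  move=> x y Qx Qy.
  have c1 : ((chi x + chi y)%:R = (q * car x y + chi (x * y)%g)%:R :> Z)%R.
    by rewrite carE ?SQ // [(q * car x y)%N]mulnC.
  have sM := Fm_M satF.1 sQS (AF_Fm satF sQS As) Qx Qy.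
  have c2 : ((chi (s x) + chi (s y))%:R = (q * car (s x) (s y) + chi (s (x * y)%g))%:R :> Z)%R.
    by rewrite sM carE ?SQ ?sQ // [(q * car _ _)%N]mulnC.
  have := congr1 e (ek x y Qx Qy); rewrite !eB !e_nat => c3.
  by rewrite !natrD in c1 c2; apply: carry_lift_identity c1 c2 c3.
(* g^p lies in Q', where the homomorphism [H] vanishes. The unknown term [e (k g)] is also killed by
   p, so p chi(s g) = p chi(g) modulo pq, and both values of [chi] are below q. *)
have Hg : (H g *+ p = 0)%R.
  by rewrite -(additive_onX HM) // (additive_on_der1 HM).
have ep : (e (k g) *+ p = 0)%R.
  rewrite /e -mulrnA -[0%R]/(0%:R : Z)%R; apply/natrE.
  by rewrite mulnAC modnMr mod0n.
have eqg : chi (s g) = chi g.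
  move: Hg; rewrite /H mulrnDl ep addr0 mulrnBl -!mulrnA => /eqP.
  rewrite subr_eq0 => /eqP/natrE.
  have lt x : x \in S -> chi x * p < q * p by move=> Sx; rewrite ltn_pmul2r ?prime_gt0 ?chi_lt.
  by rewrite !modn_small ?lt // => /eqP; rewrite eqn_pmul2r ?prime_gt0 // => /eqP.
have := chiM _ _ Sw Sg; rewrite mulgKV eqg => e0.
have : chi (s g * g^-1) + chi g = 0 + chi g %[mod q] by rewrite add0n -e0 (modn_small (chi_lt g Sg)).
move/eqP; rewrite eqn_modDr mod0n modn_small ?chi_lt // => /eqP e1.
by rewrite e1 in chi_w.
Qed.

Section MainTheorem.
Variables (gT : finGroupType) (p : nat) (S : {group gT}) (F : fsys gT) (L : linking_data gT).
Hypotheses (prp : prime p) (pS : p.-group S) (satF : saturated p S F).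
Hypothesis linkL : linking_system S F L.
Local Notation coh_iso :=
  (@cohomology_iso p (BScat S) (Lcat S F L) (@Bi_obj gT S) (@Bi_mor gT S L)).

Lemma coh_iso0_nilpotent : coh_iso 0 -> nilpotent_fs S F.
Proof.
move=> iso1; apply: (tate_nilpotent prp pS satF) => P f g sPS Ff Pg.
apply: (focal_alperin pS satF (C := fun _ _ => true)) Ff Pg _ => //; first exact: Phi_normal.
move=> Q s x cQ As Qx _; have sQS := cent_sub cQ.
have Sx := subsetP sQS x Qx.
have Ssx : s x \in S by apply: (subsetP sQS); rewrite (AF_in satF).
apply: contraT => nPhi.
have [|chi chiM] := Phi_detect prp pS _ nPhi; first by rewrite groupM ?groupV.
rewrite chiM ?groupV // (additive_onV chiM) //.
by rewrite (H1_stable satF linkL iso1 chiM cQ As Qx) subrr eqxx.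
Qed.

Lemma coh_iso1_nilpotent : coh_iso 1 -> nilpotent_fs S F.
Proof.
move=> iso2; apply: (tate_nilpotent prp pS satF) => P f g sPS Ff Pg.
have sDPhi : S^`(1) \subset 'Phi(S) by rewrite (Phi_joing pS) joing_subl.
apply: (subsetP sDPhi); apply: (focal_der1 prp pS satF) Ff Pg => // Q h x sQS Fh Qx.
apply: (focal_alperin pS satF (C := fun R y => y ^+ p \in R^`(1))) Fh Qx => //.
- exact: der_normal.
- by move=> R T y sTR; apply: (subsetP (dergS 1 sTR)).
- move=> R k y sRS Fk Ry Cy; rewrite -(Fm_X satF.1 sRS Fk) //.
  exact: (der1_homimg satF).
by move=> R s y cR As Ry; apply: (carry_stable prp pS satF linkL iso2).
Qed.

End MainTheorem.

(** Each of the four conditions is shown equivalent to nilpotency separately; index n of the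
    isomorphism predicates stands for degree n + 1. *)
Theorem theorem3p2 (gT : finGroupType) (p : nat) (S : {group gT})
    (F : fsys gT) (L : linking_data gT) :
  prime p -> (p.-group S)%g -> saturated p S F -> linking_system S F L ->
  let BS := BScat S in
  let BL := Lcat S F L in
  let fo := @Bi_obj gT S in
  let fm := @Bi_mor gT S L in
  [/\ nilpotent_fs S F <-> @cohomology_iso p BS BL fo fm 0,
      nilpotent_fs S F <-> @cohomology_iso p BS BL fo fm 1,
      nilpotent_fs S F <-> @homology_iso p BS BL fo fm 0
    & nilpotent_fs S F <-> @homology_iso p BS BL fo fm 1].
Proof.
move=> prp pS satF linkL BS BL fo fm.
have iso0 : nilpotent_fs S F <-> @cohomology_iso p BS BL fo fm 0.
  by split; [apply: nilpotent_coh_iso0 | apply: coh_iso0_nilpotent].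
have iso1 : nilpotent_fs S F <-> @cohomology_iso p BS BL fo fm 1.
  by split; [apply: nilpotent_coh_iso1 | apply: coh_iso1_nilpotent].
by split=> //; [apply: (iff_trans iso0) | apply: (iff_trans iso1)];
   apply: iff_sym; apply: homology_cohomology_iso.
Qed.
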